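(* Consider Activated Random Walks on $\mathbb{Z}^d$, $d\geqslant1$, with jump distribution $p(\cdot)$ and i.i.d. initial configuration $\eta_0$ with density $\mathbb{E}|\eta_0(\boldsymbol{0})|=1$ and positive variance. Then, for all $\lambda\in(0,\infty]$, the system almost surely stays active.
   Context: Activated Random Walk (ARW) on $\mathbb{Z}^d$. Fix $d\geqslant1$, a sleep rate $0<\lambda\leqslant\infty$ and a jump distribution $p(\cdot)$, i.e. a probability distribution on $\mathbb{Z}^d$ supported on the nearest neighbors $\{\pm e_1,\dots,\pm e_d\}$ of the origin $\boldsymbol{0}$ and whose support generates the group $\mathbb{Z}^d$. Let $\mathbb{N}_0=\{0,1,2,\dots\}$ and $\mathbb{N}_{\mathfrak{s}}=\mathbb{N}_0\cup\{\mathfrak{s}\}$, ordered by $0<\mathfrak{s}<1<2<\cdots$, with $|\mathfrak{s}|=1$, $|n|=n$, $\mathfrak{s}+1=2$, $1\cdot\mathfrak{s}=\mathfrak{s}$ and $n\cdot\mathfrak{s}=n$ for $n\geqslant2$. A configuration is $\eta\in(\mathbb{N}_{\mathfrak{s}})^{\mathbb{Z}^d}$: site $x$ contains $\eta(x)$ active particles if $\eta(x)\in\mathbb{N}_0$ and one sleeping particle if $\eta(x)=\mathfrak{s}$; $|\eta(x)|$ is the number of particles at $x$. Evolution for $\lambda<\infty$: at each site $x$ a clock rings at rate $(1+\lambda)\,\eta_t(x)\,\mathbf{1}_{\{\eta_t(x)\neq\mathfrak{s}\}}$. When it rings, with probability $\frac{\lambda}{1+\lambda}$ the value $\eta(x)$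 is replaced by $\eta(x)\cdot\mathfrak{s}$; otherwise, with probability $\frac{p(y-x)}{1+\lambda}$ for each $y$, $\eta(x)$ is replaced by $\eta(x)-1$ and $\eta(y)$ by $\eta(y)+1$. Evolution for $\lambda=\infty$: an active particle that is alone at a site falls asleep instantaneously, so a particle is sleeping if and only if it is alone at its site (in particular every value $\eta_0(x)=1$ becomes $\mathfrak{s}$ at time $0$). A site with $n\geqslant2$ particles (all active) sends a particle away at rate $n$, to a site $y$ chosen with probability $p(y-x)$; if one particle is left at $x$ it immediately falls asleep, and a particle arriving at a site with a sleeping particle wakes it up ($\mathfrak{s}+1=2$). For a translation-ergodic (in particular i.i.d.) initial distribution $\nu$ with finite density there is a process $(\eta_t)_{t\geqslant0}$ with this evolution and $\eta_0\sim\nu$; its law $\mathbf{P}^{\nu}$ is characterized by $\mathbf{P}^{\nu}(\mathcal{A})=\lim_{V\uparrow\mathbb{Z}^d}\mathbf{P}^{\nu}_V(\mathcal{A})$ for every event $\mathcal{A}$ determined by $(\eta_s(x))_{x\in B,\,s\in[0,t]}$ with $B$ finite and $t<\infty$, where $\mathbf{P}^{\nu}_V$ is the law of the (finite) system started from $\eta_0\cdot\mathbf{1}_V$, $V$ finite. The system stays active if, for each site, there are arbitrarily large times at which the site has at least one active particle. It fixates if, for each site, there is a (random) time after which the site is always either vacant or occupied by exactly one sleeping particle. *)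

(* Defs.v *)
From HB Require Import structures.
From mathcomp Require Import all_boot all_order all_algebra finmap.
From mathcomp Require Import all_classical all_reals all_analysis.
From mathcomp.analysis.showcase Require Import summability.

Set Implicit Arguments.
Unset Strict Implicit.
Unset Printing Implicit Defensive.

Import Order.TTheory GRing.Theory Num.Theory.
Import numFieldNormedType.Exports.

Local Open Scope classical_set_scope.
Local Open Scope ring_scope.

Notation lattice d := 'rV[int]_d.

(* [Active n] is the value n of N_s, [Sleeping] is the value s. *)
Variant site_state := Active of nat | Sleeping.

Definition option_of_site_state (a : site_state) : option nat :=
  if a is Active n then Some n else None.

Definition site_state_of_option (o : option nat) : site_state :=
  if o is Some n then Active n else Sleeping.

Lemma option_of_site_stateK :
  cancel option_of_site_state site_state_of_option.
Proof. by case. Qed.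

HB.instance Definition _ :=
  Countable.copy site_state (can_type option_of_site_stateK).
HB.instance Definition _ := isPointed.Build site_state (Active 0).

Definition num_particles (a : site_state) : nat :=
  if a is Active n then n else 1.

Definition num_active (a : site_state) : nat :=
  if a is Active n then n else 0.

(* a + 1, with s + 1 = 2 *)
Definition add_particle (a : site_state) : site_state :=
  if a is Active n then Active n.+1 else Active 2.

(* a - 1, only ever used at sites with an active particle *)
Definition remove_particle (a : site_state) : site_state :=
  if a is Active n then Active n.-1 else Sleeping.

(* a * s, with 1 * s = s and n * s = n for n >= 2 *)
Definition try_sleep (a : site_state) : site_state :=
  if a is Active 1 then Sleeping else a.

Definition config (d : nat) := lattice d -> site_state.

HB.instance Definition _ d := Pointed.on (config d).

Definition config_cylinders d : set (set (config d)) :=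
  [set E | exists x a, E = [set eta : config d | eta x = a]].

HB.instance Definition _ d :=
  Measurable.copy (config d) (g_sigma_algebraType (@config_cylinders d)).

Definition finite_config d (xi : config d) : Prop :=
  finite_set [set x | xi x != Active 0].

(* eta * 1_V *)
Definition restrict_config d (V : {fset lattice d}) (eta : config d) :
  config d := fun x => if x \in V then eta x else Active 0.

Definition sleep_at d (x : lattice d) (xi : config d) : config d :=
  fun z => if z == x then try_sleep (xi z) else xi z.

Definition jump d (x y : lattice d) (xi : config d) : config d :=
  fun z => if z == x then remove_particle (xi z)
           else if z == y then add_particle (xi z) else xi z.

(* Every active particle that is alone at its site falls asleep. *)
Definition sleep_everywhere d (xi : config d) : config d :=
  fun z => try_sleep (xi z).

Definition neighbors_of_origin d : set (lattice d) :=
  [set z | exists i, z = delta_mx 0 i \/ z = - delta_mx 0 i].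

Definition is_subgroup d (H : set (lattice d)) : Prop :=
  H 0 /\ forall x y, H x -> H y -> H (x - y).

Definition jump_distribution (R : realType) d (p : lattice d -> R) : Prop :=
  [/\ forall z, 0 <= p z,
      \sum_(z \in [set: lattice d]) p z = 1,
      [set z | p z != 0] `<=` @neighbors_of_origin d
    & smallest (@is_subgroup d) [set z | p z != 0] = [set: lattice d]].

(* Generators of the evolutions.  They are evaluated at finite configurations
   only, and jump distributions have finite support, so that all the sums have
   finitely many nonzero terms. *)
Definition generator_finite (R : realType) d (p : lattice d -> R) (lambda : R)
    (f : config d -> R) (xi : config d) : R :=
  \sum_(x \in [set: lattice d])
    (1 + lambda) * (num_active (xi x))%:R *
    (lambda / (1 + lambda) * f (sleep_at x xi) +
     \sum_(y \in [set: lattice d]) p (y - x) / (1 + lambda) * f (jump x y xi)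
     - f xi).

Definition generator_infinite (R : realType) d (p : lattice d -> R)
    (f : config d -> R) (xi : config d) : R :=
  \sum_(x \in [set x : lattice d | (2 <= num_active (xi x))%N])
    (num_active (xi x))%:R *
    (\sum_(y \in [set: lattice d])
       p (y - x) * f (sleep_everywhere (jump x y xi)) - f xi).

(* The value at lambda = -oo is irrelevant. *)
Definition generator (R : realType) d (p : lattice d -> R) (lambda : \bar R) :
    (config d -> R) -> config d -> R :=
  if lambda is r%:E then generator_finite p r else generator_infinite p.

(* The transition function exp (t L) of the Markov jump process with generator
   L.  From a finite configuration with n particles all the jump rates are
   bounded by (1 + lambda) n (by n if lambda = +oo), so the series converges. *)
Definition transition (R : realType) d (p : lattice d -> R) (lambda : \bar R)
    (t : R) (xi xi' : config d) : R :=
  limn (series (fun k : nat =>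
    t ^+ k / k`!%:R * iter k (generator p lambda) (\1_[set xi']) xi)).

(* Each site has right-continuous trajectories with left limits in the
   discrete space of site states. *)
Definition cadlag (R : realType) d (w : R -> config d) : Prop :=
  forall x t, 0 <= t ->
    (\forall s \near t^'+, w s x = w t x) /\
    (0 < t -> exists a, \forall s \near t^'-, w s x = a).

(* The times are the nonnegative reals; the values at negative times play no
   role. *)
Record trajectory (R : realType) (d : nat) := Trajectory {
  trajectory_fun :> R -> config d;
  trajectory_cadlag : cadlag trajectory_fun }.

Lemma cadlag_vacant (R : realType) d :
  cadlag (fun (_ : R) (_ : lattice d) => Active 0).
Proof.
move=> x t t0; split; first exact: nearW.
by move=> _; exists (Active 0); exact: nearW.
Qed.

HB.instance Definition _ R d := gen_eqMixin (trajectory R d).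
HB.instance Definition _ R d := gen_choiceMixin (trajectory R d).
HB.instance Definition _ R d :=
  isPointed.Build (trajectory R d) (Trajectory (@cadlag_vacant R d)).

Definition trajectory_cylinders (R : realType) d (D : set R)
    (B : set (lattice d)) : set (set (trajectory R d)) :=
  [set E | exists s x a,
    [/\ D s, B x & E = [set w : trajectory R d | w s x = a]]].

HB.instance Definition _ R d :=
  Measurable.copy (trajectory R d)
    (g_sigma_algebraType
      (@trajectory_cylinders R d [set t | 0 <= t] [set: lattice d])).

(* The events determined by the values w s x with x in B and 0 <= s <= t. *)
Definition event_upto (R : realType) d (B : set (lattice d)) (t : R) :
    set (set (trajectory R d)) :=
  <<s trajectory_cylinders `[0, t] B >>.

Definition initial_config d (R : realType) (lambda : \bar R)
    (V : {fset lattice d}) (eta : config d) : config d :=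
  if lambda == +oo%E then sleep_everywhere (restrict_config V eta)
  else restrict_config V eta.

(* Q is the law of the finite system started from eta_0 * 1_V, eta_0 ~ nu. *)
Definition finite_arw_law (R : realType) d (p : lattice d -> R)
    (lambda : \bar R) (nu : probability (config d) R) (V : {fset lattice d})
    (Q : probability (trajectory R d) R) : Prop :=
  (forall A : set (config d), measurable A ->
    Q [set w | A (w 0)] = nu [set eta | A (initial_config lambda V eta)]) /\
  (forall (s t : R) (F : set (trajectory R d)) (xi xi' : config d),
    0 <= s -> 0 <= t -> event_upto [set: lattice d] s F -> finite_config xi ->
    Q (F `&` [set w | w s = xi] `&` [set w | w (s + t) = xi']) =
    (Q (F `&` [set w | w s = xi]) * (transition p lambda t xi xi')%:E)%E).

(* [totally] is the filter of finite sets increasing to the whole lattice. *)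
Definition arw_law (R : realType) d (p : lattice d -> R) (lambda : \bar R)
    (nu : probability (config d) R) (P : probability (trajectory R d) R) :
    Prop :=
  exists PV : {fset lattice d} -> probability (trajectory R d) R,
    (forall V, finite_arw_law p lambda nu V (PV V)) /\
    (forall (B : {fset lattice d}) (t : R) (A : set (trajectory R d)),
      0 <= t -> event_upto [set` B] t A ->
      (fun V => PV V A) @ totally --> P A).

Definition iid (R : realType) d (nu : probability (config d) R) : Prop :=
  (forall (x : lattice d) (A : set site_state),
    nu [set eta | A (eta x)] = nu [set eta | A (eta 0)]) /\
  (forall (B : {fset lattice d}) (A : lattice d -> set site_state),
    nu [set eta | forall x, x \in B -> A x (eta x)] =
    (\prod_(x <- B) nu [set eta | A x (eta x)])%E).

Definition particles_at_origin (R : realType) d (eta : config d) : R :=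
  (num_particles (eta 0))%:R.

Definition stays_active (R : realType) d (w : trajectory R d) : Prop :=
  forall (x : lattice d) (T : R),
    exists t, [/\ 0 <= t, T <= t & (0 < num_active (w t x))%N].

(* Main.v *)
(** If a site [o] hosted no active particle during [[T, T + S]], then on that
    interval every box [U] around [o] would be stabilized by its own particles
    without a toppling at [o].  Discounting each toppling at [o] by 1/2, the
    expected value [w] of 2^-(number of topplings at [o]) in the stabilization
    of [U] can only decrease on average under illegal topplings and arrivals of
    particles, and increases by a factor 2 at most at each legal toppling at
    [o].  Following it along the dynamics bounds the probability of inactivity
    by 2^m E[w], plus the probability of more than [m] topplings at [o] before
    time [T] (Markov's inequality), plus the probability that [U] is still
    unstable at time [T + S].  It remains to see that E[w] tends to 0 as [U]
    grows.

    The stabilization leaves one particle or none at each site, so that the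
    limiting density of vacant sites ("holes") in large boxes is at least
    1 minus the initial density.  If it were larger, a random walk would meet a
    hole quickly, by a second moment estimate; almost all the particles would
    then settle close to their starting points, and the density of settled
    particles would be the initial density, a contradiction.  At density 1 the
    holes are thus rare.  The counts vanish with positive probability, so even
    when a fixed box [B] around [o] starts empty, the stabilization of the
    rest of [U] fills a larger box with high probability.  By the abelian
    property the particles of [B] may be moved last; through a filled box each
    of them performs a random walk, which reaches [o] from [x] with probability
    [hit x].  The sum of [hit] over [B] diverges as [B] grows, and the counts
    are not identically 0, so the number of topplings at [o] tends to infinity
    and E[w] to 0. *)

Require Import Defs.
From HB Require Import structures.
From mathcomp Require Import all_boot all_order all_algebra finmap.
From mathcomp Require Import all_classical all_reals all_analysis measurable_realfun.
From mathcomp.analysis.showcase Require Import summability.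
From mathcomp Require Import ring lra zify.

Set Implicit Arguments.
Unset Strict Implicit.
Unset Printing Implicit Defensive.

Import Order.TTheory GRing.Theory Num.Theory.
Import numFieldNormedType.Exports.

Local Open Scope classical_set_scope.
Local Open Scope ring_scope.

(** * Stabilization of a finite domain *)

(** A site is stable as soon as it holds at most one particle, awake or asleep, so one and the same
    stabilization serves every [lambda]; a lone active particle that jumps then performs an illegal
    toppling, and the comparison has to survive such moves. Visits to [o] before time [T] cannot be
    excluded either; this is why they are discounted by 1/2 instead of being forbidden: each of them
    costs a factor 2 and does not destroy the bound. No stacks of instructions are sampled. The
    stabilization exists only through the numbers [stab V f c], and the abelian property,
    monotonicity in the domain and asymptotic independence are identities and inequalities between
    such numbers, proved by induction on the number of topplings. Time is discretized. An Euler step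
    of length [delta] has an error of order [delta ^+ 2], so the total error vanishes as the mesh is
    refined in a fixed finite volume. The resulting bound does not depend on the volume, which lets
    it pass to the infinite system. The main input on the walk is that the expected number of visits
    to a site in [n] steps is o(n), uniformly in the start. This holds in every dimension, with or
    without drift. *)

Section Stabilization.
Variables (R : realType) (d : nat).
Variables (D : seq (lattice d)) (p : lattice d -> R).
Hypothesis p_ge0 : forall e, 0 <= p e.
Hypothesis p_sum1 : \sum_(e <- D) p e = 1.

Definition step (F : lattice d -> R) : R := \sum_(e <- D) p e * F e.

Lemma step_le F G : {in D, forall e, F e <= G e} -> step F <= step G.
Proof.
move=> FG; rewrite /step big_seq [leRHS]big_seq.
by apply: ler_sum => e eD; rewrite ler_wpM2l// FG.
Qed.

Lemma eq_step F G : {in D, F =1 G} -> step F = step G.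
Proof.
by move=> FG; apply/le_anti/andP; split; apply: step_le => e eD; rewrite FG.
Qed.

Lemma step_cst k : step (fun=> k) = k.
Proof. by rewrite /step -mulr_suml p_sum1 mul1r. Qed.

Lemma stepD F G : step (fun e => F e + G e) = step F + step G.
Proof.
by rewrite /step -big_split/=; apply: eq_bigr => e _; rewrite mulrDr.
Qed.

Lemma stepZ k F : step (fun e => k * F e) = k * step F.
Proof. by rewrite /step mulr_sumr; apply: eq_bigr => e _; rewrite mulrCA. Qed.

Lemma step_ge0 F : {in D, forall e, 0 <= F e} -> 0 <= step F.
Proof. by move=> F0; rewrite -[leLHS](step_cst 0); apply: step_le. Qed.

Lemma step_ub k F : {in D, forall e, F e <= k} -> step F <= k.
Proof. by move=> Fk; rewrite -[leRHS]step_cst; apply: step_le. Qed.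

Lemma step_lb k F : {in D, forall e, k <= F e} -> k <= step F.
Proof. by move=> Fk; rewrite -[leLHS]step_cst; apply: step_le. Qed.

Lemma step_sum (I : Type) (s : seq I) (F : I -> lattice d -> R) :
  step (fun e => \sum_(i <- s) F i e) = \sum_(i <- s) step (F i).
Proof.
rewrite /step exchange_big/=.
by apply: eq_bigr => e _; rewrite mulr_sumr.
Qed.

Lemma exchange_step (F : lattice d -> lattice d -> R) :
  step (fun e => step (F e)) = step (fun e' => step (F ^~ e')).
Proof.
rewrite {1 3}/step.
under eq_bigr do rewrite /step mulr_sumr.
rewrite exchange_big/=; apply: eq_bigr => e' _.
by rewrite /step mulr_sumr; apply: eq_bigr => e _; rewrite mulrCA.
Qed.

Lemma step_cvg (F : nat -> lattice d -> R) (G : lattice d -> R) :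
  (forall e, F n e @[n --> \oo] --> G e) ->
  step (F n) @[n --> \oo] --> step G.
Proof.
move=> FG; rewrite /step; elim: D => [|e s IH].
  by rewrite big_nil; under eq_fun do rewrite big_nil; exact: cvg_cst.
rewrite big_cons; under eq_fun do rewrite big_cons.
by apply: cvgD => //; apply: cvgM => //; exact: cvg_cst.
Qed.

Implicit Types (V : seq (lattice d)) (c : lattice d -> nat).

(* Particles that leave [V] are lost. *)
Definition topple V (x e : lattice d) c : lattice d -> nat :=
  fun z => (c z - (z == x) + ((z == (x + e)%R) && (z \in V)))%N.

Lemma topple_other V x e c y : y != x -> (c y <= topple V x e c y)%N.
Proof. by move=> /negbTE yx; rewrite /topple yx subn0 leq_addr. Qed.

Lemma topple_pred V x e c : ((c x).-1 <= topple V x e c x)%N.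
Proof. by rewrite /topple eqxx subn1 leq_addr. Qed.

Lemma toppleC V W x y e e' c : (0 < c x)%N -> (0 < c y)%N -> x != y ->
  topple W y e' (topple V x e c) = topple V x e (topple W y e' c).
Proof.
move=> cx cy xy; apply/funext => z; rewrite /topple.
case: (eqVneq z x) => [->|zx].
  rewrite (negbTE xy).
  by case: (_ && _); case: (_ && _) => //=; lia.
case: (eqVneq z y) => [->|zy];
  by case: (_ && _); case: (_ && _) => //=; lia.
Qed.

Section discount.
Variable disc : lattice d -> R.
Hypothesis disc01 : forall x, 0 <= disc x <= 1.

(* The expectation of [disc x_1 * .. * disc x_k * f c'], where [x_1 .. x_k] are
   the sites toppled from [c] until the stable state [c'] is reached; the runs
   that need more than [n] topplings count for 0. *)
Fixpoint stabn V (f : (lattice d -> nat) -> R) (n : nat) c : R :=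
  if [seq x <- V | (1 < c x)%N] is x :: _ then
    if n is m.+1 then disc x * step (fun e => stabn V f m (topple V x e c)) else 0
  else f c.

Definition stable V c := all (fun x => (c x <= 1)%N) V.

Lemma stableP V c : reflect {in V, forall x, (c x <= 1)%N} (stable V c).
Proof. exact: allP. Qed.

Lemma stable_filter V c : stable V c -> [seq x <- V | (1 < c x)%N] = [::].
Proof.
move=> /stableP cV; apply/eqP; rewrite -(negbK (_ == _)) -has_filter.
by apply/hasPn => x xV; rewrite -leqNgt cV.
Qed.

Lemma unstable_filter V c : ~~ stable V c ->
  exists x s, [/\ [seq x <- V | (1 < c x)%N] = x :: s, x \in V & (1 < c x)%N].
Proof.
move=> sV; case E : [seq x <- V | (1 < c x)%N] => [|x s].
  move/negP : sV; case; apply/stableP => x xV; rewrite leqNgt; apply/negP => cx.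
  by have : x \in [seq x <- V | (1 < c x)%N] by [rewrite mem_filter cx]; rewrite E.
exists x, s; have : x \in x :: s by rewrite inE eqxx.
by rewrite -E mem_filter => /andP[-> ->].
Qed.

Lemma unstable_ex V c : ~~ stable V c -> exists2 x, x \in V & (1 < c x)%N.
Proof. by move=> /unstable_filter[x [s [_ xV cx]]]; exists x. Qed.

Lemma unstableN V c x : x \in V -> (1 < c x)%N -> ~~ stable V c.
Proof. by move=> xV cx; apply/negP => /stableP/(_ _ xV); rewrite leqNgt cx. Qed.

Lemma stabn_stable V f n c : stable V c -> stabn V f n c = f c.
Proof. by move=> /stable_filter sV; case: n => [|n] /=; rewrite sV. Qed.

Lemma stabn0_unstable V f c : ~~ stable V c -> stabn V f 0 c = 0.
Proof. by move=> /unstable_filter[x [s [/= -> _ _]]]. Qed.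

(* The abelian property: any unstable site may be toppled first. *)
Lemma stabn_unstable V f n c x : x \in V -> (1 < c x)%N ->
  stabn V f n.+1 c = disc x * step (fun e => stabn V f n (topple V x e c)).
Proof.
elim: n c x => [|n IH] c x xV cx.
  have [y [s [/= -> yV cy]]] := unstable_filter (unstableN xV cx).
  have [->//|yx] := eqVneq y x.
  rewrite (@eq_step _ (fun=> 0)) ?step_cst ?mulr0; last first.
    move=> e _; apply: stabn0_unstable; apply: (unstableN xV).
    by rewrite (leq_trans cx)// topple_other// eq_sym.
  rewrite (@eq_step _ (fun=> 0)) ?step_cst ?mulr0// => e _.
  by apply: stabn0_unstable; apply: (unstableN yV); rewrite (leq_trans cy)// topple_other.
have [y [s [E yV cy]]] := unstable_filter (unstableN xV cx).
have -> : stabn V f n.+2 c = disc y * step (fun e => stabn V f n.+1 (topple V y e c)).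
  by rewrite [LHS]/= E.
have [->//|yx] := eqVneq y x.
(* Each side is expanded by one more toppling, at [x] and at [y] respectively; topplings at distinct
   occupied sites commute. *)
transitivity (disc y * (disc x * step (fun e => step (fun e' =>
    stabn V f n (topple V x e' (topple V y e c)))))).
  congr (_ * _); rewrite -stepZ; apply: eq_step => e _; apply: IH => //.
  by rewrite (leq_trans cx)// topple_other// eq_sym.
rewrite mulrCA; congr (_ * _); rewrite exchange_step -stepZ.
apply: eq_step => e _; rewrite (@IH _ y)//; last first.
  by rewrite (leq_trans cy)// topple_other.
congr (_ * _); apply: eq_step => e' _.
by rewrite toppleC// ?(ltnW cy)// (ltnW cx).
Qed.

Lemma stabn_ind V f (P : nat -> (lattice d -> nat) -> R -> Prop) :
  (forall n c, stable V c -> P n c (f c)) ->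
  (forall c, ~~ stable V c -> P 0%N c 0) ->
  (forall n c x, x \in V -> (1 < c x)%N ->
     (forall e, P n (topple V x e c) (stabn V f n (topple V x e c))) ->
     P n.+1 c (disc x * step (fun e => stabn V f n (topple V x e c)))) ->
  forall n c, P n c (stabn V f n c).
Proof.
move=> Ps P0 PS; elim=> [|n IH] c; have [sc|uc] := boolP (stable V c).
- by rewrite stabn_stable//; exact: Ps.
- by rewrite stabn0_unstable//; exact: P0.
- by rewrite stabn_stable//; exact: Ps.
- have [x xV cx] := unstable_ex uc.
  by rewrite (@stabn_unstable _ _ _ _ x)//; apply: PS.
Qed.

Lemma disc_ge0 x : 0 <= disc x. Proof. by have /andP[] := disc01 x. Qed.
Lemma disc_le1 x : disc x <= 1. Proof. by have /andP[] := disc01 x. Qed.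
#[local] Hint Resolve disc_ge0 disc_le1 : core.

Lemma disc_step_le x F G : {in D, forall e, F e <= G e} ->
  disc x * step F <= disc x * step G.
Proof. by move=> FG; rewrite ler_wpM2l// step_le. Qed.

Lemma disc_step_ub x k F : 0 <= k -> {in D, forall e, F e <= k} ->
  disc x * step F <= k.
Proof.
move=> k0 Fk; rewrite -[leRHS]mul1r (@le_trans _ _ (disc x * k))//.
  by rewrite ler_wpM2l// step_ub.
by rewrite ler_wpM2r.
Qed.

Lemma stabn_ge0 V f n c : (forall c, 0 <= f c) -> 0 <= stabn V f n c.
Proof.
move=> f0; apply: (stabn_ind (P := fun _ _ r => 0 <= r)) => // {}n {}c x xV cx IH.
by apply: mulr_ge0 => //; apply: step_ge0 => e _.
Qed.

Lemma stabn_ub V f n c M : 0 <= M -> (forall c, f c <= M) -> stabn V f n c <= M.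
Proof.
move=> M0 fM; apply: (stabn_ind (P := fun _ _ r => r <= M)) => // {}n {}c x xV cx IH.
by apply: disc_step_ub.
Qed.

Lemma stabn_nondecreasing V f c : (forall c, 0 <= f c) ->
  nondecreasing_seq (fun n => stabn V f n c).
Proof.
move=> f0; apply/nondecreasing_seqP => n.
elim: n c => [|n IH] c; have [sc|uc] := boolP (stable V c).
- by rewrite !stabn_stable.
- by rewrite stabn0_unstable// stabn_ge0.
- by rewrite !stabn_stable.
- have [x xV cx] := unstable_ex uc.
  by rewrite 2?(@stabn_unstable _ _ _ _ x)//; apply: disc_step_le.
Qed.

(** Nonnegativity makes the truncations [stabn] nondecreasing in [n], and boundedness makes them
    converge. *)
Definition nonneg_bounded (f : (lattice d -> nat) -> R) :=
  (forall c, 0 <= f c) /\ exists M, forall c, f c <= M.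

Lemma nonneg_boundedD f g : nonneg_bounded f -> nonneg_bounded g ->
  nonneg_bounded (fun c => f c + g c).
Proof.
move=> [f0 [M fM]] [g0 [N gN]]; split=> [c|]; first exact: addr_ge0.
by exists (M + N) => c; rewrite lerD.
Qed.

Lemma nonneg_boundedZ k f : 0 <= k -> nonneg_bounded f ->
  nonneg_bounded (fun c => k * f c).
Proof.
move=> k0 [f0 [M fM]]; split=> [c|]; first exact: mulr_ge0.
by exists (k * M) => c; rewrite ler_wpM2l.
Qed.

Lemma nonneg_bounded_cst k : 0 <= k -> nonneg_bounded (fun=> k).
Proof. by move=> k0; split=> //; exists k. Qed.

Lemma nonneg_bounded_sum (I : Type) (s : seq I) F :
  (forall i, nonneg_bounded (F i)) ->
  nonneg_bounded (fun c => \sum_(i <- s) F i c).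
Proof.
move=> FB; elim: s => [|i s IH].
  by under [X in nonneg_bounded X]eq_fun do rewrite big_nil; exact: nonneg_bounded_cst.
under [X in nonneg_bounded X]eq_fun do rewrite big_cons.
exact: nonneg_boundedD.
Qed.

Lemma nonneg_bounded_step F : (forall e, nonneg_bounded (F e)) ->
  nonneg_bounded (fun c => step (F ^~ c)).
Proof.
by move=> FB; apply: nonneg_bounded_sum => e; exact: nonneg_boundedZ.
Qed.

(** The expectation over terminating runs; a run that never becomes stable counts for 0. *)
Definition stab V f c : R := limn (fun n => stabn V f n c).

Lemma stab_cvg V f c : nonneg_bounded f -> stabn V f n c @[n --> \oo] --> stab V f c.
Proof.
move=> [f0 [M fM]]; apply: nondecreasing_is_cvgn.
  exact: stabn_nondecreasing.
exists `|M| => _ [n _ <-]; apply: stabn_ub => // c'.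
by rewrite (le_trans (fM c'))// ler_norm.
Qed.

Lemma stabn_le_stab V f n c : nonneg_bounded f -> stabn V f n c <= stab V f c.
Proof.
move=> fB; apply: nondecreasing_cvgn_le; last exact/cvgP/stab_cvg.
by apply: stabn_nondecreasing; have [] := fB.
Qed.

Lemma stab_le V f c M : nonneg_bounded f -> (forall n, stabn V f n c <= M) ->
  stab V f c <= M.
Proof.
move=> fB fM; apply: limr_le; first exact/cvgP/stab_cvg.
exact: nearW.
Qed.

Lemma stab_ge0 V f c : nonneg_bounded f -> 0 <= stab V f c.
Proof.
by move=> fB; rewrite (le_trans _ (stabn_le_stab V 0 c fB))// stabn_ge0//; case: fB.
Qed.

Lemma stab_ub V f c M : nonneg_bounded f -> 0 <= M -> (forall c, f c <= M) ->
  stab V f c <= M.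
Proof. by move=> fB M0 fM; apply: stab_le => // n; exact: stabn_ub. Qed.

Lemma stab_stable V f c : stable V c -> stab V f c = f c.
Proof.
move=> sc; rewrite /stab; under eq_fun do rewrite stabn_stable//.
exact: lim_cst.
Qed.

Lemma stab_unstable V f c x : nonneg_bounded f -> x \in V -> (1 < c x)%N ->
  stab V f c = disc x * step (fun e => stab V f (topple V x e c)).
Proof.
move=> fB xV cx; apply/cvg_lim => //; rewrite -cvg_shiftS.
under eq_fun do rewrite (stabn_unstable _ _ xV cx).
apply: cvgM; first exact: cvg_cst.
by apply: step_cvg => e; exact: stab_cvg.
Qed.

Lemma stabn_D V f g n c : stabn V (fun c => f c + g c) n c = stabn V f n c + stabn V g n c.
Proof.
elim: n c => [|n IH] c; have [sc|uc] := boolP (stable V c).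
- by rewrite !stabn_stable.
- by rewrite !stabn0_unstable// addr0.
- by rewrite !stabn_stable.
- have [x xV cx] := unstable_ex uc.
  rewrite 3!(stabn_unstable _ _ xV cx) -mulrDr -stepD; congr (_ * _).
  by apply: eq_step => e _.
Qed.

Lemma stabn_Z V k f n c : stabn V (fun c => k * f c) n c = k * stabn V f n c.
Proof.
elim: n c => [|n IH] c; have [sc|uc] := boolP (stable V c).
- by rewrite !stabn_stable.
- by rewrite !stabn0_unstable// mulr0.
- by rewrite !stabn_stable.
- have [x xV cx] := unstable_ex uc.
  rewrite 2!(stabn_unstable _ _ xV cx) [RHS]mulrCA -[in RHS]stepZ; congr (_ * _).
  by apply: eq_step => e _.
Qed.

Lemma stabD V f g c : nonneg_bounded f -> nonneg_bounded g ->
  stab V (fun c => f c + g c) c = stab V f c + stab V g c.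
Proof.
move=> fB gB; apply/cvg_lim => //.
under eq_fun do rewrite stabn_D.
by apply: cvgD; exact: stab_cvg.
Qed.

Lemma stabZ V k f c : nonneg_bounded f ->
  stab V (fun c => k * f c) c = k * stab V f c.
Proof.
move=> fB; apply/cvg_lim => //.
under eq_fun do rewrite stabn_Z.
by apply: cvgM; [exact: cvg_cst|exact: stab_cvg].
Qed.

Lemma stab_sum (I : Type) (s : seq I) V F c : (forall i, nonneg_bounded (F i)) ->
  stab V (fun c => \sum_(i <- s) F i c) c = \sum_(i <- s) stab V (F i) c.
Proof.
move=> FB; elim: s => [|i s IH].
  rewrite big_nil (_ : (fun=> _) = (fun c => 0 * 0)); last first.
    by apply/funext => c'; rewrite big_nil mulr0.
  by rewrite stabZ ?mul0r//; exact: nonneg_bounded_cst.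
rewrite big_cons -IH -stabD//; last exact: nonneg_bounded_sum.
by congr stab; apply/funext => c'; rewrite big_cons.
Qed.

Lemma stab_step V F c : (forall e, nonneg_bounded (F e)) ->
  stab V (fun c => step (F ^~ c)) c = step (fun e => stab V (F e) c).
Proof.
move=> FB; rewrite stab_sum => [|e]; last exact: nonneg_boundedZ.
by apply: eq_bigr => e _; rewrite stabZ.
Qed.

Lemma stabn_mono V f g n c : (forall c, f c <= g c) -> stabn V f n c <= stabn V g n c.
Proof.
move=> fg; elim: n c => [|n IH] c; have [sc|uc] := boolP (stable V c).
- by rewrite !stabn_stable.
- by rewrite !stabn0_unstable.
- by rewrite !stabn_stable.
- have [x xV cx] := unstable_ex uc.
  by rewrite 2!(stabn_unstable _ _ xV cx); apply: disc_step_le.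
Qed.

Lemma stab_mono V f g c : nonneg_bounded f -> nonneg_bounded g ->
  (forall c, f c <= g c) -> stab V f c <= stab V g c.
Proof.
move=> fB gB fg; apply: stab_le => // n.
by rewrite (le_trans (stabn_mono V n c fg))// stabn_le_stab.
Qed.

(** Only the sites of [V] are compared, so that such an [f] ignores all the other sites. *)
Definition antitone_on V (f : (lattice d -> nat) -> R) :=
  forall c c', {in V, forall x, (c' x <= c x)%N} -> f c <= f c'.

(** A coupling argument. As long as [c'] is unstable in [U], the same site is toppled in both
    configurations; this is legal in the larger one, and the order persists because [V] loses no
    particle that [reg x] keeps. The supersolution [H] absorbs these topplings. Letting the domain
    [reg x] depend on the toppled site allows [H] to treat several regions separately. *)
Lemma stabn_le_super V U (reg : lattice d -> seq (lattice d)) f H n c c' :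
  {subset U <= V} -> (forall c, 0 <= f c) -> antitone_on U f ->
  (forall c, 0 <= H c) ->
  (forall c x, x \in U -> (1 < c x)%N ->
     disc x * step (fun e => H (topple (reg x) x e c)) <= H c) ->
  (forall x, x \in U -> {subset reg x <= U}) ->
  (forall c, stable U c -> f c <= H c) ->
  {in U, forall x, (c' x <= c x)%N} -> stabn V f n c <= H c'.
Proof.
move=> UV f0 fU H0 superH regU fH.
(* A toppled site of [c1] held at least two particles and keeps one, which is all that the stable
   [c2] can have there. *)
have settled m c1 c2 : stable U c2 -> {in U, forall x, (c2 x <= c1 x)%N} ->
    stabn V f m c1 <= f c2.
  move=> /stableP sc2.
  elim: m c1 => [|m IH] c1 c12; have [sc|uc] := boolP (stable V c1).
  - by rewrite stabn_stable//; exact: fU.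
  - by rewrite stabn0_unstable.
  - by rewrite stabn_stable//; exact: fU.
  - have [x xV cx] := unstable_ex uc.
    rewrite (stabn_unstable _ _ xV cx); apply: disc_step_ub => // e _.
    apply: IH => z zU; have [zx|zx] := eqVneq z x.
      rewrite zx (leq_trans _ (topple_pred _ _ _ _))// (@leq_trans 1)//.
        by rewrite -zx sc2.
      by rewrite -ltnS prednK// ltnW.
    by rewrite (leq_trans (c12 _ zU))// topple_other.
elim: n c c' => [|n IH] c c' c'c; have [sc'|uc'] := boolP (stable U c').
- by rewrite (le_trans _ (fH _ sc'))// settled.
- have [x xU cx] := unstable_ex uc'.
  by rewrite stabn0_unstable// (unstableN (UV _ xU))// (leq_trans cx)// c'c.
- by rewrite (le_trans _ (fH _ sc'))// settled.
- have [x xU cx] := unstable_ex uc'.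
  rewrite (stabn_unstable _ _ (UV _ xU)); last by rewrite (leq_trans cx)// c'c.
  rewrite (le_trans _ (superH _ _ xU cx))//; apply: disc_step_le => e _.
  apply: IH => z zU; rewrite /topple; apply: leq_add.
    by rewrite leq_sub2r// c'c.
  case: (z == x + e) => //=.
  by case: (boolP (z \in reg x)) => // zr; rewrite (UV z zU).
Qed.

(** The stabilization of [U] is itself a supersolution, with equality at legal topplings. *)
Lemma stabn_le_stab_sub V U f n c c' : {subset U <= V} -> nonneg_bounded f ->
  antitone_on U f -> {in U, forall x, (c' x <= c x)%N} ->
  stabn V f n c <= stab U f c'.
Proof.
move=> UV fB fU; apply: (@stabn_le_super V U (fun=> U)) => //.
- by case: fB.
- by move=> {}c; exact: stab_ge0.
- by move=> {}c x xU cx; rewrite (stab_unstable fB xU cx).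
- by move=> x _ y.
- by move=> {}c sc; rewrite (stab_stable f sc).
Qed.

Lemma stab_le_sub V U f c c' : {subset U <= V} -> nonneg_bounded f ->
  antitone_on U f -> {in U, forall x, (c' x <= c x)%N} ->
  stab V f c <= stab U f c'.
Proof. by move=> UV fB fU c'c; apply: stab_le => // n; exact: stabn_le_stab_sub. Qed.

Lemma antitone_stab V f : nonneg_bounded f -> antitone_on V f ->
  antitone_on V (stab V f).
Proof. by move=> fB fV c c' c'c; exact: stab_le_sub. Qed.

(** Killing the particles that leave [U1] or [U2] makes the two regions evolve independently, and
    can only lower the configuration. The product is a supersolution when [reg x] is the region
    containing [x]. *)
Lemma stab_mul V U1 U2 f1 f2 c : {subset U1 <= V} -> {subset U2 <= V} ->
  {in U1, forall x, x \notin U2} ->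
  nonneg_bounded f1 -> nonneg_bounded f2 ->
  antitone_on U1 f1 -> antitone_on U2 f2 ->
  stab V (fun c => f1 c * f2 c) c <= stab U1 f1 c * stab U2 f2 c.
Proof.
move=> U1V U2V U12 f1B f2B f1U f2U.
have f10 := f1B.1; have f20 := f2B.1.
have eq_stab (U : seq (lattice d)) f c1 c2 : nonneg_bounded f -> antitone_on U f ->
    {in U, forall x, c1 x = c2 x} -> stab U f c1 = stab U f c2.
  move=> fB fU c12; apply/le_anti/andP; split; apply: stab_le_sub => // x xU.
    by rewrite c12.
  by rewrite c12.
have f12B : nonneg_bounded (fun c => f1 c * f2 c).
  split=> [c1|]; first exact: mulr_ge0.
  have [_ [M1 f1M]] := f1B; have [_ [M2 f2M]] := f2B.
  by exists (M1 * M2) => c1; rewrite ler_pM.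
have topple_out (U : seq (lattice d)) W x e c1 : (forall z, z \in U -> z \notin W) -> x \notin U ->
    {in U, forall z, topple W x e c1 z = c1 z}.
  move=> UW xU z zU; rewrite /topple (negbTE (UW z zU)) andbF addn0.
  by case: eqVneq => [zx|]; rewrite ?subn0//; move: xU; rewrite -zx zU.
apply: stab_le => // n.
apply: (@stabn_le_super V (U1 ++ U2) (fun x => if x \in U1 then U1 else U2) _
  (fun c => stab U1 f1 c * stab U2 f2 c)) => //.
- by move=> x; rewrite mem_cat => /orP[/U1V|/U2V].
- by move=> c1; exact: mulr_ge0.
- move=> c1 c2 c21; apply: ler_pM => //.
    by apply: f1U => x xU; apply: c21; rewrite mem_cat xU.
  by apply: f2U => x xU; apply: c21; rewrite mem_cat xU orbT.
- by move=> c1; apply: mulr_ge0; exact: stab_ge0.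
- move=> c1 x; rewrite mem_cat; case: ifPn => [xU1 _|xU1 /= xU2] cx.
    rewrite (@eq_step _ (fun e => stab U2 f2 c1 * stab U1 f1 (topple U1 x e c1))).
      by rewrite stepZ mulrCA mulrC -(stab_unstable f1B xU1 cx).
    move=> e _; rewrite mulrC; congr (_ * _); apply: eq_stab => //.
    apply: topple_out; last exact: U12.
    by move=> z zU2; apply/negP => /U12; rewrite zU2.
  rewrite (@eq_step _ (fun e => stab U1 f1 c1 * stab U2 f2 (topple U2 x e c1))).
    by rewrite stepZ mulrCA -(stab_unstable f2B xU2 cx).
  by move=> e _; congr (_ * _); apply: eq_stab => //; apply: topple_out.
- by move=> x _ z; rewrite mem_cat; case: ifP => _ ->; rewrite ?orbT.
- move=> c1 sc; rewrite !stab_stable//.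
    by apply/stableP => x xU; move/stableP : sc; apply; rewrite mem_cat xU orbT.
  by apply/stableP => x xU; move/stableP : sc; apply; rewrite mem_cat xU.
Qed.

Definition add1 (x : lattice d) c : lattice d -> nat := fun z => (c z + (z == x))%N.

Lemma topple_add1 V x e y c : (0 < c x)%N ->
  topple V x e (add1 y c) = add1 y (topple V x e c).
Proof.
move=> cx; apply/funext => z; rewrite /topple /add1.
by case: (eqVneq z x) => [->|_]; case: (_ && _); case: (_ == _) => /=; lia.
Qed.

Lemma topple_add1_settled V x e c :
  topple V x e (add1 x c) = if x + e \in V then add1 (x + e) c else c.
Proof.
apply/funext => z; rewrite /topple /add1 addnK.
case: (eqVneq z (x + e)) => [->|zx] /=; first by case: ifP; rewrite ?eqxx ?addn0.
by case: ifP; rewrite ?(negbTE zx) addn0.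
Qed.

(* Toppling a site holding a single particle is not legal: it may only
   lower the discounted count of visits. *)
Lemma stab_illegal V f c x : nonneg_bounded f -> (forall c, f c <= 1) ->
  (forall c, stable V c -> f c = 1) -> x \in V -> (0 < c x)%N ->
  disc x * step (fun e => stab V f (topple V x e c)) <= stab V f c.
Proof.
move=> fB f1 fs xV cx.
have key n : disc x * step (fun e => stabn V f n (topple V x e c)) <= stab V f c.
  elim: n c cx => [|n IH] c cx; (have [cx1|cx1] := ltnP 1 (c x);
      first by rewrite -(stabn_unstable _ _ xV cx1) stabn_le_stab);
    (have [sc|uc] := boolP (stable V c);
      first by rewrite stab_stable// fs//; apply: disc_step_ub => // e _; exact: stabn_ub).
    have [y yV cy] := unstable_ex uc.
    have yx : y != x by apply/eqP => yx; move: cy; rewrite yx ltnNge cx1.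
    rewrite (@eq_step _ (fun=> 0)) ?step_cst ?mulr0 ?stab_ge0// => e _.
    by apply/stabn0_unstable/(unstableN yV); rewrite (leq_trans cy)// topple_other.
  have [y yV cy] := unstable_ex uc.
  have yx : y != x by apply/eqP => yx; move: cy; rewrite yx ltnNge cx1.
  (* The legal toppling at [y] is performed on both sides and commuted with the one at [x]; the
     induction applies after it. *)
  rewrite (stab_unstable fB yV cy).
  rewrite (@eq_step _ (fun e => disc y * step (fun e' =>
      stabn V f n (topple V x e (topple V y e' c))))); last first.
    move=> e _; rewrite (@stabn_unstable _ _ _ _ y)//; last first.
      by rewrite (leq_trans cy)// topple_other.
    congr (_ * _); apply: eq_step => e' _; rewrite toppleC// ?(ltnW cy)//.
    by rewrite eq_sym.
  rewrite stepZ mulrCA exchange_step ler_wpM2l// -[leLHS]stepZ.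
  apply: step_le => e _.
  by apply: IH; rewrite (leq_trans cx)// topple_other// eq_sym.
have lim_f : disc x * step (fun e => stabn V f n (topple V x e c)) @[n --> \oo] -->
    disc x * step (fun e => stab V f (topple V x e c)).
  by apply: cvgM; [exact: cvg_cst|apply: step_cvg => e; exact: stab_cvg].
rewrite -(cvg_lim _ lim_f)//; apply: limr_le; first exact/cvgP/lim_f.
exact: nearW.
Qed.

End discount.
End Stabilization.

(** * Green functions and hitting probabilities *)

Section Walk.
Variables (R : realType) (d : nat).
Variables (D : seq (lattice d)) (p : lattice d -> R).
Hypothesis p_ge0 : forall e, 0 <= p e.
Hypothesis p_sum1 : \sum_(e <- D) p e = 1.
Let step := step D p.

Lemma le_sum_subset (I : eqType) (s t : seq I) (F : I -> R) : uniq s -> uniq t ->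
  {subset s <= t} -> (forall x, 0 <= F x) -> \sum_(x <- s) F x <= \sum_(x <- t) F x.
Proof.
move=> us ut st F0; rewrite [leRHS](bigID (mem s))/=.
have -> : \sum_(x <- t | x \in s) F x = \sum_(x <- s) F x.
  rewrite -big_filter; apply: perm_big; apply: uniq_perm => //.
    exact: filter_uniq.
  by move=> x; rewrite mem_filter; case: (boolP (x \in s)) => // /st.
by rewrite lerDl; apply: sumr_ge0.
Qed.

(** The mean of the nonnegative deficits [k - F] is at least the contribution of the single jump
    [e]. *)
Lemma step_ge_term F k e : e \in D -> {in D, forall e, F e <= k} ->
  step F <= k - p e * (k - F e).
Proof.
move=> eD Fk; rewrite lerBrDr -lerBrDl.
have -> : k - step F = \sum_(e <- D) p e * (k - F e).
  under eq_bigr do rewrite mulrBr.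
  by rewrite sumrB -mulr_suml p_sum1 mul1r.
rewrite (big_rem e)//= lerDl big_seq; apply: sumr_ge0 => e' e'D.
by rewrite mulr_ge0// subr_ge0 Fk// (mem_rem e'D).
Qed.

(** The expected sum of [g] over the first [n] positions of the walk, the start included. The same
    convention for time is used in [hit] and [green2]. *)
Fixpoint green (g : lattice d -> R) (n : nat) (x : lattice d) : R :=
  if n is m.+1 then g x + step (fun e => green g m (x + e)) else 0.

Definition mass_le (g : lattice d -> R) (M : R) :=
  forall s, uniq s -> \sum_(x <- s) g x <= M.

Lemma mass_le_step g M : mass_le g M ->
  mass_le (fun x => step (fun e => g (x + e))) M.
Proof.
move=> gM s us; rewrite -step_sum; apply: step_ub => // e _.
rewrite -(big_map (fun x => x + e) predT g) gM// map_inj_uniq//.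
exact: addIr.
Qed.

Lemma mass_leD f g M N : mass_le f M -> mass_le g N ->
  mass_le (fun x => f x + g x) (M + N).
Proof. by move=> fM gN s us; rewrite big_split lerD//=; [exact: fM|exact: gN]. Qed.

Lemma mass_leZ k f M : 0 <= k -> mass_le f M -> mass_le (fun x => k * f x) (k * M).
Proof. by move=> k0 fM s us; rewrite -mulr_sumr ler_wpM2l// fM. Qed.

Lemma mass_le_pred1 z : mass_le (fun x => (x == z)%:R) 1.
Proof.
move=> s us; have -> : \sum_(x <- s) (x == z)%:R = (count_mem z s)%:R :> R.
  by rewrite -sum1_count natr_sum [RHS]big_mkcond; apply: eq_bigr => x _ /=; case: eqP.
by rewrite count_uniq_mem// lern1 leq_b1.
Qed.

Lemma green_ge0 g n x : (forall x, 0 <= g x) -> 0 <= green g n x.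
Proof.
move=> g0; elim: n x => //= n IH x.
by rewrite addr_ge0// step_ge0.
Qed.

Lemma green_leS g n x : (forall x, 0 <= g x) -> green g n x <= green g n.+1 x.
Proof.
move=> g0; elim: n x => [|n IH] x; first exact: green_ge0.
by rewrite [leLHS]/= [leRHS]/= lerD2l; apply: step_le.
Qed.

Lemma le_green g n m x : (forall x, 0 <= g x) -> (n <= m)%N ->
  green g n x <= green g m x.
Proof.
move=> g0; have /nondecreasing_seqP : forall n, green g n x <= green g n.+1 x.
  by move=> k; exact: green_leS.
by apply.
Qed.

Lemma green_ub g n x : (forall x, g x <= 1) -> green g n x <= n%:R.
Proof.
move=> g1; elim: n x => //= n IH x.
by rewrite -natr1 addrC lerD// step_ub.
Qed.

(** By translation invariance, summing over the starting points gives mean one visit to [z] per unit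
    of time. *)
Lemma mass_le_green z n : mass_le (green (fun x => (x == z)%:R) n) n%:R.
Proof.
elim: n => [s _|n IH]; first by rewrite big1.
rewrite -natr1 addrC; apply: mass_leD; first exact: mass_le_pred1.
exact: mass_le_step.
Qed.

Lemma green_sum (I : Type) (r : seq I) (g : I -> lattice d -> R) n x :
  green (fun x => \sum_(i <- r) g i x) n x = \sum_(i <- r) green (g i) n x.
Proof.
elim: n x => [|n IH] x; first by rewrite big1.
rewrite /= big_split/= -step_sum; congr (_ + _).
by apply: (eq_step p_ge0) => e _.
Qed.

Variables (e0 : lattice d).
Hypotheses (e0D : e0 \in D) (pe0 : 0 < p e0) (e0_neq0 : e0 != 0).

(* A summable function that is nearly harmonic and attains nearly its maximum
   [M] at [x] is still nearly [M] at [x + j e0] for each [j <= J]. *)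
Lemma green_bound J : exists C, forall n z x,
  J%:R * green (fun x => (x == z)%:R) n x <= n%:R + C.
Proof.
(* [C j] bounds the deficit from the maximum at the [j]-th point along [e0]: one more step adds 1
   for the source [g] and divides by the probability of the jump. *)
pose C := fix C j : R := if j is i.+1 then (1 + C i) / p e0 else 1.
exists (\sum_(0 <= j < J) C j) => n z x0; set g := fun x => (x == z)%:R.
have g0 x : 0 <= g x :> R by rewrite /g ler0n.
have g1 x : g x <= 1 :> R by rewrite /g lern1 leq_b1.
pose A := range (green g n); pose M := sup A.
have supA : has_sup A.
  split; first by exists (green g n 0); exists 0.
  by exists n%:R => _ [x _ <-]; exact: green_ub.
have leM x : green g n x <= M by apply: ub_le_sup; [exact: supA.2|exists x].
have [_ [x _ <-] Mx] := @sup_adherent _ A 1 ltr01 supA.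
have near j : M - C j <= green g n (x + e0 *+ j).
  elim: j => [|j IH]; first by rewrite mulr0n addr0 ltW.
  have : green g n (x + e0 *+ j) <= 1 + step (fun e => green g n (x + e0 *+ j + e)).
    by rewrite (le_trans (green_leS _ _ g0))//= lerD2r.
  move=> /(le_trans IH); have := @step_ge_term (fun e => green g n (x + e0 *+ j + e)) M e0 e0D.
  move=> /(_ (fun _ _ => leM _)); rewrite -addrA -mulrSr.
  move: (step _) (green _ _ _) => S G SM MS.
  have : p e0 * (M - G) <= 1 + C j by lra.
  by rewrite mulrC -ler_pdivlMr//= => ?; lra.
have : \sum_(0 <= j < J) (M - C j) <= n%:R.
  apply: (@le_trans _ _ (\sum_(0 <= j < J) green g n (x + e0 *+ j))).
    by apply: ler_sum => j _.
  rewrite -(big_map (fun j => x + e0 *+ j) predT (green g n)).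
  (* The points are distinct because [e0] is not 0, so the total mass [n] bounds the sum of [J]
     nearly maximal values. *)
  apply: mass_le_green; rewrite map_inj_uniq ?iota_uniq// => i j /addrI ij.
  have [k ek] : exists k, e0 0 k != 0.
    apply/not_existsP => /(_ _)/negP/negPn ek; move/eqP: e0_neq0; apply.
    by apply/rowP => k; rewrite mxE; apply/eqP.
  move/rowP : ij => /(_ k); rewrite !mulmxnE.
  by move/mulrIn; apply; exact: ek.
rewrite sumrB big_const_nat subn0 iter_addr_0 lerBlDr -[M *+ J]mulr_natl.
by apply: le_trans; rewrite ler_wpM2l.
Qed.

(** In [green_bound] the number [J] of near-maximal points is arbitrary. It is taken with
    [2 <= k * J%:R], and [n] is then large enough to absorb the constant. *)
Lemma green_sublinear (k : R) : 0 < k -> exists N, forall n, (N <= n)%N ->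
  forall z x, green (fun x => (x == z)%:R) n x <= k * n%:R.
Proof.
move=> k0.
have [J J0 Jk] : exists2 J, (0 < J)%N & 2 <= k * J%:R.
  exists (Num.truncn (2 / k)).+1 => //.
  by rewrite mulrC -ler_pdivrMr// ltW// truncnS_gt.
have [C HC] := green_bound J.
exists (Num.truncn C).+1 => n Nn z x.
have Cn : C <= n%:R.
  by rewrite (le_trans (ltW (truncnS_gt _)))// ler_nat.
have J0' : 0 < J%:R :> R by rewrite ltr0n.
have n0 : 0 <= n%:R :> R by rewrite ler0n.
have := HC n z x; move: (green _ _ _) => G JG.
rewrite -(ler_pM2l J0'); apply: (le_trans JG).
by rewrite mulrA (le_trans (_ : _ <= 2 * n%:R))//; [lra|rewrite ler_wpM2r// mulrC].
Qed.

Fixpoint hit (Q : pred (lattice d)) (n : nat) (x : lattice d) : R :=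
  if n is m.+1 then if Q x then 1 else step (fun e => hit Q m (x + e)) else 0.

Lemma hit_ge0 Q n x : 0 <= hit Q n x.
Proof.
by elim: n x => //= n IH x; case: ifP => // _; apply: step_ge0.
Qed.

Lemma hit_le1 Q n x : hit Q n x <= 1.
Proof.
by elim: n x => //= n IH x; case: ifP => // _; apply: step_ub.
Qed.

Lemma sub_hit (Q Q' : pred (lattice d)) n x : (forall x, Q x -> Q' x) -> hit Q n x <= hit Q' n x.
Proof.
move=> QQ; elim: n x => //= n IH x; case: ifPn => [/QQ ->//|_].
by case: ifP => _; [apply: step_ub => // e _; exact: hit_le1|apply: step_le].
Qed.

(* First-passage decomposition. *)
Lemma green_le_hit z n M : (forall y, green (fun x => (x == z)%:R) n y <= M) ->
  forall x, green (fun x => (x == z)%:R) n x <= hit (pred1 z) n x * M.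
Proof.
move=> HM x; have : (n <= n)%N by []; set g := fun x => _ in HM *.
have g0 y : 0 <= g y by rewrite /g ler0n.
move: {1 3 4}n => m; elim: m x => [|m IH] x mn; first by rewrite mul0r.
have [xz|xz] := eqVneq x z.
  rewrite [leRHS]/= xz eqxx mul1r (le_trans _ (HM z))//.
  exact: le_green.
rewrite [hit _ _ _]/= /= (negbTE xz) /g (negbTE xz) add0r mulrC -stepZ.
by apply: step_le => // e _; rewrite mulrC IH// ltnW.
Qed.

Fixpoint green2 (g : lattice d -> R) (n : nat) (x : lattice d) : R :=
  if n is m.+1 then
    g x + 2 * (g x * step (fun e => green g m (x + e))) +
    step (fun e => green2 g m (x + e))
  else 0.

(* [green] and [green2] are the first two moments of the number [X] of visits
   to [Q], and the inequality is the mean of t^2 1_{X = 0} <= (X - t)^2. *)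
Lemma second_moment (Q : pred (lattice d)) n x t :
  2 * t * green (fun x => (Q x)%:R) n x <=
  t ^+ 2 * hit Q n x + green2 (fun x => (Q x)%:R) n x.
Proof.
elim: n x t => [|n IH] x t /=; first by rewrite !mulr0 addr0.
set S1 := step _; set S0 := step _; set S2 := step _.
have key u : 2 * u * S1 <= u ^+ 2 * S0 + S2.
  by rewrite /S1 /S2 /S0 -!stepZ -stepD; apply: step_le => // e _; exact: IH.
have S01 : S0 <= 1 by apply: step_ub => // e _; exact: hit_le1.
case: ifPn => Qx /=; last by have := key t; lra.
(* A visit at the start lowers the target [t] by one for the visits that remain. *)
have := key (t - 1); have : (t - 1) ^+ 2 * S0 <= (t - 1) ^+ 2.
  by rewrite ler_piMr// sqr_ge0.
by rewrite expr2; lra.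
Qed.

End Walk.

(** * Boxes for the sup norm *)

Section Box.
Variable d : nat.
Implicit Types (o x y z e : lattice d).

Definition box (o : lattice d) (r : nat) : seq (lattice d) :=
  [seq o + (\row_i ((nat_of_ord (f i))%:Z - r%:Z)) | f : {ffun 'I_d -> 'I_(r.*2.+1)}].

Lemma box_uniq o r : uniq (box o r).
Proof.
rewrite map_inj_uniq ?enum_uniq// => f g /addrI/rowP fg.
apply/ffunP => i; have := fg i; rewrite !mxE => /addIr [fgi].
exact: val_inj.
Qed.

Lemma size_box o r : size (box o r) = ((r.*2.+1) ^ d)%N.
Proof. by rewrite size_map -cardE card_ffun !card_ord. Qed.

Lemma mem_box o r x : (x \in box o r) = [forall i, (`|x 0%R i - o 0%R i| <= r)%N].
Proof.
apply/mapP/forallP => [[f _ ->] i|xr].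
  rewrite !mxE; have := ltn_ord (f i).
  by move: (nat_of_ord (f i)) (o 0%R i) => a b; rewrite -muln2; lia.
have lt i : (absz (x 0 i - o 0 i + r%:Z)%R < r.*2.+1)%N.
  by have := xr i; move: (x 0 i) (o 0 i) => a b; rewrite -muln2; lia.
exists [ffun i => Ordinal (lt i)]; first by rewrite mem_enum.
apply/rowP => i; rewrite !mxE ffunE/=; have := xr i.
by move: (x 0 i) (o 0 i) => a b; lia.
Qed.

Lemma mem_boxP o r x : reflect (forall i, (`|x 0%R i - o 0%R i| <= r)%N) (x \in box o r).
Proof. by rewrite mem_box; exact: forallP. Qed.

Lemma box_center o r : o \in box o r.
Proof. by apply/mem_boxP => i; rewrite subrr. Qed.

Lemma box_shift o x e r s : x \in box o r -> e \in box 0 s -> x + e \in box o (r + s).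
Proof.
move=> /mem_boxP xo /mem_boxP eo; apply/mem_boxP => i.
have := xo i; have := eo i; rewrite !mxE subr0.
by move: (x 0 i) (o 0 i) (e 0 i) => a b c; lia.
Qed.

Lemma box_sym x y r : (x \in box y r) = (y \in box x r).
Proof. by rewrite !mem_box; apply: eq_forallb => i; rewrite distnC. Qed.

Lemma box_trans x y z r s : x \in box y r -> y \in box z s -> x \in box z (s + r).
Proof.
move=> /mem_boxP xy /mem_boxP yz; apply/mem_boxP => i.
have := xy i; have := yz i.
by move: (x 0 i) (y 0 i) (z 0 i) => a b c; lia.
Qed.

Lemma sub_box x r s : (r <= s)%N -> {subset box x r <= box x s}.
Proof.
move=> rs y /mem_boxP xy; apply/mem_boxP => i; exact: leq_trans (xy i) rs.
Qed.

Lemma box_translate o z r : box (o + z) r = [seq x + z | x <- box o r].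
Proof. by rewrite /box -map_comp; apply: eq_map => f /=; rewrite addrAC. Qed.

Lemma subset_box (s : seq (lattice d)) o : exists r, {subset s <= box o r}.
Proof.
elim: s => [|x s [r IH]]; first by exists 0%N.
exists (maxn r (\max_(i < d) `|x 0%R i - o 0%R i|)%N) => y.
rewrite inE => /predU1P[->|/IH]; last by apply: sub_box; exact: leq_maxl.
apply/mem_boxP => i; rewrite leq_max; apply/orP; right.
exact: (@leq_bigmax_cond _ predT (fun i : 'I_d => `|x 0%R i - o 0%R i|%N)).
Qed.

End Box.

(** * Hitting probabilities summed over a box *)

Section WalkBox.
Variables (R : realType) (d : nat).
Variables (D : seq (lattice d)) (p : lattice d -> R).
Hypothesis p_ge0 : forall e, 0 <= p e.
Hypothesis p_sum1 : \sum_(e <- D) p e = 1.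
Hypothesis D_box : {subset D <= box 0 1}.

(** Each of the [n] times contributes mass 1 when all starting points are counted, and within
    [n <= r] steps only those of the box can reach [o]. *)
Lemma sum_green_box o n r : (n <= r)%N ->
  n%:R <= \sum_(x <- box o r) green D p (fun x => (x == o)%:R) n x.
Proof.
elim: n r => [|n IH] r nr; first by rewrite big1.
have [s rs] : exists s, r = s.+1 by exists r.-1; rewrite prednK// (leq_trans _ nr).
rewrite rs ltnS in nr *.
rewrite /= big_split/= -natr1 [leRHS]addrC; apply: lerD; last first.
  rewrite (bigD1_seq o) ?box_center ?box_uniq//= eqxx lerDl.
  by apply: sumr_ge0.
rewrite -step_sum; apply: step_lb => // e eD.
rewrite (le_trans (IH _ nr))//.
rewrite -(big_map (fun x => x + e) predT (green D p (fun x => (x == o)%:R) n)).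
apply: le_sum_subset; first exact: box_uniq.
- by rewrite map_inj_uniq ?box_uniq//; exact: addIr.
- move=> x xs; apply/mapP; exists (x - e); last by rewrite subrK.
  rewrite -[s.+1]addn1; apply: box_shift => //.
  have /D_box/mem_boxP eo := eD; apply/mem_boxP => i.
  by have := eo i; rewrite !mxE !subr0 abszN.
- by move=> x; apply: green_ge0.
Qed.

(** By first passage, [n] is at most the sum of [hit] times the maximal expected number of visits,
    which is o(n). *)
Lemma sum_hit_box o e0 (L : R) : e0 \in D -> 0 < p e0 -> e0 != 0 ->
  exists n, L <= \sum_(x <- box o n) hit D p (pred1 o) n x.
Proof.
move=> e0D pe0 e00.
pose L' := `|L| + 1; have L'0 : 0 < L' by rewrite /L' ltr_wpDl.
have L'V0 : 0 < L'^-1 by rewrite invr_gt0.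
have [N HN] := green_sublinear p_ge0 p_sum1 e0D pe0 e00 L'V0.
exists N.+1; set n := N.+1.
have {}HN := HN n (leqnSn _) o.
have := sum_green_box o (leqnn n).
have n0 : 0 < n%:R :> R by rewrite ltr0n.
move=> /le_trans/(_ (ler_sum _ (fun x _ => green_le_hit p_ge0 p_sum1 HN x))).
rewrite -mulr_suml mulrA -[leLHS]mul1r ler_pM2r// ler_pdivlMr// mul1r.
by apply: le_trans; rewrite /L' (le_trans (ler_norm _))// lerDl.
Qed.

End WalkBox.

(** * Holes left by the stabilization *)

Section IidCounts.
Variables (R : realType) (d : nat) (K : nat) (mu : nat -> R).
Hypothesis mu_ge0 : forall j, 0 <= mu j.
Hypothesis mu_sum1 : \sum_(j < K.+1) mu j = 1.
Implicit Types (c : lattice d -> nat) (F G : (lattice d -> nat) -> R).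

Definition addk (x : lattice d) (j : nat) c : lattice d -> nat :=
  fun z => (c z + (z == x) * j)%N.

Lemma addk0 x c : addk x 0 c = c.
Proof. by apply/funext => z; rewrite /addk muln0 addn0. Qed.

Lemma addkS x j c : addk x j.+1 c = add1 x (addk x j c).
Proof. by apply/funext => z; rewrite /addk /add1; case: eqP => _; lia. Qed.

Lemma addkC x y i j c : addk x i (addk y j c) = addk y j (addk x i c).
Proof. by apply/funext => z; rewrite /addk addnAC. Qed.

Lemma leq_addk x j c z : (c z <= addk x j c z)%N.
Proof. exact: leq_addr. Qed.

Lemma leq_add1 x c z : (c z <= add1 x c z)%N.
Proof. exact: leq_addr. Qed.

(* The expectation of [F] when independent numbers of particles of law [mu]
   (on 0 .. K) are added to [c] at the sites of [s]. *)
Fixpoint Ex (s : seq (lattice d)) F c : R :=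
  if s is x :: t then \sum_(j < K.+1) mu j * Ex t F (addk x j c) else F c.

Lemma Ex_le s F G c : (forall c, F c <= G c) -> Ex s F c <= Ex s G c.
Proof.
move=> FG; elim: s c => //= x s IH c.
by apply: ler_sum => j _; rewrite ler_wpM2l.
Qed.

Lemma eq_Ex s F G c : F =1 G -> Ex s F c = Ex s G c.
Proof. by move=> /funext ->. Qed.

Lemma Ex_cst s k c : Ex s (fun=> k) c = k.
Proof.
elim: s c => //= x s IH c.
by under eq_bigr do rewrite IH; rewrite -mulr_suml mu_sum1 mul1r.
Qed.

Lemma Ex_ge0 s F c : (forall c, 0 <= F c) -> 0 <= Ex s F c.
Proof. by move=> F0; rewrite -(Ex_cst s 0 c); exact: Ex_le. Qed.

Lemma ExD s F G c : Ex s (fun c => F c + G c) c = Ex s F c + Ex s G c.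
Proof.
elim: s c => //= x s IH c; rewrite -big_split/=.
by apply: eq_bigr => j _; rewrite IH mulrDr.
Qed.

Lemma ExZ s k F c : Ex s (fun c => k * F c) c = k * Ex s F c.
Proof.
elim: s c => //= x s IH c; rewrite mulr_sumr.
by apply: eq_bigr => j _; rewrite IH mulrCA.
Qed.

Lemma Ex_sum (I : Type) (r : seq I) s (F : I -> _) c :
  Ex s (fun c => \sum_(i <- r) F i c) c = \sum_(i <- r) Ex s (F i) c.
Proof.
elim: r => [|i r IH].
  by rewrite big_nil -[RHS](Ex_cst s 0 c); apply: eq_Ex => c'; rewrite big_nil.
by rewrite big_cons -IH -ExD; apply: eq_Ex => c'; rewrite big_cons.
Qed.

Lemma Ex_step D (p : lattice d -> R) s (F : lattice d -> _) c :
  Ex s (fun c => step D p (F ^~ c)) c = step D p (fun e => Ex s (F e) c).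
Proof. by rewrite Ex_sum; apply: eq_bigr => e _; rewrite ExZ. Qed.

Lemma Ex_cat s t F c : Ex (s ++ t) F c = Ex s (Ex t F) c.
Proof. by elim: s c => //= x s IH c; apply: eq_bigr => j _; rewrite IH. Qed.

Lemma Ex_swap x s F c : Ex (x :: s) F c = Ex s (Ex [:: x] F) c.
Proof.
elim: s c => //= y s IH c.
under eq_bigr do rewrite mulr_sumr.
rewrite exchange_big/=; apply: eq_bigr => j _.
rewrite -IH/= mulr_sumr; apply: eq_bigr => i _.
by rewrite mulrCA addkC.
Qed.

Lemma Ex_catC s t F c : Ex s (Ex t F) c = Ex t (Ex s F) c.
Proof.
elim: s c => //= x s IH c.
under eq_bigr do rewrite IH.
transitivity (Ex (x :: t) (Ex s F) c) => //.
by rewrite Ex_swap.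
Qed.

Lemma Ex_perm s t F c : perm_eq s t -> Ex s F c = Ex t F c.
Proof.
move=> st; move: st (erefl (Ex s F c)).
apply: (@catCA_perm_ind _ (fun t => Ex s F c = Ex t F c)) => s1 s2 s3 ->.
by rewrite !Ex_cat Ex_catC Ex_cat; apply: eq_Ex => c'; rewrite Ex_cat Ex_catC.
Qed.

Definition local_on (U : seq (lattice d)) F :=
  forall c c', {in U, c =1 c'} -> F c = F c'.

Lemma local_Ex U s F : local_on U F -> local_on U (Ex s F).
Proof.
move=> FU; elim: s => //= x s IH c c' cc'; apply: eq_bigr => j _.
by congr (_ * _); apply: IH => y yU; rewrite /addk cc'.
Qed.

Lemma Ex_skip U x s F c : x \notin U -> local_on U F -> Ex (x :: s) F c = Ex s F c.
Proof.
move=> xU FU /=; under eq_bigr => j _.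
  rewrite (_ : Ex s F _ = Ex s F c); first over.
  apply: (local_Ex s FU) => y yU; rewrite /addk; case: eqP => [yx|]; last first.
    by rewrite mul0n addn0.
  by move: xU; rewrite -yx yU.
by rewrite -mulr_suml mu_sum1 mul1r.
Qed.

Lemma Ex_restrict U s F c : uniq s -> uniq U -> {subset U <= s} -> local_on U F ->
  Ex s F c = Ex U F c.
Proof.
move=> us uU Us FU.
have -> : Ex s F c = Ex [seq x <- s | x \in U] F c.
  elim: s c {us Us} => // x s IH c; rewrite [in RHS]/=; case: ifPn => xU.
    by rewrite /=; apply: eq_bigr => j _; rewrite IH.
  by rewrite (Ex_skip _ _ xU FU) IH.
apply: Ex_perm; apply: uniq_perm => //; first exact: filter_uniq.
by move=> x; rewrite mem_filter; case: (boolP (x \in U)) => // /Us.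
Qed.

(** Each added count is seen by at most one of the two factors. *)
Lemma Ex_mul U1 U2 s F G c : {in U1, forall x, x \notin U2} ->
  local_on U1 F -> local_on U2 G ->
  Ex s (fun c => F c * G c) c = Ex s F c * Ex s G c.
Proof.
move=> U12 FU GU; elim: s c => // x s IH c.
case: (boolP (x \in U1)) => xU1.
  rewrite (Ex_skip s c (U12 _ xU1) GU) /= mulr_suml; apply: eq_bigr => j _.
  rewrite IH mulrA; congr (_ * _); apply: (local_Ex s GU) => y yU2.
  rewrite /addk; case: eqP => [yx|]; last by rewrite mul0n addn0.
  by move: (U12 _ xU1); rewrite -yx yU2.
rewrite (Ex_skip s c xU1 FU) /= mulr_sumr; apply: eq_bigr => j _.
rewrite IH mulrCA; congr (_ * (_ * _)); apply: (local_Ex s FU) => y yU1.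
rewrite /addk; case: eqP => [yx|]; last by rewrite mul0n addn0.
by move: xU1; rewrite -yx yU1.
Qed.

Lemma Ex_antitone_le V s F c : antitone_on V F -> Ex s F c <= F c.
Proof.
move=> FV; elim: s c => //= x s IH c.
rewrite -[leRHS]mul1r -mu_sum1 mulr_suml; apply: ler_sum => j _.
rewrite ler_wpM2l// (le_trans (IH _))//; apply: FV => y _; exact: leq_addk.
Qed.

Definition shift (z : lattice d) c : lattice d -> nat := fun y => c (y - z).

Lemma shift_addk z x j c : shift z (addk x j c) = addk (x + z) j (shift z c).
Proof. by apply/funext => y; rewrite /shift /addk subr_eq. Qed.

Lemma Ex_shift z s F c :
  Ex [seq x + z | x <- s] F (shift z c) = Ex s (fun c => F (shift z c)) c.
Proof.
elim: s c => //= x s IH c; apply: eq_bigr => j _.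
by rewrite -shift_addk IH.
Qed.

End IidCounts.

(** * Hole probabilities, and the holes removed by added particles *)

Section Holes.
Variables (R : realType) (d : nat).
Variables (D : seq (lattice d)) (p : lattice d -> R).
Hypothesis p_ge0 : forall e, 0 <= p e.
Hypothesis p_sum1 : \sum_(e <- D) p e = 1.
Hypothesis D_box : {subset D <= box 0 1}.
Variables (e0 : lattice d).
Hypotheses (e0D : e0 \in D) (pe0 : 0 < p e0) (e0_neq0 : e0 != 0).
Variables (K : nat) (mu : nat -> R).
Hypothesis mu_ge0 : forall j, 0 <= mu j.
Hypothesis mu_sum1 : \sum_(j < K.+1) mu j = 1.
Implicit Types (c : lattice d -> nat) (V : seq (lattice d)).

Local Notation step := (step D p).
(** With this trivial discount [stab] is a plain expectation of the final configuration. *)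
Let one := fun _ : lattice d => 1 : R.
Let one01 x : 0 <= one x <= 1. Proof. by rewrite /one ler01 lexx. Qed.
Local Notation St := (stab D p one).
Local Notation E := (@Ex R d K mu).
Let empty := fun _ : lattice d => 0%N.

Definition hole (y : lattice d) c : R := (c y == 0%N)%:R.

Lemma hole_nb y : nonneg_bounded (hole y).
Proof.
by split=> [c|]; [rewrite /hole ler0n|exists 1 => c; rewrite /hole lern1 leq_b1].
Qed.

Lemma hole_antitone U y : y \in U -> antitone_on U (hole y).
Proof.
move=> yU c c' c'c; rewrite /hole ler_nat.
by have := c'c _ yU; case: eqP => // ->; rewrite leqn0 => ->.
Qed.

Lemma topple_shift z V x e c :
  topple [seq y + z | y <- V] (x + z) e (shift z c) = shift z (topple V x e c).
Proof.
apply/funext => y; rewrite /topple /shift.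
have yz a : (y == a + z) = (y - z == a) by rewrite subr_eq.
rewrite (addrAC x z e) !yz; congr (_ + (_ && _))%N.
by rewrite -{1}(subrK z y) (mem_map (@addIr _ z)).
Qed.

Lemma stabn_shift z V f n c : stabn D p one [seq y + z | y <- V] f n (shift z c) =
  stabn D p one V (fun c => f (shift z c)) n c.
Proof.
have shiftE c1 y : shift z c1 (y + z) = c1 y by rewrite /shift addrK.
have stE c1 : stable [seq y + z | y <- V] (shift z c1) = stable V c1.
  by rewrite /stable all_map; apply: eq_all => y /=; rewrite shiftE.
elim: n c => [|n IH] c; have [sc|uc] := boolP (stable V c).
- by rewrite !stabn_stable// stE.
- by rewrite !stabn0_unstable// stE.
- by rewrite !stabn_stable// stE.
- have [x xV cx] := unstable_ex uc.
  have xV' : x + z \in [seq y + z | y <- V] by exact: map_f.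
  have cx' : (1 < shift z c (x + z))%N by rewrite shiftE.
  rewrite (stabn_unstable p_ge0 p_sum1 _ _ _ xV' cx').
  rewrite (stabn_unstable p_ge0 p_sum1 _ _ _ xV cx); congr (_ * _).
  by apply: eq_step => // e _; rewrite topple_shift IH.
Qed.

Lemma stab_shift z V f c :
  St [seq y + z | y <- V] f (shift z c) = St V (fun c => f (shift z c)) c.
Proof. by rewrite /stab; under eq_fun do rewrite stabn_shift. Qed.

(** Nonincreasing in [r], since enlarging the domain can only help to fill its center; its infimum
    is the limiting density of holes. *)
Definition hole_prob r := E (box 0 r) (St (box 0 r) (hole 0)) empty.

Lemma hole_prob_box o r : E (box o r) (St (box o r) (hole o)) empty = hole_prob r.
Proof.
rewrite /hole_prob -(add0r o) box_translate.
rewrite -[empty in LHS]/(shift o empty) Ex_shift//; apply: eq_Ex => // c.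
rewrite stab_shift; congr stab; apply/funext => c'.
by rewrite /hole /shift add0r subrr.
Qed.

Lemma hole_prob_ge0 r : 0 <= hole_prob r.
Proof. by apply: Ex_ge0 => // c; apply: stab_ge0 => //; exact: hole_nb. Qed.

Lemma local_stab U f : nonneg_bounded f -> antitone_on U f -> local_on U (St U f).
Proof.
move=> fB fU c1 c2 c12; apply/le_anti/andP.
by split; apply: stab_le_sub => // x xU; rewrite c12.
Qed.

Lemma Ex_stab_hole_le V o r : uniq V -> {subset box o r <= V} ->
  E V (St V (hole o)) empty <= hole_prob r.
Proof.
move=> uV oV; rewrite -(hole_prob_box o).
have hb : antitone_on (box o r) (hole o) by apply: hole_antitone; exact: box_center.
rewrite -(@Ex_restrict _ _ _ _ mu_sum1 (box o r) V) ?box_uniq//; last first.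
  by apply: local_stab => //; exact: hole_nb.
by apply: Ex_le => // c; apply: stab_le_sub => //; exact: hole_nb.
Qed.

(** [V] is enclosed in a box centered at [o], where a hole at [o] is less likely still. *)
Lemma Ex_stab_hole_ge V o m : (forall r, m <= hole_prob r) -> uniq V -> o \in V ->
  m <= E V (St V (hole o)) empty.
Proof.
move=> meps uV oV; have [r Vr] := subset_box V o.
rewrite (le_trans (meps r))// -(hole_prob_box o).
rewrite -(@Ex_restrict _ _ _ _ mu_sum1 V (box o r)) ?box_uniq//; last first.
  by apply: local_stab; [exact: hole_nb|exact: hole_antitone].
apply: Ex_le => // c; apply: stab_le_sub => //; first exact: hole_nb.
exact: hole_antitone.
Qed.

(** At distance more than [r.*2] the boxes of radius [r] around the two sites are disjoint;
    stabilizing them separately gives independent events. *)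
Lemma Ex_stab_hole2 V x y r : uniq V -> {subset box x r <= V} ->
  {subset box y r <= V} ->
  E V (St V (fun c => hole x c * hole y c)) empty <=
  hole_prob r ^+ 2 + (y \in box x r.*2)%:R.
Proof.
move=> uV xV yV; have [yx|yx] := boolP (y \in box x r.*2).
  rewrite -[leLHS]add0r lerD ?sqr_ge0// -[leRHS](Ex_cst mu_sum1 V 1 empty).
  apply: Ex_le => // c; apply: stab_ub => //.
    split=> [c'|]; first by rewrite mulr_ge0// /hole ler0n.
    by exists 1 => c'; rewrite /hole -natrM lern1 mulnb leq_b1.
  by move=> c'; rewrite /hole -natrM lern1 mulnb leq_b1.
rewrite addr0.
have dis : {in box x r, forall z, z \notin box y r}.
  move=> z zx; apply: contra yx => zy; rewrite -addnn.
  by apply: (box_trans _ zx); rewrite box_sym.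
have hx : antitone_on (box x r) (hole x) by apply: hole_antitone; exact: box_center.
have hy : antitone_on (box y r) (hole y) by apply: hole_antitone; exact: box_center.
have nb := hole_nb.
apply: (@le_trans _ _ (E V (fun c => St (box x r) (hole x) c * St (box y r) (hole y) c) empty)).
  by apply: Ex_le => // c; apply: stab_mul.
rewrite (Ex_mul mu_sum1 V empty dis); [|exact: local_stab..].
rewrite expr2 -{1}(hole_prob_box x) -(hole_prob_box y).
rewrite -(@Ex_restrict _ _ _ _ mu_sum1 (box x r) V) ?box_uniq//; last exact: local_stab.
by rewrite -(@Ex_restrict _ _ _ _ mu_sum1 (box y r) V) ?box_uniq//; exact: local_stab.
Qed.

Definition holes V c : R := \sum_(y <- V) hole y c.

Definition hole_in V c : pred (lattice d) := fun y => (y \in V) && (c y == 0%N).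

Lemma holes_nb V : nonneg_bounded (holes V).
Proof. by apply: nonneg_bounded_sum => y; exact: hole_nb. Qed.

Lemma holes_antitone V : antitone_on V (holes V).
Proof.
move=> c c' c'c; rewrite /holes big_seq [leRHS]big_seq.
by apply: ler_sum => y yV; apply: hole_antitone c'c.
Qed.

Lemma hit_nb V n x : nonneg_bounded (fun c => hit D p (hole_in V c) n x).
Proof. by split=> [c|]; [exact: hit_ge0|exists 1 => c; exact: hit_le1]. Qed.

Lemma hit_antitone V n x : antitone_on V (fun c => hit D p (hole_in V c) n x).
Proof.
move=> c c' c'c; apply: sub_hit => // y /andP[yV /eqP cy]; rewrite /hole_in yV /=.
by have := c'c _ yV; rewrite cy leqn0.
Qed.

(** Only the site of the added particle can be unstable, so that particle walks until it fills a
    hole; [n] steps do not take it out of [V]. *)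
Lemma stab_holes_add1_stable V n x c : uniq V -> stable V c ->
  {subset box x n <= V} ->
  hit D p (hole_in V c) n x + St V (holes V) (add1 x c) <= holes V c.
Proof.
move=> uV sc; elim: n x => [|n IH] x xV.
  rewrite add0r -(stab_stable D p one (holes V) sc).
  apply: antitone_stab => //; [exact: holes_nb|exact: holes_antitone|].
  by move=> y _; exact: leq_add1.
have xinV : x \in V by apply: xV; exact: box_center.
rewrite [hit _ _ _ _ _]/= {1}/hole_in xinV /=; case: ifPn => cx.
  rewrite stab_stable; last first.
    apply/stableP => y yV; rewrite /add1; case: eqP => [->|_].
      by rewrite (eqP cx).
    by rewrite addn0; move/stableP : sc; apply.
  rewrite /holes !(bigD1_seq x)//= /hole {1}/add1 eqxx addn1 /= add0r cx lerD2l.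
  by apply: ler_sum => y yx; rewrite /add1 (negbTE yx) addn0.
rewrite (@stab_unstable _ _ _ _ p_ge0 p_sum1 _ one01 V _ _ x)//; last 2 first.
- exact: holes_nb.
- by rewrite /add1 eqxx addn1 ltnS lt0n.
rewrite mul1r -stepD; apply: step_ub => // e /D_box e1.
have xeV : {subset box (x + e) n <= V}.
  move=> y yx; apply: xV; rewrite -[n.+1]add1n; apply: box_trans yx _.
  exact: (box_shift (box_center x 0) e1).
rewrite topple_add1_settled ifT; first exact: IH.
by apply: xeV; exact: box_center.
Qed.

(* A particle added at [x] to a stable configuration removes a hole as soon as
   a random walk started from [x] finds one inside [V]. *)
Lemma stab_holes_add1 V n x c : uniq V -> {subset box x n <= V} ->
  St V (fun c => hit D p (hole_in V c) n x) c + St V (holes V) (add1 x c) <=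
  St V (holes V) c.
Proof.
move=> uV xV; rewrite -lerBrDr; apply: stab_le => [//|//|//||k]; first exact: hit_nb.
rewrite lerBrDr; elim: k c => [|k IH] c; have [sc|uc] := boolP (stable V c).
- by rewrite stabn_stable// [leRHS]stab_stable//; exact: stab_holes_add1_stable.
- rewrite stabn0_unstable// add0r; apply: antitone_stab => //.
  + exact: holes_nb.
  + exact: holes_antitone.
  + by move=> y _; exact: leq_add1.
- by rewrite stabn_stable// [leRHS]stab_stable//; exact: stab_holes_add1_stable.
- have [y yV cy] := unstable_ex uc; have hB := holes_nb V.
  rewrite (stabn_unstable p_ge0 p_sum1 _ _ _ yV cy) mul1r.
  rewrite (stab_unstable p_ge0 p_sum1 one01 hB yV cy) mul1r.
  rewrite (@stab_unstable _ _ _ _ p_ge0 p_sum1 _ one01 V _ (add1 x c) y)//; last first.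
    by rewrite (leq_trans cy)// leq_add1.
  (* The added particle waits while [c] is being stabilized, by the abelian property. *)
  rewrite mul1r -stepD; apply: step_le => // e _.
  by rewrite topple_add1 ?IH// ltnW.
Qed.

Lemma stab_hit_le1 V n x c : St V (fun c => hit D p (hole_in V c) n x) c <= 1.
Proof. by apply: stab_ub => //; [exact: hit_nb|move=> c'; exact: hit_le1]. Qed.

(** The particles are added one by one. The hitting probability decreases as holes disappear, so its
    final value serves for all [j] of them, and [j <= K] bounds the total loss. *)
Lemma stab_holes_addk V n x j c : uniq V -> {subset box x n <= V} -> (j <= K)%N ->
  St V (holes V) (addk x j c) + j%:R -
    K%:R * (1 - St V (fun c => hit D p (hole_in V c) n x) (addk x j c)) <=
  St V (holes V) c.
Proof.
move=> uV xV jK; pose b c := hit D p (hole_in V c) n x.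
rewrite -[St V (fun c => hit _ _ _ _ _)]/(St V b).
have : St V (holes V) (addk x j c) + j%:R * St V b (addk x j c) <= St V (holes V) c.
  elim: j {jK} => [|j IH]; first by rewrite addk0 mul0r addr0.
  have Sj := stab_holes_add1 (addk x j c) uV xV.
  have bj : St V b (addk x j.+1 c) <= St V b (addk x j c).
    apply: antitone_stab => //; [exact: hit_nb|exact: hit_antitone|].
    by move=> y _; rewrite addkS leq_add1.
  have jb : j%:R * St V b (addk x j.+1 c) <= j%:R * St V b (addk x j c).
    by rewrite ler_wpM2l.
  by rewrite -addkS in Sj; rewrite -natr1; lra.
have := stab_hit_le1 V n x (addk x j c); rewrite -/b.
have : j%:R <= K%:R :> R by rewrite ler_nat.
move=> jKr B1; set B := St V b _ in B1 *.
have : j%:R * (1 - B) <= K%:R * (1 - B) by rewrite ler_wpM2r// subr_ge0.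
by lra.
Qed.

Definition mean_mu : R := \sum_(j < K.+1) mu j * j%:R.

(** A balance of holes: a site of [I], deep enough inside [V], removes [mean_mu] holes on average,
    up to [K] times the probability that its walk misses all the holes. The other sites create no
    hole. *)
Lemma Ex_holes V n (I : pred (lattice d)) s c : uniq V ->
  (forall x, I x -> {subset box x n <= V}) ->
  E s (St V (holes V)) c + mean_mu * (count I s)%:R <= St V (holes V) c +
  \sum_(x <- [seq x <- s | I x])
    K%:R * (1 - E s (St V (fun c => hit D p (hole_in V c) n x)) c).
Proof.
move=> uV IV; pose b x c := hit D p (hole_in V c) n x.
set H := St V (holes V).
rewrite -[X in _ <= _ + X]/(\sum_(x <- [seq x <- s | I x])
  K%:R * (1 - E s (St V (b x)) c)).
have H_anti : antitone_on V H.
  by apply: antitone_stab => //; [exact: holes_nb|exact: holes_antitone].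
have b_anti x : antitone_on V (St V (b x)).
  by apply: antitone_stab => //; [exact: hit_nb|exact: hit_antitone].
elim: s c => [|x s IH] c; first by rewrite big_nil mulr0.
have T F : E (x :: s) F c = E [:: x] (E s F) c by [].
have IHx : E [:: x] (E s H) c + mean_mu * (count I s)%:R <= E [:: x] H c +
    \sum_(y <- [seq y <- s | I y]) K%:R * (1 - E (x :: s) (St V (b y)) c).
  have := @Ex_le _ _ K mu mu_ge0 [:: x] _ _ c IH.
  rewrite !ExD (Ex_cst mu_sum1) (Ex_sum mu_sum1) => /le_trans; apply.
  rewrite lerD2l; apply: ler_sum => y _; rewrite ExZ ler_wpM2l//.
  rewrite (_ : (fun c => 1 - _) = (fun c => 1 + -1 * E s (St V (b y)) c)).
    by rewrite ExD ExZ (Ex_cst mu_sum1) mulN1r.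
  by apply/funext => c'; rewrite mulN1r.
rewrite T; have -> : count I (x :: s) = (I x + count I s)%N by [].
have -> : [seq y <- x :: s | I y] =
  if I x then x :: [seq y <- s | I y] else [seq y <- s | I y] by [].
case: ifPn => Ix; last first.
  have Hx : E [:: x] H c <= H c by apply: (Ex_antitone_le mu_ge0 mu_sum1) H_anti.
  by rewrite add0n; apply: (le_trans IHx); rewrite lerD2r.
(* The particles added later only fill holes, so the hitting probability may be evaluated after all
   of them. *)
have bx : E (x :: s) (St V (b x)) c <= E [:: x] (St V (b x)) c.
  by rewrite T; apply: Ex_le => // c'; exact: (Ex_antitone_le mu_ge0 mu_sum1) (b_anti x).
have Hx : E [:: x] H c + mean_mu <= H c + K%:R * (1 - E [:: x] (St V (b x)) c).
  have Hj (j : 'I_K.+1) : H (addk x j c) + j%:R <=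
      H c + K%:R * (1 - St V (b x) (addk x j c)).
    have jK : (j <= K)%N by rewrite -ltnS.
    by have := stab_holes_addk c uV (IV _ Ix) jK; rewrite lerBlDr.
  apply: (@le_trans _ _ (\sum_(j < K.+1) mu j * (H c + K%:R * (1 - St V (b x) (addk x j c))))).
    rewrite /= /mean_mu -big_split/=; apply: ler_sum => j _.
    by rewrite -mulrDr ler_wpM2l.
  under eq_bigr do rewrite mulrDr mulrCA mulrBr mulr1.
  by rewrite big_split/= -mulr_suml mu_sum1 mul1r -mulr_sumr sumrB mu_sum1.
have Kbx : K%:R * (1 - E [:: x] (St V (b x)) c) <=
    K%:R * (1 - E (x :: s) (St V (b x)) c).
  by rewrite ler_wpM2l// lerB.
rewrite natrD mulrDr mulr1.
by rewrite big_cons; lra.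
Qed.

Definition expect V f : R := E V (St V f) empty.

Lemma expectD V f g : nonneg_bounded f -> nonneg_bounded g ->
  expect V (fun c => f c + g c) = expect V f + expect V g.
Proof.
by move=> fB gB; rewrite -ExD; apply: eq_Ex => c; rewrite (stabD p_ge0 p_sum1 one01).
Qed.

Lemma expectZ V k f : nonneg_bounded f ->
  expect V (fun c => k * f c) = k * expect V f.
Proof.
by move=> fB; rewrite -ExZ; apply: eq_Ex => c; rewrite (stabZ p_ge0 p_sum1 one01).
Qed.

Lemma expect_step V F : (forall e, nonneg_bounded (F e)) ->
  expect V (fun c => step (F ^~ c)) = step (fun e => expect V (F e)).
Proof.
move=> FB; rewrite -(Ex_step mu_sum1); apply: eq_Ex => c.
by rewrite (stab_step p_ge0 p_sum1 one01).
Qed.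

Lemma expect_le V f g : nonneg_bounded f -> nonneg_bounded g ->
  (forall c, f c <= g c) -> expect V f <= expect V g.
Proof. by move=> fB gB fg; apply: Ex_le => // c; exact: stab_mono. Qed.

Lemma expect_ge0 V f : nonneg_bounded f -> 0 <= expect V f.
Proof. by move=> fB; apply: Ex_ge0 => // c; exact: stab_ge0. Qed.

Lemma expect_le1 V f : nonneg_bounded f -> (forall c, f c <= 1) -> expect V f <= 1.
Proof.
move=> fB f1; rewrite -[leRHS](Ex_cst mu_sum1 V 1 empty).
by apply: Ex_le => // c; exact: stab_ub.
Qed.

Definition hole_ind V c : lattice d -> R := fun y => (hole_in V c y)%:R.

Lemma hole_ind_nb V y : nonneg_bounded (fun c => hole_ind V c y).
Proof.
split=> [c|]; first by rewrite /hole_ind ler0n.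
by exists 1 => c; rewrite /hole_ind lern1 leq_b1.
Qed.

Lemma hole_indE V y : y \in V -> (fun c => hole_ind V c y) = hole y.
Proof. by move=> yV; apply/funext => c; rewrite /hole_ind /hole_in yV. Qed.

Lemma green_nb V n x : nonneg_bounded (fun c => green D p (hole_ind V c) n x).
Proof.
elim: n x => [|n IH] x; first exact: nonneg_bounded_cst.
by apply: nonneg_boundedD; [exact: hole_ind_nb|exact: nonneg_bounded_step].
Qed.

Lemma hole_ind_mul_nb V y f : nonneg_bounded f ->
  nonneg_bounded (fun c => hole_ind V c y * f c).
Proof.
move=> [f0 [M fM]]; split=> [c|]; first by rewrite mulr_ge0// /hole_ind ler0n.
exists M => c; rewrite (le_trans _ (fM c))// ler_piMl//.
by rewrite /hole_ind lern1 leq_b1.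
Qed.

Lemma green2_nb V n x : nonneg_bounded (fun c => green2 D p (hole_ind V c) n x).
Proof.
elim: n x => [|n IH] x; first exact: nonneg_bounded_cst.
apply: nonneg_boundedD; last exact: nonneg_bounded_step.
apply: nonneg_boundedD; first exact: hole_ind_nb.
apply: nonneg_boundedZ => //; apply: hole_ind_mul_nb.
by apply: nonneg_bounded_step => // e; exact: green_nb.
Qed.

Lemma box_step x e n : e \in D -> {subset box (x + e) n <= box x n.+1}.
Proof.
move=> /D_box e1 y yx; rewrite -[n.+1]add1n; apply: box_trans yx _.
exact: (box_shift (box_center x 0) e1).
Qed.

Lemma expect_green_ge V n x m : (forall r, m <= hole_prob r) -> uniq V ->
  {subset box x n <= V} ->
  n%:R * m <= expect V (fun c => green D p (hole_ind V c) n x).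
Proof.
move=> meps uV; elim: n x => [|n IH] x xV.
  by rewrite mul0r expect_ge0//; exact: nonneg_bounded_cst.
have gB e : nonneg_bounded (fun c => green D p (hole_ind V c) n (x + e)).
  exact: green_nb.
rewrite [leRHS](expectD V (hole_ind_nb V x)); last exact: nonneg_bounded_step.
rewrite expect_step// -natr1 mulrDl mul1r addrC lerD//.
  have xinV : x \in V by apply: xV; exact: box_center.
  by rewrite hole_indE//; exact: Ex_stab_hole_ge.
apply: step_lb => // e eD; apply: IH => y yx.
by apply: xV; exact: box_step yx.
Qed.

(** Positions within [r.*2] of [y] are merely counted; at the others, holes are nearly independent
    of the one at [y]. *)
Lemma expect_hole_green_le V n r y z : uniq V -> {subset box y r <= V} ->
  (forall z', z' \in box z n -> {subset box z' r <= V}) ->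
  expect V (fun c => hole_ind V c y * green D p (hole_ind V c) n z) <=
  n%:R * hole_prob r ^+ 2 + green D p (fun z => (z \in box y r.*2)%:R) n z.
Proof.
move=> uV yV; elim: n z => [|n IH] z zV.
  rewrite mul0r addr0 (_ : (fun c => _) = fun=> 0); last first.
    by apply/funext => c; rewrite /= mulr0.
  rewrite -[leRHS](Ex_cst mu_sum1 V 0 empty) Ex_le// => c.
  by apply: stab_ub => //; exact: nonneg_bounded_cst.
rewrite (_ : (fun c => _) = (fun c => hole_ind V c y * hole_ind V c z +
    step (fun e => hole_ind V c y * green D p (hole_ind V c) n (z + e)))); last first.
  by apply/funext => c; rewrite /= mulrDr stepZ.
rewrite expectD; last 2 first.
- by apply: hole_ind_mul_nb; exact: hole_ind_nb.
- by apply: nonneg_bounded_step => // e; apply: hole_ind_mul_nb; exact: green_nb.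
rewrite expect_step; last first.
  by move=> e; apply: hole_ind_mul_nb; exact: green_nb.
rewrite [green _ _ _ n.+1 z]/= -natr1 mulrDl mul1r.
rewrite [X in _ <= X + _]addrC addrACA; apply: lerD.
  have zr := zV _ (box_center z n.+1).
  rewrite (_ : (fun c => _) = (fun c => hole y c * hole z c)).
    exact: Ex_stab_hole2.
  apply/funext => c; rewrite /hole_ind /hole_in.
  by rewrite (yV _ (box_center y r)) (zr _ (box_center z r)).
rewrite -[X in _ <= X + _](step_cst p_sum1) -stepD; apply: step_le => // e eD.
by apply: IH => z' zz'; apply: zV; exact: box_step zz'.
Qed.

(** The square of the number of holes met is expanded: [n] diagonal terms, near pairs bounded
    through [B], and far pairs through [hole_prob r ^+ 2]. *)
Lemma expect_green2_le V N n r x B : uniq V ->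
  (forall m y z, (m <= N)%N -> green D p (fun z => (z \in box y r.*2)%:R) m z <= B) ->
  (n <= N)%N -> (forall y, y \in box x n -> {subset box y r <= V}) ->
  expect V (fun c => green2 D p (hole_ind V c) n x) <=
  n%:R * (1 + 2 * B) + n%:R ^+ 2 * hole_prob r ^+ 2.
Proof.
move=> uV HB; elim: n x => [|n IH] x nN xV.
  rewrite mul0r expr0n mul0r addr0 -[leRHS](Ex_cst mu_sum1 V 0 empty).
  apply: Ex_le => // c.
  by apply: stab_ub => //; exact: nonneg_bounded_cst.
have gB e : nonneg_bounded (fun c => green D p (hole_ind V c) n (x + e)).
  exact: green_nb.
have g2B e : nonneg_bounded (fun c => green2 D p (hole_ind V c) n (x + e)).
  exact: green2_nb.
have hgB e : nonneg_bounded (fun c => hole_ind V c x * green D p (hole_ind V c) n (x + e)).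
  exact: hole_ind_mul_nb.
have xV' e y : e \in D -> y \in box (x + e) n -> {subset box y r <= V}.
  by move=> eD yx; apply: xV; exact: box_step yx.
rewrite (_ : (fun c => _) = (fun c => hole_ind V c x +
    2 * step (fun e => hole_ind V c x * green D p (hole_ind V c) n (x + e)) +
    step (fun e => green2 D p (hole_ind V c) n (x + e)))); last first.
  by apply/funext => c; rewrite /= stepZ.
rewrite expectD; last 2 first.
- apply: nonneg_boundedD; first exact: hole_ind_nb.
  by apply: nonneg_boundedZ => //; exact: nonneg_bounded_step.
- exact: nonneg_bounded_step.
rewrite expectD; last 2 first.
- exact: hole_ind_nb.
- by apply: nonneg_boundedZ => //; exact: nonneg_bounded_step.
rewrite expectZ; last exact: nonneg_bounded_step.
rewrite !expect_step//.
have h1 : expect V (fun c => hole_ind V c x) <= 1.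
  by apply: expect_le1; [exact: hole_ind_nb|move=> c; rewrite /hole_ind lern1 leq_b1].
have h2 : step (fun e => expect V (fun c => hole_ind V c x *
    green D p (hole_ind V c) n (x + e))) <= n%:R * hole_prob r ^+ 2 + B.
  apply: step_ub => // e eD; apply: (le_trans (expect_hole_green_le uV _ _)).
  + by apply: xV; exact: box_center.
  + by move=> z' /xV'; exact.
  + by rewrite lerD2l HB// ltnW.
have h3 : step (fun e => expect V (fun c => green2 D p (hole_ind V c) n (x + e))) <=
    n%:R * (1 + 2 * B) + n%:R ^+ 2 * hole_prob r ^+ 2.
  by apply: step_ub => // e eD; apply: IH; [exact: ltnW|move=> y /xV'; exact].
move: (step _) (step _) (expect _ _) h1 h2 h3 => a b c h1 h2 h3.
have := sqr_ge0 (hole_prob r); rewrite -natr1; move: (hole_prob r ^+ 2) h2 h3 => E2 h2 h3 E0.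
have : n.+1%:R ^+ 2 = n%:R ^+ 2 + 2 * n%:R + 1 :> R by rewrite -natr1; ring.
by rewrite -natr1 => ->; lra.
Qed.

(* Chebyshev's inequality for the number of holes met by the walk. *)
Lemma expect_hit_ge V n r x B m : uniq V -> (forall r, m <= hole_prob r) -> 0 <= m ->
  (forall k y z, (k <= n)%N -> green D p (fun z => (z \in box y r.*2)%:R) k z <= B) ->
  (forall y, y \in box x n -> {subset box y r <= V}) ->
  2 * (n%:R * m) ^+ 2 <= (n%:R * m) ^+ 2 * expect V (fun c => hit D p (hole_in V c) n x) +
    (n%:R * (1 + 2 * B) + n%:R ^+ 2 * hole_prob r ^+ 2).
Proof.
move=> uV meps m0 HB xV; set t := n%:R * m.
have t0 : 0 <= t by rewrite mulr_ge0.
have g := expect_green2_le uV HB (leqnn n) xV.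
have xV' : {subset box x n <= V} by move=> y yx; apply: (xV _ yx); exact: box_center.
have g1 := expect_green_ge meps uV xV'.
rewrite (@le_trans _ _ (2 * t * expect V (fun c => green D p (hole_ind V c) n x)))//.
  by rewrite expr2 mulrA ler_wpM2l// mulr_ge0.
rewrite (@le_trans _ _ (t ^+ 2 * expect V (fun c => hit D p (hole_in V c) n x) +
   expect V (fun c => green2 D p (hole_ind V c) n x)))//; last by rewrite lerD2l.
have hB := hit_nb V n x; have gB := green_nb V n x; have g2B := green2_nb V n x.
rewrite -!expectZ// -expectD//; last exact: nonneg_boundedZ (sqr_ge0 t) hB.
apply: expect_le.
- by apply: nonneg_boundedZ => //; rewrite mulr_ge0.
- by apply: nonneg_boundedD => //; apply: nonneg_boundedZ => //; exact: sqr_ge0.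
- by move=> c; exact: second_moment.
Qed.

End Holes.

(** * Density of holes in large boxes *)

Section HoleDensity.
Variables (R : realType) (d : nat).
Variables (D : seq (lattice d)) (p : lattice d -> R).
Hypothesis p_ge0 : forall e, 0 <= p e.
Hypothesis p_sum1 : \sum_(e <- D) p e = 1.
Hypothesis D_box : {subset D <= box 0 1}.
Variables (e0 : lattice d).
Hypotheses (e0D : e0 \in D) (pe0 : 0 < p e0) (e0_neq0 : e0 != 0).

Lemma bernoulli_le (t : R) n : 0 <= t <= 1 -> 1 - n%:R * t <= (1 - t) ^+ n.
Proof.
move=> /andP[t0 t1]; elim: n => [|n IH]; first by rewrite mul0r subr0.
rewrite exprS (le_trans _ (ler_wpM2l _ IH)) ?subr_ge0// -natr1.
have nt : 0 <= n%:R * t * t by rewrite !mulr_ge0.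
by lra.
Qed.

(** The boundary layer of width [a] is negligible in a large box, by Bernoulli's inequality with
    exponent [d]. *)
Lemma box_ratio a (g : R) : 0 < g -> exists2 L, (a <= L)%N &
  (1 - g) * (size (box (0 : lattice d) L))%:R <= (size (box (0 : lattice d) (L - a)))%:R.
Proof.
move=> g0; set x : R := d%:R * a.*2%:R / g.
have [q xq] : exists q : nat, x < q%:R by exists (Num.truncn x).+1; exact: truncnS_gt.
pose L := (a + q)%N.
exists L; first exact: leq_addr.
rewrite !size_box !natrX.
have B0 : 0 < L.*2.+1%:R :> R by rewrite ltr0n.
pose t : R := a.*2%:R / L.*2.+1%:R.
have t01 : 0 <= t <= 1.
  rewrite divr_ge0//= ler_pdivrMr// mul1r ler_nat.
  by rewrite -addnn -muln2; lia.
have -> : ((L - a).*2.+1)%:R = L.*2.+1%:R * (1 - t) :> R.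
  rewrite mulrBr mulr1 mulrCA divff ?gt_eqF// mulr1 -natrB; last by rewrite -!muln2; lia.
  by congr (_%:R); rewrite -!muln2; lia.
rewrite exprMn mulrC ler_wpM2l ?exprn_ge0//.
apply: le_trans (bernoulli_le d t01); rewrite lerD2l lerN2.
rewrite mulrA ler_pdivrMr// [leRHS]mulrC -ler_pdivrMr//.
rewrite -/x (le_trans (ltW xq))// ler_nat.
by rewrite -muln2 /L; lia.
Qed.

Lemma green_box_sublinear s (k : R) : 0 < k -> exists N, forall n, (N <= n)%N ->
  forall m y z, (m <= n)%N ->
  green D p (fun z => (z \in box y s)%:R) m z <= k * n%:R.
Proof.
move=> k0; pose b := size (box (0 : lattice d) s).
have b0 : 0 < b%:R :> R by rewrite ltr0n /b size_box expn_gt0.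
have kb : 0 < k / b%:R by rewrite divr_gt0.
have [N HN] := green_sublinear p_ge0 p_sum1 e0D pe0 e0_neq0 kb.
exists N => n Nn m y z mn.
rewrite (_ : (fun z => _) = fun z => \sum_(u <- box y s) (z == u)%:R); last first.
  apply/funext => u; have [uy|uy] := boolP (u \in box y s).
    rewrite (bigD1_seq u) ?box_uniq//= eqxx big1 ?addr0// => v.
    by rewrite eq_sym => /negbTE ->.
  rewrite big1_seq// => v /andP[_ vy].
  by case: eqP => // uv; move: uy; rewrite uv vy.
rewrite green_sum//.
apply: (@le_trans _ _ (\sum_(u <- box y s) (k / b%:R * n%:R))).
  by apply: ler_sum => u _; rewrite (le_trans _ (HN n Nn u z))// le_green.
rewrite big_const_seq count_predT iter_addr_0 -[leLHS]mulr_natl size_box.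
by rewrite -(@size_box d 0) -/b mulrA mulrCA divff ?mulr1// gt_eqF.
Qed.

Variables (K : nat) (mu : nat -> R).
Hypothesis mu_ge0 : forall j, 0 <= mu j.
Hypothesis mu_sum1 : \sum_(j < K.+1) mu j = 1.
Hypothesis mean_le1 : mean_mu K mu <= 1.

Local Notation hole_prob := (hole_prob D p K mu).

(* If the density of holes stayed above [1 - mean], holes would be so frequent
   that almost all the particles would settle near their starting points; then
   the density of settled particles would be the mean of [mu]. *)
Lemma hole_density g : 0 < g <= 1 -> exists r, hole_prob r <= 1 - mean_mu K mu + g.
Proof.
(* [m] is the limiting density of holes, and bounds from below the probability of a hole in every
   finite domain. *)
move=> /andP[g0 g1]; pose m := inf (range hole_prob).
have infA : has_inf (range hole_prob).
  split; first by exists (hole_prob 0%N); exists 0%N.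
  by exists 0 => _ [r _ <-]; exact: hole_prob_ge0.
have m_le r : m <= hole_prob r by apply: ge_inf; [exact: infA.2|exists r].
have [mg|mg] := lerP m (1 - mean_mu K mu + g / 2).
  have g20 : 0 < g / 2 by lra.
  have [_ [r _ <-] rm] := inf_adherent g20 infA.
  by exists r; apply: ltW; apply: (lt_le_trans rm); rewrite -/m; lra.
exfalso.
have m0 : 0 < m by have := mean_le1; lra.
(* The walks will miss the holes with probability at most [4 * t]; at [K] particles per site this
   costs at most [g / 4]. *)
pose t := g / (16 * K.+1%:R).
have K1 : 1 <= K.+1%:R :> R by rewrite ler1n.
have t0 : 0 < t by rewrite divr_gt0// mulr_gt0//; lra.
have Kt : 4 * K%:R * t <= g / 4.
  rewrite /t mulrA ler_pdivrMr; last by lra.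
  rewrite (_ : g / 4 * (16 * K.+1%:R) = 4 * K.+1%:R * g); last by field.
  by rewrite ler_pM2r// ler_pM2l// ler_nat.
have t1 : t <= 1 / 16.
  by rewrite /t ler_pdivrMr; lra.
have mt0 : 0 < m * t by rewrite mulr_gt0.
have [_ [r _ <-] rm] := inf_adherent mt0 infA.
have {}rm : hole_prob r ^+ 2 <= m ^+ 2 * (1 + 3 * t).
  apply: (@le_trans _ _ ((m * (1 + t)) ^+ 2)).
    have em : hole_prob r <= m * (1 + t) by rewrite -/m in rm; lra.
    have e0' : 0 <= hole_prob r by exact: hole_prob_ge0.
    by rewrite !expr2; apply: ler_pM.
  rewrite exprMn ler_wpM2l ?sqr_ge0// expr2.
  have : t * t <= t by rewrite ler_piMl ?ltW//; lra.
  by lra.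
(* With this [k] and [n] large, the diagonal and near pairs of the second moment amount to at most a
   fraction [t] of the squared mean [(n%:R * m) ^+ 2]. *)
pose k := t * m ^+ 2 / 4.
have k0 : 0 < k by rewrite divr_gt0// mulr_gt0// exprn_gt0.
have [N HN] := green_box_sublinear r.*2 k0.
pose n := maxn N (Num.truncn (2 / (t * m ^+ 2))).+1.
have tm0 : 0 < t * m ^+ 2 by rewrite mulr_gt0// exprn_gt0.
have n1 : 1 <= t * m ^+ 2 * n%:R / 2.
  rewrite ler_pdivlMr// mul1r [leRHS]mulrC -ler_pdivrMr//.
  by rewrite (le_trans (ltW (truncnS_gt _)))// ler_nat leq_maxr.
have n0 : 0 < n%:R :> R by rewrite ltr0n /n leq_max orbT.
have {}HN := HN n (leq_maxl _ _).
have [L aL Lratio] := @box_ratio (n + r) (g / 8) ltac:(lra).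
pose V : seq (lattice d) := box 0 L.
have uV : uniq V by exact: box_uniq.
pose I : pred (lattice d) := fun x => x \in box 0 (L - (n + r)).
have IV x y : I x -> y \in box x n -> {subset box y r <= V}.
  move=> Ix yx z zy; rewrite /V -(subnK aL) addnA.
  by apply: box_trans zy _; apply: box_trans yx _.
have IV' x : I x -> {subset box x n <= V}.
  by move=> Ix y yx; apply: (IV x y) => //; exact: box_center.
(* Of the loss [4 * t], one [t] comes from the diagonal and near pairs, and [3 * t] from the excess
   of [hole_prob r ^+ 2] over [m ^+ 2]. *)
have hitI x : I x -> 1 - 4 * t <= expect D p K mu V (fun c => hit D p (hole_in V c) n x).
  move=> Ix; have nm : 0 < (n%:R * m) ^+ 2 by rewrite exprn_gt0// mulr_gt0.
  have := expect_hit_ge p_ge0 p_sum1 D_box mu_ge0 mu_sum1 uV m_le (ltW m0) HN (fun y => IV x y Ix).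
  set X := expect _ _ _ _ _ _ => HX.
  have h1 : n%:R * (1 + 2 * (k * n%:R)) <= t * (n%:R * m) ^+ 2.
    rewrite (_ : t * (n%:R * m) ^+ 2 = n%:R * (t * m ^+ 2 * n%:R)); last by ring.
    by rewrite ler_pM2l// /k; lra.
  have h2 : n%:R ^+ 2 * hole_prob r ^+ 2 <= (n%:R * m) ^+ 2 * (1 + 3 * t).
    rewrite [leRHS](_ : _ = n%:R ^+ 2 * (m ^+ 2 * (1 + 3 * t))); last by ring.
    by apply: ler_wpM2l => //; exact: sqr_ge0.
  rewrite -(ler_pM2l nm); move: HX h1 h2 => HX h1 h2.
  by rewrite mulrBr; lra.
pose v : R := (size V)%:R.
have v0 : 0 < v by rewrite /v size_box ltr0n expn_gt0.
pose e : lattice d -> nat := fun=> 0%N.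
have holes0 : stab D p (fun=> 1) V (holes R V) e = v.
  rewrite stab_stable; last by apply/stableP.
  by rewrite /holes /hole /= big_const_seq count_predT iter_addr_0.
pose J := [seq x <- V | I x].
have cJ : (count I V)%:R = (size J)%:R :> R by rewrite size_filter.
have sJ1 : (size J)%:R <= v by rewrite /v ler_nat size_filter count_size.
have sJ2 : (1 - g / 8) * v <= (size J)%:R.
  apply: (le_trans Lratio); rewrite ler_nat; apply: uniq_leq_size; first exact: box_uniq.
  by move=> x Ix; rewrite mem_filter /I Ix /=; apply: (IV' x Ix); exact: box_center.
have := @Ex_holes _ _ _ _ p_ge0 p_sum1 D_box _ _ mu_ge0 mu_sum1 V n I V e uV IV'.
rewrite holes0 cJ.
have : v * m <= Ex K mu V (stab D p (fun=> 1) V (holes R V)) e.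
  have -> : Ex K mu V (stab D p (fun=> 1) V (holes R V)) e =
      \sum_(y <- V) expect D p K mu V (hole R y).
    rewrite -(Ex_sum mu_sum1); apply: eq_Ex => c; apply: stab_sum => //.
      by move=> x; rewrite ler01 lexx.
    by move=> y; exact: hole_nb.
  rewrite [leLHS](_ : _ = \sum_(y <- V) m); last first.
    by rewrite big_const_seq count_predT iter_addr_0 -[RHS]mulr_natl.
  rewrite big_seq [leRHS]big_seq; apply: ler_sum => y yV.
  exact: Ex_stab_hole_ge.
have : \sum_(x <- J) K%:R * (1 - Ex K mu V (stab D p (fun=> 1) V
    (fun c => hit D p (hole_in V c) n x)) e) <= v * (g / 4).
  apply: (@le_trans _ _ (\sum_(x <- J) K%:R * (4 * t))).
    rewrite big_seq [leRHS]big_seq; apply: ler_sum => x.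
    rewrite mem_filter => /andP[/hitI hx _].
    by rewrite ler_wpM2l//; rewrite /expect in hx; lra.
  rewrite big_const_seq count_predT iter_addr_0 -[leLHS]mulr_natl.
  by apply: ler_pM => //; [rewrite !mulr_ge0// ltW|lra].
(* The balance bounds [m] by [1 - mean_mu K mu + g / 8 + g / 4], with [g / 8] for the boundary and
   [g / 4] for missed holes; this contradicts [mg]. *)
move: (Ex _ _ _ _ _) (\sum_(x <- _) _) => X Y XJ HY main.
have mean0 : 0 <= mean_mu K mu by apply: sumr_ge0 => j _; rewrite mulr_ge0.
have h3 : mean_mu K mu * ((1 - g / 8) * v) <= mean_mu K mu * (size J)%:R.
  by rewrite ler_wpM2l.
have h4 : mean_mu K mu * (g / 8) * v <= g / 8 * v.
  by rewrite -mulrA ler_piMl// mulr_ge0// ltW// divr_gt0.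
have : v * m <= v * (1 - mean_mu K mu + g / 8 + g / 4) by lra.
by rewrite ler_pM2l//; lra.
Qed.

End HoleDensity.

(** * Visits to a site during the stabilization *)

Section Visits.
Variables (R : realType) (d : nat).
Variables (D : seq (lattice d)) (p : lattice d -> R).
Hypothesis p_ge0 : forall e, 0 <= p e.
Hypothesis p_sum1 : \sum_(e <- D) p e = 1.
Hypothesis D_box : {subset D <= box 0 1}.
Variable o : lattice d.
Implicit Types (c : lattice d -> nat) (V W B s : seq (lattice d)).

(* Each toppling at [o] contributes a factor 1/2. *)
Definition halving (x : lattice d) : R := if x == o then 1 / 2 else 1.

Lemma halving01 x : 0 <= halving x <= 1.
Proof. by rewrite /halving; case: ifP => _; lra. Qed.

Local Notation w V := (stab D p halving V (fun=> 1)).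
Local Notation h n x := (hit D p (pred1 o) n x).

Definition not_filled W c : R := (has (fun y => c y == 0%N) W)%:R.

Local Notation bad W V := (stab D p (fun=> 1) V (not_filled W)).

Let one01 (x : lattice d) : 0 <= (1 : R) <= 1. Proof. by rewrite ler01 lexx. Qed.

Let cst1_nb : nonneg_bounded (fun _ : lattice d -> nat => 1 : R).
Proof. exact: nonneg_bounded_cst. Qed.

Lemma not_filled_nb W : nonneg_bounded (not_filled W).
Proof.
split=> [c|]; first by rewrite /not_filled ler0n.
by exists 1 => c; rewrite /not_filled lern1 leq_b1.
Qed.

Lemma visits_ge0 V c : 0 <= w V c.
Proof. by apply: stab_ge0 => //; exact: halving01. Qed.

Lemma visits_le1 V c : w V c <= 1.
Proof. by apply: stab_ub => //; exact: halving01. Qed.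

Lemma not_filled_antitone W V : {subset W <= V} -> antitone_on V (not_filled W).
Proof.
move=> WV c c' c'c; rewrite /not_filled ler_nat.
have [/hasP[y yW /eqP cy]|//] := boolP (has _ _).
rewrite (_ : has _ _)//; apply/hasP; exists y => //.
by have := c'c _ (WV _ yW); rewrite cy leqn0.
Qed.

Lemma visits_antitone V : antitone_on V (w V).
Proof. by apply: antitone_stab => //; exact: halving01. Qed.

(** Inside the filled region every site reached by the added particle becomes unstable, so the
    particle keeps walking; reaching [o] brings a factor 1/2. *)
Lemma visits_add1_filled V W n x c : {subset W <= V} -> stable V c ->
  {in W, forall y, c y != 0%N} -> {subset box x n <= W} ->
  w V (add1 x c) + h n x / 2 <= 1.
Proof.
move=> WV sc fW; elim: n x => [|n IH] x xW.
  by rewrite /= mul0r addr0 visits_le1.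
have xinW : x \in W by apply: xW; exact: box_center.
have xV := WV _ xinW.
have cx : (1 < add1 x c x)%N by rewrite /add1 eqxx addn1 ltnS lt0n fW.
rewrite (stab_unstable p_ge0 p_sum1 halving01 cst1_nb xV cx) [hit _ _ _ _ _]/=.
have [xo|xo] := eqVneq x o.
  have -> : halving x = 1 / 2 by rewrite /halving xo eqxx.
  have : step D p (fun e => w V (topple V x e (add1 x c))) <= 1.
    by apply: step_ub => // e _; exact: visits_le1.
  by lra.
have -> : halving x = 1 by rewrite /halving (negbTE xo).
rewrite mul1r [X in _ + X]mulrC -stepZ -stepD; apply: step_ub => // e eD.
have xeW : {subset box (x + e) n <= W}.
  by move=> y /(box_step D_box eD)/xW.
rewrite topple_add1_settled ifT; first by rewrite mulrC; exact: IH.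
by apply/WV/xeW; exact: box_center.
Qed.

(** The added particle is held back until [c] is stable. It then walks from [x], unless a site of
    [W] is vacant. *)
Lemma visits_add1 V W n x c : {subset W <= V} -> {subset box x n <= W} ->
  w V (add1 x c) <= (1 - h n x / 2) * w V c + bad W V c.
Proof.
move=> WV xW; apply: stab_le => // [|k]; first exact: halving01.
have h01 : 0 <= 1 - h n x / 2.
  by have := hit_le1 p_ge0 p_sum1 (pred1 o) n x; lra.
have nfB := not_filled_nb W.
have settled m c1 : stable V c1 -> stabn D p halving V (fun=> 1) m (add1 x c1) <=
    (1 - h n x / 2) * w V c1 + bad W V c1.
  move=> sc; rewrite !stab_stable// mulr1 /not_filled.
  apply: (@le_trans _ _ (w V (add1 x c1))); first by apply: stabn_le_stab => //; exact: halving01.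
  have [fW|/hasPn fW] := boolP (has _ _).
    rewrite (le_trans (visits_le1 _ _))//.
    by have := hit_le1 p_ge0 p_sum1 (pred1 o) n x; rewrite /=; lra.
  by have := visits_add1_filled WV sc fW xW; rewrite /=; lra.
elim: k c => [|k IH] c; have [sc|uc] := boolP (stable V c).
- exact: settled.
- have [y yV cy] := unstable_ex uc; rewrite stabn0_unstable.
    by rewrite addr_ge0 ?mulr_ge0 ?visits_ge0// stab_ge0.
  by apply: (unstableN yV); rewrite (leq_trans cy)// leq_add1.
- exact: settled.
- have [y yV cy] := unstable_ex uc.
  have cy' : (1 < add1 x c y)%N by rewrite (leq_trans cy)// leq_add1.
  rewrite (stabn_unstable p_ge0 p_sum1 _ _ _ yV cy').
  rewrite (stab_unstable p_ge0 p_sum1 halving01 cst1_nb yV cy).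
  rewrite (stab_unstable p_ge0 p_sum1 one01 nfB yV cy) mul1r.

  apply: (@le_trans _ _ (halving y * step D p (fun e => (1 - h n x / 2) *
     w V (topple V y e c) + bad W V (topple V y e c)))).
    have /andP[hy0 _] := halving01 y.
    rewrite ler_wpM2l//; apply: step_le => // e _.
    by rewrite topple_add1 ?IH// ltnW.
  (* The discount at [y] belongs to the recursion of [w] but not to that of [bad], where it is
     bounded by 1. *)
  rewrite stepD stepZ mulrDr mulrCA lerD2l ler_piMl//; last by have /andP[] := halving01 y.
  by apply: step_ge0 => // e _; exact: stab_ge0.
Qed.

Variables (K : nat) (mu : nat -> R).
Hypothesis mu_ge0 : forall j, 0 <= mu j.
Hypothesis mu_sum1 : \sum_(j < K.+1) mu j = 1.
Hypothesis mu0_gt0 : 0 < mu 0%N.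
Let alpha := 1 - mu 0%N.

Lemma alpha01 : 0 <= alpha <= 1.
Proof.
rewrite /alpha; have := mu_sum1; rewrite big_ord_recl/= => m1.
have : 0 <= \sum_(i < K) mu (bump 0 i) by apply: sumr_ge0.
by have := mu_ge0 0%N; lra.
Qed.

Lemma sum_mu_le (F : nat -> R) M : (forall j, F j.+1 <= M) ->
  \sum_(j < K.+1) mu j * F j <= mu 0%N * F 0%N + alpha * M.
Proof.
move=> FM; have := mu_sum1; rewrite !big_ord_recl/= => m1; rewrite lerD2l.
have -> : alpha = \sum_(i < K) mu (bump 0 i) by rewrite /alpha; lra.
by rewrite mulr_suml; apply: ler_sum => j _; rewrite ler_wpM2l.
Qed.

(* Conditionally on the counts outside [B], the particles of [B] move at last,
   when [W] has been filled, and perform independent walks. *)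
Lemma Ex_visits V W B n c : {subset W <= V} ->
  {in B, forall x, {subset box x n <= W}} ->
  Ex K mu B (w V) c <=
  \prod_(x <- B) (1 - alpha * h n x / 2) * w V c + (size B)%:R * bad W V c.
Proof.
move=> WV; have nfB := not_filled_nb W.
have /andP[al0 al1] := alpha01.
have bad_anti : antitone_on V (bad W V).
  by apply: antitone_stab => //; exact: not_filled_antitone.
elim: B c => [|x B IH] c BW; first by rewrite big_nil mul1r mul0r addr0.
have h01 : 0 <= h n x <= 1 by rewrite hit_ge0// hit_le1.
set P := \prod_(x <- B) _ in IH.
have P01 : 0 <= P <= 1.
  rewrite /P; elim: (B) => [|y B' /andP[IH0 IH1]]; first by rewrite big_nil ler01 lexx.
  have y01 : 0 <= 1 - alpha * h n y / 2 <= 1.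
    have h0 := hit_ge0 p_ge0 p_sum1 (pred1 o) n y.
    have h1 := hit_le1 p_ge0 p_sum1 (pred1 o) n y.
    have a0 : 0 <= alpha * h n y by rewrite mulr_ge0.
    have a1 : alpha * h n y <= 1 by rewrite mulr_ile1.
    by lra.
  have /andP[y0 y1] := y01.
  by rewrite big_cons mulr_ge0//= mulr_ile1.
have /andP[P0 P1] := P01.
have BW' : {in B, forall x, {subset box x n <= W}}.
  by move=> y yB; apply: BW; rewrite inE yB orbT.
have xW : {subset box x n <= W} by apply: BW; rewrite inE eqxx.
rewrite big_cons -/P [Ex _ _ _ _ _]/=.
apply: (@le_trans _ _ (\sum_(j < K.+1) mu j * (P * w V (addk x j c) +
    (size B)%:R * bad W V c))).
  apply: ler_sum => j _; rewrite ler_wpM2l// (le_trans (IH _ BW'))// lerD2l.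
  by rewrite ler_wpM2l//; apply: bad_anti => y _; exact: leq_addk.
apply: (le_trans (@sum_mu_le (fun j => P * w V (addk x j c) + (size B)%:R * bad W V c)
  (P * w V (add1 x c) + (size B)%:R * bad W V c) _)).
  move=> j; rewrite lerD2r ler_wpM2l//; apply: visits_antitone => y _.
  by rewrite addkS /add1 leq_add2r leq_addk.
rewrite addk0.
have wx c1 := visits_add1 c1 WV xW.
have wc0 := visits_ge0 V c.
have bc0 : 0 <= bad W V c by exact: stab_ge0.
have -> : (size (x :: B))%:R = (size B)%:R + 1 :> R by rewrite natr1.
have key : P * w V (add1 x c) <= P * ((1 - h n x / 2) * w V c) + bad W V c.
  rewrite (le_trans (ler_wpM2l P0 (wx c)))// mulrDr lerD2l.
  by rewrite ler_piMl.
have : alpha * (P * w V (add1 x c)) <= alpha * (P * ((1 - h n x / 2) * w V c)) + bad W V c.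
  rewrite (le_trans (ler_wpM2l al0 key))// mulrDr lerD2l.
  by rewrite ler_piMl.
rewrite /alpha; move: (w V c) (w V (add1 x c)) (bad W V c) => a b e.
by lra.
Qed.

(** Only the event that all the counts in [B] vanish is kept. This compares a start with [B] empty
    to the i.i.d. start, at the price of a constant factor. *)
Lemma Ex_ge_empty B F c : (forall c, 0 <= F c) -> mu 0%N ^+ size B * F c <= Ex K mu B F c.
Proof.
move=> F0; elim: B c => [|x B IH] c; first by rewrite mul1r.
rewrite /= exprS -mulrA big_ord_recl addk0 -[leLHS]addr0 lerD//.
  by rewrite ler_wpM2l.
by apply: sumr_ge0 => j _; rewrite mulr_ge0// Ex_ge0.
Qed.

(** A weak form of the exponential bound on the product, sufficient because the sum of [hit]
    diverges. *)
Lemma prod_le_sum (I : Type) (s : seq I) (t : I -> R) :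
  (forall i, 0 <= t i <= 1) -> \prod_(i <- s) (1 - t i) * (1 + \sum_(i <- s) t i) <= 1.
Proof.
move=> t01; elim: s => [|i s IH]; first by rewrite !big_nil addr0 mulr1.
rewrite !big_cons; have /andP[t0 t1] := t01 i.
have P0 : 0 <= \prod_(j <- s) (1 - t j).
  by apply: prodr_ge0 => j _; have /andP[] := t01 j; lra.
have S0 : 0 <= \sum_(j <- s) t j.
  by apply: sumr_ge0 => j _; have /andP[] := t01 j.
apply: le_trans IH; rewrite mulrAC mulrC ler_wpM2l//.
set S := \sum_(j <- s) _ in S0 *.
have : 0 <= t i * (t i + S) by rewrite mulr_ge0// addr_ge0.
by lra.
Qed.

(** The counts in [B] are added last. The first term is the effect of their walks through a filled
    [W]; the second is a union bound on the holes in [W], each site of which has a box of radius [r]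
    inside [V]. *)
Lemma Ex_visits_box n r :
  Ex K mu (box o (n + n + r)) (w (box o (n + n + r))) (fun=> 0%N) <=
  (1 + alpha / 2 * \sum_(x <- box o n) h n x)^-1 +
  (size (box o n))%:R * mu 0%N ^- size (box o n) *
    ((size (box o (n + n)))%:R * hole_prob D p K mu r).
Proof.
set V := box o (n + n + r); set B := box o n; set W := box o (n + n).
have /andP[al0 al1] := alpha01.
have nfB := not_filled_nb W.
have WV : {subset W <= V} by apply: sub_box; exact: leq_addr.
have BW : {in B, forall x, {subset box x n <= W}}.
  by move=> x xB y yx; apply: box_trans yx xB.
have BV : {subset B <= V} by move=> x xB; apply: WV; apply: BW xB _ _; exact: box_center.
pose s := [seq x <- V | x \notin B].
have Vs : perm_eq V (s ++ B).
  apply: uniq_perm; first exact: box_uniq.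
    rewrite cat_uniq filter_uniq ?box_uniq//= andbT.
    by apply/hasPn => x xB; rewrite mem_filter xB.
  move=> x; rewrite mem_cat mem_filter; case: (boolP (x \in B)) => [/BV ->|]//=.
  by rewrite orbF.
rewrite (Ex_perm _ _ _ _ Vs) Ex_cat.
apply: (@le_trans _ _ (Ex K mu s (fun c =>
    \prod_(x <- B) (1 - alpha * h n x / 2) * w V c + (size B)%:R * bad W V c)
    (fun=> 0%N))).
  by apply: Ex_le => // c; exact: Ex_visits.
rewrite ExD !ExZ; apply: lerD.
  set t := fun x => alpha * h n x / 2.
  have t01 x : 0 <= t x <= 1.
    have h0 := hit_ge0 p_ge0 p_sum1 (pred1 o) n x.
    have h1 := hit_le1 p_ge0 p_sum1 (pred1 o) n x.
    have a0 : 0 <= alpha * h n x by rewrite mulr_ge0.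
    have a1 : alpha * h n x <= 1 by rewrite mulr_ile1.
    by rewrite /t; lra.
  have := prod_le_sum B t01.
  rewrite (_ : \sum_(x <- B) t x = alpha / 2 * \sum_(x <- B) h n x); last first.
    by rewrite mulr_sumr; apply: eq_bigr => x _; rewrite /t mulrAC.
  have S0 : 0 < 1 + alpha / 2 * \sum_(x <- B) h n x.
    rewrite ltr_wpDr// mulr_ge0//; first by lra.
    by apply: sumr_ge0 => x _; exact: hit_ge0.
  rewrite -ler_pdivlMr// mul1r; apply: le_trans.
  have P0 : 0 <= \prod_(x <- B) (1 - alpha * h n x / 2).
    by apply: prodr_ge0 => x _; have /andP[_] := t01 x; rewrite subr_ge0.
  rewrite ler_piMr//.
  rewrite -[leRHS](Ex_cst mu_sum1 s 1 (fun=> 0%N)).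
  by apply: Ex_le => // c; exact: visits_le1.
rewrite -mulrA ler_wpM2l//.
have m0 : 0 < mu 0%N ^+ size B by rewrite exprn_gt0.
rewrite mulrC ler_pdivlMr//.
apply: (@le_trans _ _ (Ex K mu V (bad W V) (fun=> 0%N))).
  rewrite (Ex_perm _ _ _ _ Vs) Ex_cat mulrC -ExZ; apply: Ex_le => // c.
  by apply: Ex_ge_empty => c'; exact: stab_ge0.
have nb (y : lattice d) : nonneg_bounded (hole R y) by exact: hole_nb.
apply: (@le_trans _ _ (\sum_(y <- W) Ex K mu V (stab D p (fun=> 1) V (hole R y)) (fun=> 0%N))).
  rewrite -(Ex_sum mu_sum1); apply: Ex_le => // c.
  rewrite -stab_sum//; apply: stab_mono => //; first exact: nonneg_bounded_sum.
  move=> c'; rewrite /not_filled; have [/hasP[y yW cy]|_] := boolP (has _ _); last first.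
    by apply: sumr_ge0 => y _; case: (nb y).
  rewrite (bigD1_seq y) ?box_uniq//= {1}/hole cy lerDl.
  by apply: sumr_ge0 => z _; case: (nb z).
apply: (@le_trans _ _ (\sum_(y <- W) hole_prob D p K mu r)).
  rewrite big_seq [leRHS]big_seq; apply: ler_sum => y yW.
  apply: Ex_stab_hole_le => //; first exact: box_uniq.
  by move=> z zy; apply: box_trans zy yW.
by rewrite big_const_seq count_predT iter_addr_0 -[leLHS]mulr_natl.
Qed.

End Visits.

(** * Generators at finite configurations *)

Lemma sum_moved (T : eqType) (c c' : T -> nat) (x y : T) (s : seq T) :
  uniq s -> x \in s -> y \in s ->
  (0 < c x)%N -> (forall z : T, c' z = (c z - (z == x) + (z == y))%N) ->
  (\sum_(u <- s) c' u = \sum_(u <- s) c u)%N.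
Proof.
move=> us xs ys cx cE.
have ind (z0 : T) : z0 \in s -> (\sum_(u <- s) (u == z0) = 1)%N.
  move=> z0s; rewrite (bigD1_seq z0)//= eqxx big1 ?addn0// => z /negbTE ->//.
apply/eqP; rewrite -(eqn_add2r 1) -{1}(ind x xs) -(ind y ys) -!big_split/=.
apply/eqP; apply: eq_bigr => z _; rewrite cE.
by case: eqVneq => [->|_]; case: eqVneq => _ /=; lia.
Qed.

Section Moves.
Variables (R : realType) (d : nat).
Variables (D : seq (lattice d)) (p : lattice d -> R).
Hypothesis p_ge0 : forall e, 0 <= p e.
Hypothesis p_sum1 : \sum_(e <- D) p e = 1.
Hypothesis D_uniq : uniq D.
Hypothesis D_neq0 : 0 \notin D.
Hypothesis p_supp : forall z, z \notin D -> p z = 0.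
Variable lambda : \bar R.
Hypothesis lambda_gt0 : (0 < lambda)%E.
Implicit Types (xi : config d) (x y z : lattice d) (s : seq (lattice d)).

Definition particles xi : lattice d -> nat := fun x => num_particles (xi x).

Definition jump_rate xi x : R :=
  if lambda is r%:E then (num_active (xi x))%:R
  else if (2 <= num_active (xi x))%N then (num_active (xi x))%:R else 0.

Definition sleep_rate xi x : R :=
  if lambda is r%:E then r * (num_active (xi x))%:R else 0.

Definition jumped xi x y : config d :=
  if lambda is r%:E then jump x y xi else sleep_everywhere (jump x y xi).

Definition rate_bound : R := if lambda is r%:E then 1 + r else 1.

Lemma rate_bound_ge0 : 0 <= rate_bound.
Proof.
move: lambda_gt0; rewrite /rate_bound; case: lambda => // r.
by rewrite lte_fin => r0; rewrite addr_ge0// ltW.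
Qed.

Lemma jump_rate_ge0 xi x : 0 <= jump_rate xi x.
Proof. by rewrite /jump_rate; case: lambda => [r||]; rewrite ?ler0n//; case: ifP. Qed.

Lemma sleep_rate_ge0 xi x : 0 <= sleep_rate xi x.
Proof.
move: lambda_gt0; rewrite /sleep_rate; case: lambda => //= r.
by rewrite lte_fin => r0; rewrite mulr_ge0// ltW.
Qed.

Lemma num_active_le (a : site_state) : (num_active a <= num_particles a)%N.
Proof. by case: a. Qed.

Lemma jump_rate_le xi x : jump_rate xi x <= (particles xi x)%:R.
Proof.
have := num_active_le (xi x).
by rewrite /jump_rate; case: lambda => [r||]; rewrite ?ler_nat//;
  case: ifP => //; rewrite ?ler_nat ?ler0n.
Qed.

Lemma rates_le xi x :
  sleep_rate xi x + jump_rate xi x <= rate_bound * (particles xi x)%:R.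
Proof.
have na : (num_active (xi x))%:R <= (particles xi x)%:R :> R.
  by rewrite ler_nat num_active_le.
have := jump_rate_le xi x.
rewrite /jump_rate /sleep_rate /rate_bound; move: lambda_gt0.
case: lambda => [r||] //; last by rewrite add0r mul1r.
rewrite lte_fin => r0 _; rewrite -[X in _ + X]mul1r -mulrDl [r + 1]addrC ler_wpM2l//.
by rewrite addr_ge0// ltW.
Qed.

Lemma jump_rate_ge1 xi x : (2 <= particles xi x)%N -> 1 <= jump_rate xi x.
Proof.
rewrite /particles /jump_rate; case: (xi x) => //= n n2.
case: lambda => [r||]; rewrite ?n2 ler1n; exact: ltnW.
Qed.

Lemma jump_rate_gt0 xi x : 0 < jump_rate xi x -> (0 < num_active (xi x))%N.
Proof.
rewrite /jump_rate; case: lambda => [r||]; rewrite ?ltr0n//; case: ifP; rewrite ?ltr0n ?ltxx//.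
Qed.

Lemma particles_try_sleep a : num_particles (try_sleep a) = num_particles a.
Proof. by case: a => [[|[|n]]|]. Qed.

Lemma particles_sleep xi x : particles (sleep_at x xi) = particles xi.
Proof.
apply/funext => z; rewrite /particles /sleep_at.
by case: ifP => // _; exact: particles_try_sleep.
Qed.

Lemma particles_jumped xi x y : (0 < num_active (xi x))%N -> y != x ->
  particles (jumped xi x y) =
  fun z => (particles xi z - (z == x) + (z == y))%N.
Proof.
move=> nx yx; apply/funext => z.
have -> : particles (jumped xi x y) z = num_particles (jump x y xi z).
  by rewrite /particles /jumped; case: lambda => [r||] //; exact: particles_try_sleep.
rewrite /jump /particles; have [->|zx] := eqVneq z x.
  rewrite eq_sym (negbTE yx) addn0; case: (xi x) nx => //= n _.
  by rewrite subn1.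
by rewrite subn0; case: eqVneq => _; rewrite ?addn0// addn1; case: (xi z).
Qed.

Definition supports s xi := uniq s /\ forall x, (x \in s) = (particles xi x != 0%N).

(** Preserved by every move; on this set of configurations the total rate is bounded. *)
Definition at_most n xi := exists2 s, supports s xi & (\sum_(x <- s) particles xi x <= n)%N.

Lemma at_most_sub s n xi : uniq s -> (forall x, particles xi x != 0%N -> x \in s) ->
  (\sum_(x <- s) particles xi x <= n)%N -> at_most n xi.
Proof.
move=> us xs sn; exists [seq x <- s | particles xi x != 0%N].
  split; first exact: filter_uniq.
  by move=> x; rewrite mem_filter; case: (boolP (_ != _)) => // /xs.
rewrite big_filter; apply: leq_trans sn.
by rewrite [leqRHS](bigID (fun x => particles xi x != 0%N))/= leq_addr.
Qed.

Lemma at_most_sleep n xi x : at_most n xi -> at_most n (sleep_at x xi).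
Proof. by rewrite /at_most /supports particles_sleep. Qed.

Lemma at_most_jumped n xi x y : at_most n xi -> (0 < num_active (xi x))%N -> y != x ->
  at_most n (jumped xi x y).
Proof.
move=> [s [us sE] sn] nx yx.
have px : (0 < particles xi x)%N by rewrite (leq_trans nx)// num_active_le.
have xs : x \in s by rewrite sE -lt0n.
have PE := particles_jumped nx yx.
pose s' := undup (y :: s).
have us' : uniq s' by exact: undup_uniq.
have ss' : {subset s <= s'} by move=> z zs; rewrite mem_undup inE zs orbT.
apply: (@at_most_sub s') => //.
  move=> z; rewrite PE mem_undup inE sE; case: (eqVneq z y) => //= _.
  by rewrite addn0; apply: contra => /eqP ->; rewrite sub0n.
have ys' : y \in s' by rewrite mem_undup inE eqxx.
rewrite (@sum_moved _ (particles xi) _ x y _ us' (ss' _ xs) ys' px); last first.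
  by move=> z; rewrite PE.
apply: leq_trans sn; rewrite (bigID (fun z => z \in s))/= [X in (_ + X)%N]big1; last first.
  by move=> z; rewrite sE negbK => /eqP.
rewrite addn0 -big_filter (perm_big s)//; apply: uniq_perm => //.
  exact: filter_uniq.
by move=> z; rewrite mem_filter; case: (boolP (z \in s)) => // /ss'.
Qed.

(** The generator as a finite sum of rates times increments, in one form for finite and infinite
    [lambda]. *)
Definition drift s (f : config d -> R) xi : R :=
  \sum_(x <- s) (sleep_rate xi x * (f (sleep_at x xi) - f xi) +
    jump_rate xi x * (step D p (fun e => f (jumped xi x (x + e))) - f xi)).

Lemma fsum_step (F : lattice d -> R) x :
  \sum_(y \in [set: lattice d]) p (y - x) * F y = step D p (fun e => F (x + e)).
Proof.
rewrite (@fsbigE _ _ _ _ _ [seq x + e | e <- D]).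
- rewrite big_mkcond big_map; apply: eq_bigr => e _.
  by rewrite in_setT addrAC subrr add0r.
- by rewrite map_inj_uniq//; exact: addrI.
- by [].
- move=> y _ yD; rewrite p_supp ?mul0r//; apply: contra yD => yD.
  by apply/mapP; exists (y - x) => //; rewrite addrC subrK.
Qed.

Lemma generatorE s f xi : supports s xi -> generator p lambda f xi = drift s f xi.
Proof.
move=> [us sE]; rewrite /drift /jump_rate /sleep_rate /jumped /generator.
have na0 x : x \notin s -> num_active (xi x) = 0%N.
  move=> xs; apply/eqP; rewrite -leqn0 (leq_trans (num_active_le _))//.
  by move: xs; rewrite sE negbK => /eqP; rewrite /particles => ->.
move: lambda_gt0; case: lambda => [r|_|//].
  rewrite lte_fin => r0; rewrite /generator_finite (@fsbigE _ _ _ _ _ s)//; last first.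
    by move=> x _ /na0 ->; rewrite mulr0 mul0r.
  rewrite big_mkcond; apply: eq_bigr => x _; rewrite in_setT.
  rewrite (_ : \sum_(y \in _) _ = (1 + r)^-1 * step D p (fun e => f (jump x (x + e) xi))).
    have r1 : 1 + r != 0 by rewrite gt_eqF// addr_gt0.
    by field.
  rewrite -(fsum_step (fun y => f (jump x y xi))) mulr_fsumr.
  by apply: eq_fsbigr => y _; rewrite mulrAC mulrA mulrC mulrA.
rewrite /generator_infinite (@fsbigE _ _ _ _ _ [seq x <- s | (2 <= num_active (xi x))%N]).
- rewrite big_filter_cond big_mkcond; apply: eq_bigr => x _; rewrite mul0r add0r.
  have -> : (x \in [set x | (1 < num_active (xi x))%N]) = (1 < num_active (xi x))%N.
    by apply/idP/idP => [/set_mem|/mem_set].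
  rewrite andbb; case: ifP => _; last by rewrite mul0r.
  by rewrite (fsum_step (fun y => f (sleep_everywhere (jump x y xi)))).
- exact: filter_uniq.
- by move=> x /=; rewrite mem_filter => /andP[].
- move=> x /= n2; rewrite mem_filter n2/= => /na0 n0.
  by rewrite n0 mul0r.
Qed.

End Moves.

(** * Comparison of the dynamics with the stabilization *)

Section Comparison.
Variables (R : realType) (d : nat).
Variables (D : seq (lattice d)) (p : lattice d -> R).
Hypothesis p_ge0 : forall e, 0 <= p e.
Hypothesis p_sum1 : \sum_(e <- D) p e = 1.
Hypothesis D_uniq : uniq D.
Hypothesis D_neq0 : 0 \notin D.
Hypothesis p_supp : forall z, z \notin D -> p z = 0.
Variables (e0 : lattice d).
Hypotheses (e0D : e0 \in D) (pe0 : 0 < p e0).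
Implicit Types (xi : config d) (x y z : lattice d) (s U : seq (lattice d)).

Local Notation step := (step D p).

Let e0_neq0 : e0 != 0.
Proof. by apply: contra D_neq0 => /eqP <-. Qed.

(* [g] is exponential along [e0], and plays the role of the expected exit time. *)
Lemma exit_time U : exists g : lattice d -> R, exists M : R,
  [/\ forall x, 0 <= g x, forall x, g x <= M &
   forall x, x \in U -> step (fun e => if x + e \in U then g (x + e) else 0) <= g x - 1].
Proof.
have [i ei] : exists i, e0 0 i != 0.
  apply/not_existsP => /(_ _)/negP/negPn ei; move/eqP: e0_neq0; apply.
  by apply/rowP => i; rewrite mxE; apply/eqP.
have [L UL] := subset_box U 0.
pose l x : int := Num.sg (e0 0 i) * x 0 i.
have l0 : 1 <= l e0 by rewrite /l; case: sgzP ei => //; lia.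
have lL x : x \in U -> `|l x| <= L%:Z.
  move=> /UL/mem_boxP/(_ i); rewrite mxE subr0 /l.
  rewrite normrM normr_sg ei mul1r -lez_nat abszE; apply: le_trans.
  by rewrite lexx.
have lD x : l (x + e0) = l x + l e0 by rewrite /l mxE mulrDr.
(* With this base, the jump [e0] alone gives [p e0 * b ^+ (n x).+1 = 2 * b ^+ n x], which exceeds
   [b ^+ n x] by at least 1. *)
pose b := 2 / p e0; pose T := b ^+ (L + L).+1.
have b1 : 1 <= b.
  have : p e0 <= 1.
    rewrite -p_sum1 (bigD1_seq e0)//= lerDl; exact: sumr_ge0.
  by rewrite /b ler_pdivlMr//; lra.
pose n x := absz (l x + L%:Z).
have nL x : x \in U -> (n x <= L + L)%N by move=> /lL; rewrite /n; lia.
have nD x : x \in U -> x + e0 \in U -> (n x < n (x + e0)%R)%N.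
  by move=> /lL + /lL; rewrite /n lD; lia.
pose g x := if x \in U then T - b ^+ n x else 0.
have T0 : 0 <= T by rewrite exprn_ge0//; lra.
have bT x : x \in U -> b ^+ (n x).+1 <= T.
  by move=> xU; rewrite /T ler_weXn2l// ltnS nL.
exists g, T; split.
- move=> x; rewrite /g; case: ifPn => // xU; rewrite subr_ge0 (le_trans _ (bT _ xU))//.
  by rewrite ler_weXn2l.
- move=> x; rewrite /g; case: ifPn => // xU; rewrite gerBl exprn_ge0//; lra.
- move=> x xU; set F := fun e => _.
  have gT y : g y <= T.
    by rewrite /g; case: ifPn => // yU; rewrite gerBl exprn_ge0//; lra.
  have FT e : F e <= T by rewrite /F; case: ifP.
  have Fe0 : F e0 <= T - b ^+ (n x).+1.
    rewrite /F; case: ifPn => xeU; last by rewrite subr_ge0 bT.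
    by rewrite /g xeU lerB// ler_weXn2l// nD.
  have pb : p e0 * b ^+ (n x).+1 = 2 * b ^+ n x.
    by rewrite exprS mulrA /b mulrCA divff ?mulr1// gt_eqF.
  apply: (le_trans (step_ge_term p_ge0 p_sum1 e0D (fun e _ => FT e))).
  rewrite /g xU -addrA lerD2l -opprD lerN2.
  apply: (@le_trans _ _ (p e0 * b ^+ (n x).+1)).
    by rewrite pb mulr_natl mulr2n lerD2l exprn_ege1.
  by rewrite ler_wpM2l// lerBrDr addrC -lerBrDr.
Qed.

(** With [g] from [exit_time] and the domain [U], a Lyapunov function that decreases by at least 1
    on average at each toppling in [U]. *)
Definition total_weight U (g : lattice d -> R) (c : lattice d -> nat) : R :=
  \sum_(x <- U) (c x)%:R * g x.

Lemma total_weight_topple U g x e c : uniq U -> x \in U -> (0 < c x)%N -> 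
  total_weight U g (topple U x e c) =
  total_weight U g c - g x + (if x + e \in U then g (x + e) else 0).
Proof.
move=> uU xU cx; have ind z : \sum_(y <- U) (y == z)%:R * g y = if z \in U then g z else 0.
  case: ifPn => zU.
    rewrite (bigD1_seq z)//= eqxx mul1r big1 ?addr0// => y /negbTE ->.
    by rewrite mul0r.
  by rewrite big1_seq// => y /andP[_ yU]; case: eqP zU => [<-|]; rewrite ?yU ?mul0r.
have := ind x; have := ind (x + e); rewrite xU => <- <-.
rewrite /total_weight -sumrB -big_split/= big_seq [RHS]big_seq.
apply: eq_bigr => y yU; rewrite /topple yU andbT natrD natrB; last first.
  by case: eqVneq => [->|].
by rewrite mulrDl mulrBl.
Qed.

Variable lambda : \bar R.
Hypothesis lambda_gt0 : (0 < lambda)%E.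
Variable o : lattice d.
Variables (n : nat) (delta err : R).
Hypothesis delta_gt0 : 0 < delta.
Hypothesis delta_small : delta * (rate_bound lambda * n%:R) <= 1.
Hypothesis err_ge0 : 0 <= err.

Local Notation generator := (generator p lambda).
Local Notation drift := (drift D p lambda).
Local Notation jump_rate := (jump_rate lambda).
Local Notation sleep_rate := (sleep_rate lambda).
Local Notation jumped := (jumped lambda).

(** The total rate times [delta] is at most 1, so an Euler step is a convex combination of [f xi]
    and the mean values after one move; each jump at [x] gains [a x]. *)
Lemma drift_le s (f : config d -> R) xi Y (a : lattice d -> R) :
  supports s xi -> (\sum_(x <- s) particles xi x <= n)%N ->
  f xi <= Y ->
  (forall x, x \in s -> f (sleep_at x xi) <= Y) ->
  (forall x, x \in s -> 0 < jump_rate xi x ->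
     step (fun e => f (jumped xi x (x + e))) <= Y - a x) ->
  f xi + delta * drift s f xi <= Y - delta * \sum_(x <- s) jump_rate xi x * a x.
Proof.
move=> [us sE] sn fY sY jY.
pose r := \sum_(x <- s) (sleep_rate xi x + jump_rate xi x).
have r1 : delta * r <= 1.
  apply: le_trans delta_small; rewrite ler_pM2l//.
  apply: (@le_trans _ _ (\sum_(x <- s) rate_bound lambda * (particles xi x)%:R)).
    by apply: ler_sum => x _; exact: rates_le.
  rewrite -mulr_sumr ler_wpM2l ?rate_bound_ge0//.
  by rewrite -natr_sum ler_nat.
have : drift s f xi <= \sum_(x <- s) ((sleep_rate xi x + jump_rate xi x) * (Y - f xi) -
    jump_rate xi x * a x).
  rewrite /drift big_seq [leRHS]big_seq; apply: ler_sum => x xs.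
  have h1 : sleep_rate xi x * (f (sleep_at x xi) - f xi) <=
      sleep_rate xi x * (Y - f xi).
    by rewrite ler_wpM2l ?sleep_rate_ge0// lerB// sY.
  have h2 : jump_rate xi x * (step (fun e => f (jumped xi x (x + e))) - f xi) <=
      jump_rate xi x * (Y - a x - f xi).
    have := jump_rate_ge0 lambda xi x; rewrite le_eqVlt => /predU1P[<-|j0].
      by rewrite !mul0r.
    by rewrite ler_pM2l// lerB// jY.
  by lra.
rewrite sumrB -mulr_suml -/r => /(ler_wpM2l (ltW delta_gt0)).
have : 0 <= (1 - delta * r) * (Y - f xi) by rewrite mulr_ge0 ?subr_ge0.
by lra.
Qed.

Variable N : nat.

(* An upper bound for the probability that the origin of time [xi] leads to
   no active particle at [o] at the last N + 1 of k + 1 times with mesh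
   [delta], where [err] dominates the error made by using the generator. *)
Fixpoint inactivity (k : nat) xi : R :=
  if k is m.+1 then
    Num.min 1 (((m < N)%N ==> (num_active (xi o) == 0%N))%:R *
      (inactivity m xi + delta * generator (inactivity m) xi + err))
  else (num_active (xi o) == 0%N)%:R.

Lemma inactivity_le1 k xi : inactivity k xi <= 1.
Proof. by case: k => [|k] /=; [rewrite lern1 leq_b1|rewrite ge_min lexx]. Qed.

Let e_neq x e : e \in D -> x + e != x.
Proof.
by move=> eD; rewrite -subr_eq0 addrAC subrr add0r; apply: contra D_neq0 => /eqP <-.
Qed.

Lemma inactivity_ge0 k xi : at_most n xi -> 0 <= inactivity k xi.
Proof.
elim: k xi => [|k IH] xi nxi /=; first by rewrite ler0n.
rewrite le_min ler01/= mulr_ge0// addr_ge0//.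
have [s sxi sn] := nxi; rewrite (generatorE D_uniq p_supp lambda_gt0 _ sxi).
(* The comparison is applied to the opposite function: the Euler step is a mean of nonnegative
   values. *)
have := @drift_le s (fun xi => - inactivity k xi) xi 0 (fun=> 0) sxi sn.
rewrite oppr_le0 IH// => /(_ isT).
have -> : drift s (fun xi => - inactivity k xi) xi = - drift s (inactivity k) xi.
  rewrite /drift -sumrN; apply: eq_bigr => x _.
  rewrite (_ : step (fun e => - inactivity k (jumped xi x (x + e))) =
    -1 * step (fun e => inactivity k (jumped xi x (x + e)))).
    by ring.
  by rewrite -stepZ; apply: eq_step => // e _; rewrite mulN1r.
under eq_bigr do rewrite mulr0.
rewrite big1// mulr0 subr0 => h.
have {h} : - inactivity k xi + delta * - drift s (inactivity k) xi <= 0.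
  apply: h => x xs; first by rewrite oppr_le0 IH//; exact: at_most_sleep.
  move=> /jump_rate_gt0 nx; rewrite ?subr0; apply: step_ub => // e eD.
  by rewrite oppr_le0 IH//; apply: at_most_jumped => //; exact: e_neq.
by lra.
Qed.

Variables (U : seq (lattice d)) (n0 : nat) (g : lattice d -> R) (M : R).
Hypothesis U_uniq : uniq U.
Hypotheses (g_ge0 : forall x, 0 <= g x) (g_le : forall x, g x <= M).
Hypothesis g_exit : forall x, x \in U ->
  step (fun e => if x + e \in U then g (x + e) else 0) <= g x - 1.

Local Notation w := (stab D p (halving R o) U (fun=> 1)).
Local Notation W := (total_weight U g).
Implicit Types zeta : lattice d -> nat.

(** [zeta] is the part of [xi] whose stabilization in [U] is followed; it never gains particles from
    the rest. The bound [n0] controls its weight independently of the volume. *)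
Definition below zeta xi :=
  {in U, forall x, (zeta x <= particles xi x)%N} /\ (\sum_(x <- U) zeta x <= n0)%N.

Lemma below_sleep zeta xi x : below zeta xi -> below zeta (sleep_at x xi).
Proof. by rewrite /below particles_sleep. Qed.

Lemma below_stay zeta xi x e : below zeta xi -> e \in D -> (0 < num_active (xi x))%N ->
  (x \in U -> zeta x < particles xi x)%N -> below zeta (jumped xi x (x + e)).
Proof.
move=> [zxi zn] eD nx zx; split=> // y yU.
rewrite particles_jumped ?e_neq//; have [yx|yx] := eqVneq y x.
  rewrite yx subn1 (leq_trans _ (leq_addr _ _))// -ltnS prednK.
    by rewrite zx// -yx.
  by rewrite (leq_trans nx)// num_active_le.
by rewrite subn0 (leq_trans (zxi _ yU))// leq_addr.
Qed.

Lemma below_topple zeta xi x e : below zeta xi -> e \in D -> (0 < num_active (xi x))%N ->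
  x \in U -> (0 < zeta x)%N -> below (topple U x e zeta) (jumped xi x (x + e)).
Proof.
move=> [zxi zn] eD nx xU zx; split=> [y yU|].
  rewrite particles_jumped ?e_neq// /topple yU andbT leq_add2r.
  by rewrite leq_sub2r// zxi.
apply: leq_trans zn; rewrite -(ler_nat R) !natr_sum.
have tw c : total_weight U (fun=> 1) c = \sum_(y <- U) (c y)%:R.
  by apply: eq_bigr => y _; rewrite mulr1.
have := total_weight_topple (fun=> 1) e U_uniq xU zx; rewrite !tw => ->.
by case: ifP => _; lra.
Qed.

Let cst1_nb : nonneg_bounded (fun _ : lattice d -> nat => 1 : R).
Proof. exact: nonneg_bounded_cst. Qed.

Let w_topple zeta x : x \in U -> (0 < zeta x)%N ->
  halving R o x * step (fun e => w (topple U x e zeta)) <= w zeta.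
Proof. by move=> xU zx; apply: stab_illegal => //; exact: halving01. Qed.

Let W_topple zeta x : x \in U -> (0 < zeta x)%N ->
  step (fun e => W (topple U x e zeta)) <= W zeta - 1.
Proof.
move=> xU zx.
rewrite (@eq_step _ _ _ _ p_ge0 _ (fun e => (W zeta - g x) +
    (if x + e \in U then g (x + e) else 0))); last first.
  by move=> e _; rewrite total_weight_topple.
by rewrite stepD step_cst//; have := g_exit xU; lra.
Qed.

Let W_ge0 zeta : 0 <= W zeta.
Proof. by apply: sumr_ge0 => x _; rewrite mulr_ge0. Qed.

(** The summand 1 keeps this bound on the weight positive. *)
Let Wmax := M * n0%:R + 1.

Lemma total_weight_le zeta xi : below zeta xi -> W zeta <= Wmax.
Proof.
move=> [_ zn]; have M0 : 0 <= M by exact: le_trans (g_ge0 0) (g_le 0).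
rewrite /Wmax (@le_trans _ _ (M * n0%:R))//; last by lra.
rewrite (@le_trans _ _ (\sum_(x <- U) (zeta x)%:R * M))//.
  by apply: ler_sum => x _; rewrite ler_wpM2l.
by rewrite -mulr_suml mulrC ler_wpM2l// -natr_sum ler_nat.
Qed.

(** An unstable [zeta] loses weight at rate at least 1, hence at least a fraction [delta / Wmax] of
    its weight per step. *)
Let rho := 1 - delta / Wmax.
Hypothesis rho_ge0 : 0 <= rho.

(* While [o] is inactive, the sub-configuration [zeta] is stabilized at
   rate at least 1, and it cannot be stable without [o] having been visited,
   up to the probability [w zeta]. *)
Lemma inactivity_le k zeta xi : (k <= N)%N -> at_most n xi -> below zeta xi ->
  inactivity k xi <= w zeta + rho ^+ k * W zeta + k%:R * err.
Proof.
have w0 c : 0 <= w c by exact: visits_ge0.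
elim: k zeta xi => [|k IH] zeta xi kN nxi bz.
  (* A stable [zeta] has [w zeta = 1] and an unstable one has weight at least 1, so the trivial
     bound suffices at the last time. *)
  have [sz|uz] := boolP (stable U zeta).
    rewrite stab_stable// (le_trans (inactivity_le1 _ _))// -addrA lerDl addr_ge0 ?mulr_ge0//.
  rewrite (le_trans (inactivity_le1 _ _))// mul0r addr0 mul1r.
  have [x xU zx] := unstable_ex uz.
  have : 1 <= W zeta.
    have := W_topple xU (ltnW zx).
    have : 0 <= step (fun e => W (topple U x e zeta)) by exact: step_ge0.
    by lra.
  by have := w0 zeta; lra.
have [sz|uz] := boolP (stable U zeta).
  by rewrite stab_stable// (le_trans (inactivity_le1 _ _))// -addrA lerDl addr_ge0 ?mulr_ge0 ?exprn_ge0.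
rewrite [inactivity _ _]/= kN /=; have [no|no] := eqVneq (num_active (xi o)) 0%N; last first.
  by rewrite mul0r ge_min !addr_ge0 ?mulr_ge0 ?exprn_ge0// orbT.
rewrite mul1r ge_min; apply/orP; right.
have [s sxi sn] := nxi; rewrite (generatorE D_uniq p_supp lambda_gt0 _ sxi).
set Y := w zeta + rho ^+ k * W zeta + k%:R * err.
pose a x := if (x \in U) && (1 < zeta x)%N then rho ^+ k else 0.
have kN' := ltnW kN; have rk0 : 0 <= rho ^+ k by exact: exprn_ge0.
(* No active particle sits at [o], so every jump is undiscounted. *)
have jo x : 0 < jump_rate xi x -> halving R o x = 1.
  move=> /jump_rate_gt0; rewrite /halving; case: eqP => // ->.
  by rewrite no.
have topple_le x : x \in U -> (0 < zeta x)%N -> 0 < jump_rate xi x ->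
    step (fun e => inactivity k (jumped xi x (x + e))) <= Y - rho ^+ k.
  move=> xU zx j0; have nx := jump_rate_gt0 j0.
  apply: (@le_trans _ _ (step (fun e => w (topple U x e zeta) +
      rho ^+ k * W (topple U x e zeta) + k%:R * err))).
    apply: step_le => // e eD; apply: IH => //.
      by apply: at_most_jumped => //; exact: e_neq.
    exact: below_topple.
  rewrite !stepD (stepZ _ _ (rho ^+ k)) step_cst//.
  have := w_topple xU zx; rewrite jo// mul1r.
  have := ler_wpM2l rk0 (W_topple xU zx); rewrite /Y.
  by lra.
have := @drift_le s (inactivity k) xi Y a sxi sn (IH _ _ kN' nxi bz).
move=> /(_ (fun x _ => IH _ _ kN' (at_most_sleep x nxi) (below_sleep x bz))).
(* A jump at [x] topples [zeta] when it has two particles there, with a gain, or when it owns all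
   the particles of [x]; the latter toppling may be illegal but does not raise the bound. Otherwise
   the jump is that of a particle outside [zeta]. *)
have jY x : x \in s -> 0 < jump_rate xi x ->
    step (fun e => inactivity k (jumped xi x (x + e))) <= Y - a x.
  move=> xs j0; have nx := jump_rate_gt0 j0.
  rewrite /a; case: ifPn => [/andP[xU zx]|]; first by apply: topple_le => //; exact: ltnW.
  rewrite negb_and subr0 => zx.
  have [/andP[xU zxi]|zxi] := boolP ((x \in U) && (zeta x == particles xi x)).
    rewrite (le_trans (topple_le _ xU _ j0))//; last by rewrite gerBl.
    by rewrite (eqP zxi) (leq_trans nx)// num_active_le.
  apply: step_ub => // e eD; apply: IH => //.
    by apply: at_most_jumped => //; exact: e_neq.
  apply: below_stay => // xU; rewrite xU/= in zxi.
  by rewrite ltn_neqAle zxi bz.1.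
move=> /(_ jY) main.
have [x xU zx] := unstable_ex uz.
have px : (1 < particles xi x)%N by rewrite (leq_trans zx)// bz.1.
have xs : x \in s by rewrite sxi.2 -lt0n ltnW.
have : rho ^+ k <= \sum_(x <- s) jump_rate xi x * a x.
  rewrite (bigD1_seq x) ?sxi.1//= {1}/a xU zx/=.
  rewrite -[leLHS]addr0 lerD//; first by rewrite ler_peMl// jump_rate_ge1.
  apply: sumr_ge0 => y _; rewrite mulr_ge0 ?jump_rate_ge0// /a.
  by case: ifP.
move=> /(ler_wpM2l (ltW delta_gt0)) ra.
have Wm0 : 0 < Wmax.
  by rewrite /Wmax ltr_wpDl// mulr_ge0// (le_trans (g_ge0 0) (g_le 0)).
have : rho ^+ k * (delta / Wmax * W zeta) <= rho ^+ k * delta.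
  rewrite ler_wpM2l// mulrAC ler_pdivrMr// ler_pM2l//.
  exact: total_weight_le bz.
have rhoE : rho = 1 - delta / Wmax by [].
have -> : rho ^+ k.+1 * W zeta =
    rho ^+ k * W zeta - rho ^+ k * (delta / Wmax * W zeta).
  by rewrite exprSr [X in _ * X * _]rhoE; ring.
have -> : k.+1%:R * err = k%:R * err + err by rewrite -natr1 mulrDl mul1r.
rewrite /Y in main.
by lra.
Qed.

(* [visit_bound k x] bounds the expected number of visits to [o] of one
   particle started from [x] over k steps. *)
Fixpoint visit_bound (k : nat) x : R :=
  if k is l.+1 then
    visit_bound l x + delta * (step (fun e => visit_bound l (x + e)) + (x == o)%:R)
  else 0.

Lemma visit_bound_ge0 k x : 0 <= visit_bound k x.
Proof.
elim: k x => //= k IH x; apply: addr_ge0 => //; apply: mulr_ge0; first exact: ltW.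
by apply: addr_ge0 => //; exact: step_ge0.
Qed.

(** The mass plus 1 is multiplied by [1 + delta] at each step, because the departure of the jumping
    particle is not subtracted in [visit_bound]. *)
Lemma mass_le_visit_bound k : mass_le (visit_bound k) ((1 + delta) ^+ k - 1).
Proof.
elim: k => [|k IH]; first by move=> s _; rewrite big1// expr0 subrr.
have -> : (1 + delta) ^+ k.+1 - 1 =
    ((1 + delta) ^+ k - 1) + delta * (((1 + delta) ^+ k - 1) + 1).
  by rewrite exprS; ring.
apply: mass_leD => //; apply: mass_leZ; first exact: ltW.
by apply: mass_leD; [exact: mass_le_step|exact: mass_le_pred1].
Qed.

Definition expected_visits k xi : R :=
  \sum_(x \in [set: lattice d]) (particles xi x)%:R * visit_bound k x.

Lemma expected_visitsE k xi s : uniq s ->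
  (forall x, particles xi x != 0%N -> x \in s) ->
  expected_visits k xi = total_weight s (visit_bound k) (particles xi).
Proof.
move=> us sxi; rewrite /expected_visits (@fsbigE _ _ _ _ _ s)//.
  by rewrite big_mkcond; apply: eq_bigr => x _; rewrite in_setT.
by move=> x _; apply: contraNeq; rewrite mulf_eq0 pnatr_eq0 negb_or => /andP[+ _]; exact: sxi.
Qed.

Lemma expected_visits_jumped k xi x e : at_most n xi -> e \in D ->
  (0 < num_active (xi x))%N ->
  expected_visits k (jumped xi x (x + e)) <=
  expected_visits k xi + visit_bound k (x + e).
Proof.
move=> [s [us sE] _] eD nx.
have px : (0 < particles xi x)%N by rewrite (leq_trans nx)// num_active_le.
pose s' := undup (x + e :: s).
have us' : uniq s' by exact: undup_uniq.
have ss' z : particles xi z != 0%N -> z \in s'.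
  by rewrite -sE => zs; rewrite mem_undup inE zs orbT.
have xs' : x \in s' by rewrite ss'// -lt0n.
have xes' : x + e \in s' by rewrite mem_undup inE eqxx.
have PE := particles_jumped lambda nx (e_neq x eD).
rewrite (expected_visitsE k us' ss') (@expected_visitsE k _ s' us'); last first.
  move=> z; rewrite PE; have [->//|zx] := eqVneq z (x + e).
  by rewrite addn0 => pz; apply: ss'; apply: contra pz => /eqP ->.
have -> : total_weight s' (visit_bound k) (particles (jumped xi x (x + e))) =
    total_weight s' (visit_bound k) (topple s' x e (particles xi)).
  rewrite /total_weight big_seq [RHS]big_seq; apply: eq_bigr => z zs'.
  by rewrite PE /topple zs' andbT.
rewrite total_weight_topple// xes' -addrA lerD2l gerDr oppr_le0.
exact: visit_bound_ge0.
Qed.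

Variable m : nat.
Hypothesis m_gt0 : (0 < m)%N.

(* [j] is the number of visits to [o] still granted; exhausting the [m]
   initial ones has a probability that is controlled by Markov's inequality. *)
Lemma inactivity_late_le k j zeta xi : (j <= m)%N -> at_most n xi -> below zeta xi ->
  inactivity (N + k) xi <= 2 ^+ j * w zeta + rho ^+ N * Wmax +
    m%:R^-1 * ((m - j)%:R + expected_visits k xi) + (N + k)%:R * err.
Proof.
have w0 c : 0 <= w c by exact: visits_ge0.
have mi0 : 0 <= m%:R^-1 :> R by rewrite invr_ge0.
have Wm0 : 0 <= Wmax.
  by rewrite /Wmax addr_ge0// mulr_ge0// (le_trans (g_ge0 0) (g_le 0)).
have A0 : 0 <= rho ^+ N * Wmax by rewrite mulr_ge0// exprn_ge0.
have ev0 l xi' : 0 <= expected_visits l xi'.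
  by apply: fsumr_ge0 => x _; rewrite mulr_ge0// visit_bound_ge0.
elim: k j zeta xi => [|k IH] j zeta xi jm nxi bz.
  rewrite addn0 (le_trans (inactivity_le (leqnn _) nxi bz))// lerD2r.
  have h1 : w zeta <= 2 ^+ j * w zeta by rewrite ler_peMl// exprn_ege1// ler1n.
  have h2 : rho ^+ N * W zeta <= rho ^+ N * Wmax.
    by rewrite ler_wpM2l ?exprn_ge0// (total_weight_le bz).
  have h3 : 0 <= m%:R^-1 * ((m - j)%:R + expected_visits 0 xi).
    by rewrite mulr_ge0// addr_ge0.
  by lra.
(* With no visit left, the Markov term alone is at least 1. *)
case: j jm => [|j] jm.
  rewrite (le_trans (inactivity_le1 _ _))// subn0 (mulrDr m%:R^-1) mulVf; last first.
    by rewrite pnatr_eq0 -lt0n.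
  have h3 : 0 <= m%:R^-1 * expected_visits k.+1 xi by rewrite mulr_ge0.
  have h4 : 0 <= (N + k.+1)%:R * err by rewrite mulr_ge0.
  by have := w0 zeta; rewrite expr0; lra.
rewrite addnS [inactivity _ _]/= ltnNge leq_addr /= mul1r ge_min; apply/orP; right.
have [s sxi sn] := nxi; rewrite (generatorE D_uniq p_supp lambda_gt0 _ sxi).
set G := inactivity (N + k) in IH *.
pose Y := 2 ^+ j.+1 * w zeta + rho ^+ N * Wmax +
  m%:R^-1 * ((m - j.+1)%:R + expected_visits k xi) + (N + k)%:R * err.
pose b x := step (fun e => visit_bound k (x + e)) + (x == o)%:R.
pose a x := - (m%:R^-1 * b x).
have jY x : x \in s -> 0 < jump_rate xi x ->
    step (fun e => G (jumped xi x (x + e))) <= Y - a x.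
  move=> xs j0; have nx := jump_rate_gt0 j0.
  have natx e : e \in D -> at_most n (jumped xi x (x + e)).
    by move=> eD; apply: at_most_jumped => //; exact: e_neq.
  have evx e : e \in D -> m%:R^-1 * expected_visits k (jumped xi x (x + e)) <=
      m%:R^-1 * (expected_visits k xi + visit_bound k (x + e)).
    by move=> eD; rewrite ler_wpM2l// expected_visits_jumped.
  rewrite /a opprK /b /Y.
  (* The jump is charged to a particle outside [zeta] whenever [x] has one; only otherwise is [zeta]
     toppled. *)
  have [/andP[xU /eqP zxi]|zxi] := boolP ((x \in U) && (zeta x == particles xi x)); last first.
    apply: (@le_trans _ _ (step (fun e => Y + m%:R^-1 * visit_bound k (x + e)))).
      apply: step_le => // e eD.
      have bz' : below zeta (jumped xi x (x + e)).
        apply: below_stay => // xU; rewrite xU/= in zxi.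
        by rewrite ltn_neqAle zxi bz.1.
      by have := IH _ _ _ jm (natx _ eD) bz'; have := evx e eD; rewrite /Y; lra.
    rewrite stepD step_cst// (stepZ _ _ m%:R^-1) -/Y lerD2l ler_wpM2l//.
    by rewrite lerDl.
  have zx : (0 < zeta x)%N by rewrite zxi (leq_trans nx)// num_active_le.
  have bz' e : e \in D -> below (topple U x e zeta) (jumped xi x (x + e)).
    by move=> eD; exact: below_topple.
  have := w_topple xU zx; have [xo|xo] := eqVneq x o.
    (* The discount turns [2 ^+ j.+1] into [2 ^+ j] and uses up one granted visit; the increase of
       [m - j] by 1 is paid by the indicator of [o] in [b]. *)
    have -> : halving R o x = 1 / 2 by rewrite /halving xo eqxx.
    move=> wx.
    have {wx} : 2 ^+ j * step (fun e => w (topple U x e zeta)) <= 2 ^+ j.+1 * w zeta.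
      by rewrite exprSr -mulrA ler_wpM2l ?exprn_ge0//; lra.
    rewrite -stepZ => wx.
    pose C := rho ^+ N * Wmax +
      m%:R^-1 * ((m - j)%:R + expected_visits k xi) + (N + k)%:R * err.
    apply: (@le_trans _ _ (step (fun e => 2 ^+ j * w (topple U x e zeta) +
        m%:R^-1 * visit_bound k (x + e) + C))).
      apply: step_le => // e eD; rewrite /C.
      by have := IH j _ _ (ltnW jm) (natx _ eD) (bz' _ eD); have := evx e eD; lra.
    rewrite 2!stepD step_cst// (stepZ _ _ m%:R^-1) /C.
    have -> : (m - j)%:R = (m - j.+1)%:R + 1 :> R by rewrite natr1 subnSK.
    by rewrite mulr1n; lra.
  have -> : halving R o x = 1 by rewrite /halving (negbTE xo).
  rewrite mul1r => /(ler_wpM2l (exprn_ge0 j.+1 (ler0n R 2))).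
  rewrite -stepZ => wx.
  pose C := rho ^+ N * Wmax +
    m%:R^-1 * ((m - j.+1)%:R + expected_visits k xi) + (N + k)%:R * err.
  apply: (@le_trans _ _ (step (fun e => 2 ^+ j.+1 * w (topple U x e zeta) +
      m%:R^-1 * visit_bound k (x + e) + C))).
    apply: step_le => // e eD; rewrite /C.
    by have := IH j.+1 _ _ jm (natx _ eD) (bz' _ eD); have := evx e eD; lra.
  rewrite 2!stepD step_cst// (stepZ _ _ m%:R^-1) /C.
  by rewrite mulr0n; lra.
have sY x : x \in s -> G (sleep_at x xi) <= Y.
  move=> _; have := IH _ _ _ jm (at_most_sleep x nxi) (below_sleep x bz).
  by rewrite /expected_visits particles_sleep.
have main := @drift_le s G xi Y a sxi sn (IH _ _ _ jm nxi bz) sY jY.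
have sum_le : - (\sum_(x <- s) jump_rate xi x * a x) <=
    m%:R^-1 * \sum_(x <- s) (particles xi x)%:R * b x.
  rewrite -sumrN mulr_sumr; apply: ler_sum => x _.
  rewrite /a mulrN opprK mulrCA ler_wpM2l// ler_wpM2r ?jump_rate_le//.
  by rewrite /b addr_ge0// step_ge0// => e _; exact: visit_bound_ge0.
have evS : expected_visits k.+1 xi =
    expected_visits k xi + delta * \sum_(x <- s) (particles xi x)%:R * b x.
  have sP z : particles xi z != 0%N -> z \in s by rewrite sxi.2.
  rewrite !(expected_visitsE _ sxi.1 sP) mulr_sumr -big_split/=.
  by apply: eq_bigr => x _; rewrite /= /b; ring.
have := ler_wpM2l (ltW delta_gt0) sum_le.
rewrite evS -natr1 /Y in main *.
by move: main; set S1 := \sum_(x <- s) _; set S2 := \sum_(x <- s) _; lra.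
Qed.

End Comparison.

(** * Events and transitions over short times *)

Section EventUpto.
Variables (R : realType) (d : nat).
Implicit Types (B : set (lattice d)) (s t : R) (A E F : set (trajectory R d)).

Lemma event_uptoS B B' s t : B `<=` B' -> s <= t ->
  @event_upto R d B s `<=` @event_upto R d B' t.
Proof.
move=> BB' st; apply: sub_sigma_algebra2 => A [u [x [a [us Bx ->]]]].
exists u, x, a; split=> //; last exact: BB'.
by move: us; rewrite /= !in_itv/= => /andP[-> us]; rewrite (le_trans us).
Qed.

Lemma measurable_event_upto B t A : event_upto B t A -> measurable A.
Proof.
apply: sub_sigma_algebra2 => E [u [x [a [ut Bx ->]]]].
exists u, x, a; split=> //.
by move: ut; rewrite /= in_itv/= => /andP[].
Qed.

Lemma event_uptoI B t A E : event_upto B t A -> event_upto B t E ->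
  event_upto B t (A `&` E).
Proof. exact: (@measurableI _ (g_sigma_algebraType (trajectory_cylinders `[0, t] B))). Qed.

Lemma event_uptoU B t A E : event_upto B t A -> event_upto B t E ->
  event_upto B t (A `|` E).
Proof. exact: (@measurableU _ (g_sigma_algebraType (trajectory_cylinders `[0, t] B))). Qed.

Lemma event_uptoT B t : @event_upto R d B t setT.
Proof. exact: (@measurableT _ (g_sigma_algebraType (trajectory_cylinders `[0, t] B))). Qed.

Lemma event_upto_bigcap B t (A : nat -> set (trajectory R d)) :
  (forall n, event_upto B t (A n)) -> event_upto B t (\bigcap_n A n).
Proof. exact: (@bigcapT_measurable _ (g_sigma_algebraType (trajectory_cylinders `[0, t] B))). Qed.

Lemma event_upto_site B s t x a : 0 <= s <= t -> B x ->
  event_upto B t [set w : trajectory R d | w s x = a].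
Proof.
by move=> st Bx; apply: sub_sigma_algebra; exists s, x, a; split.
Qed.

Definition inactive_at o s : set (trajectory R d) :=
  [set w | num_active (w s o) = 0%N].

Lemma event_upto_inactive B o s t : 0 <= s <= t -> B o ->
  event_upto B t (inactive_at o s).
Proof.
move=> st Bo; have -> : inactive_at o s =
    [set w | w s o = Active 0] `|` [set w | w s o = Sleeping].
  apply/seteqP; split=> w; rewrite /inactive_at /=.
    by case: (w s o) => [[|n]|]//; [left|right].
  by case=> ->.
by apply: event_uptoU; exact: event_upto_site.
Qed.

Definition config_at s (xi : config d) : set (trajectory R d) := [set w | w s = xi].

Lemma event_upto_config s t xi : 0 <= s <= t ->
  event_upto setT t (config_at s xi).
Proof.
move=> st; have -> : config_at s xi = \bigcap_n
    (if @choice.unpickle (lattice d) n is Some x then [set w | w s x = xi x] else setT).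
  apply/seteqP; split=> w.
    by move=> wxi n _; case: choice.unpickle => //= x; rewrite wxi.
  by move=> wxi; apply/funext => x; have := wxi (choice.pickle x) I; rewrite choice.pickleK.
apply: event_upto_bigcap => n; case: choice.unpickle => [x|]; last exact: event_uptoT.
exact: event_upto_site.
Qed.

End EventUpto.

(** * First-order expansion of the transition function *)

Section Markov.
Variables (R : realType) (d : nat).
Variables (D : seq (lattice d)) (p : lattice d -> R).
Hypothesis p_ge0 : forall e, 0 <= p e.
Hypothesis p_sum1 : \sum_(e <- D) p e = 1.
Hypothesis D_uniq : uniq D.
Hypothesis D_neq0 : 0 \notin D.
Hypothesis p_supp : forall z, z \notin D -> p z = 0.
Variable lambda : \bar R.
Hypothesis lambda_gt0 : (0 < lambda)%E.
Variable n : nat.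
Implicit Types (xi eta : config d) (x y z : lattice d) (s : seq (lattice d)).

Local Notation step := (step D p).
Local Notation L := (generator p lambda).
Local Notation drift := (drift D p lambda).
Let r := 2 * (rate_bound lambda * n%:R).

Let r_ge0 : 0 <= r.
Proof. by rewrite /r mulr_ge0// mulr_ge0// rate_bound_ge0. Qed.

Let e_neq x e : e \in D -> x + e != x.
Proof.
by move=> eD; rewrite -subr_eq0 addrAC subrr add0r; apply: contra D_neq0 => /eqP <-.
Qed.

Lemma generator_bounded f xi (M : R) : 0 <= M ->
  (forall eta, at_most n eta -> `|f eta| <= M) -> at_most n xi ->
  `|L f xi| <= r * M.
Proof.
move=> M0 fM nxi; have [s sxi sn] := nxi; rewrite (generatorE D_uniq p_supp lambda_gt0 _ sxi).
rewrite /drift (le_trans (ler_norm_sum _ _ _))//.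
apply: (@le_trans _ _ (\sum_(x <- s) 2 * M * (rate_bound lambda * (particles xi x)%:R))).
  apply: ler_sum => x _.
  have fb a b : `|a| <= M -> `|b| <= M -> `|a - b| <= 2 * M.
    by move=> aM bM; rewrite (le_trans (ler_normB _ _))//; lra.
  apply: (@le_trans _ _ (2 * M * (sleep_rate lambda xi x + jump_rate lambda xi x))).
    rewrite (le_trans (ler_normD _ _))// [leRHS]mulrDr; apply: lerD.
      rewrite normrM ger0_norm ?sleep_rate_ge0// mulrC ler_wpM2r ?sleep_rate_ge0//.
      by apply: fb; apply: fM => //; exact: at_most_sleep.
    have := jump_rate_ge0 lambda xi x; rewrite le_eqVlt => /predU1P[<-|j0].
      by rewrite mul0r mulr0 normr0.
    rewrite normrM ger0_norm ?jump_rate_ge0// mulrC ler_wpM2r ?jump_rate_ge0//.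
    have fj e : e \in D -> `|f (jumped lambda xi x (x + e))| <= M.
      move=> eD; apply: fM; apply: at_most_jumped => //; last exact: e_neq.
      exact: jump_rate_gt0 j0.
    apply: fb; last exact: fM.
    rewrite ler_norml; apply/andP; split.
      by apply: step_lb => // e /fj; rewrite ler_norml => /andP[].
    by apply: step_ub => // e /fj; rewrite ler_norml => /andP[].
  by rewrite ler_wpM2l ?rates_le// mulr_ge0.
rewrite -mulr_sumr -mulr_sumr /r mulrAC ler_wpM2r// ler_wpM2l// ler_wpM2l ?rate_bound_ge0//.
by rewrite -natr_sum ler_nat.
Qed.

Definition ind eta : config d -> R := \1_[set eta].

Lemma indE eta xi : ind eta xi = (xi == eta)%:R.
Proof.
by rewrite /ind indicE; congr (nat_of_bool _)%:R.
Qed.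

Lemma iter_generator_bounded k eta xi : at_most n xi ->
  `|iter k L (ind eta) xi| <= r ^+ k.
Proof.
elim: k xi => [|k IH] xi nxi.
  by rewrite /= indE ger0_norm// lern1 leq_b1.
by rewrite exprS [iter _ _ _]/=; apply: generator_bounded => //; exact: exprn_ge0.
Qed.

Let tterm (t : R) eta xi k := t ^+ k / k`!%:R * iter k L (ind eta) xi.

Lemma tterm_le t eta xi k : 0 <= t -> at_most n xi ->
  `|tterm t eta xi k| <= exp_coeff (t * r) k.
Proof.
move=> t0 nxi; rewrite /tterm /exp_coeff /= normrM ger0_norm; last first.
  by rewrite divr_ge0// exprn_ge0.
rewrite exprMn [leRHS]mulrAC ler_wpM2l//; last exact: iter_generator_bounded.
by rewrite divr_ge0// exprn_ge0.
Qed.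

(** On configurations with at most [n] particles the generator has norm at most [r], so the terms of
    order at least 2 are dominated by an exponential series. *)
Lemma transition_approx t eta xi : 0 <= t -> t * r <= 1 -> at_most n xi ->
  `|transition p lambda t xi eta - (ind eta xi + t * L (ind eta) xi)| <=
  (t * r) ^+ 2 * expR 1.
Proof.
move=> t0 tr1 nxi; set u := tterm t eta xi.
have tr0 : 0 <= t * r by rewrite mulr_ge0.
have u_cvg : cvgn (series u).
  apply: normed_cvg; apply: (@series_le_cvg _ _ (exp_coeff (t * r))).
  - by move=> k; exact: normr_ge0.
  - by move=> k; apply: exp_coeff_ge0.
  - by move=> k; exact: tterm_le.
  - exact: is_cvg_series_exp_coeff.
have tail N : `|series u N.+2 - (ind eta xi + t * L (ind eta) xi)| <=
    (t * r) ^+ 2 * expR 1.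
  have -> : series u N.+2 = ind eta xi + t * L (ind eta) xi + \sum_(0 <= k < N) u k.+2.
    rewrite /series /= big_nat_recl// big_nat_recl// addrA; congr (_ + _ + _).
      by rewrite /u /tterm expr0 fact0 divr1 mul1r.
    by rewrite /u /tterm expr1 divr1.
  rewrite addrAC subrr add0r (le_trans (ler_norm_sum _ _ _))//.
  apply: (@le_trans _ _ (\sum_(0 <= k < N) (t * r) ^+ 2 * exp_coeff 1 k)).
    apply: ler_sum => k _; rewrite (le_trans (tterm_le _ _ _ _))//.
    rewrite /exp_coeff /= expr1n mul1r -addn2 exprD [X in X * _]mulrC -mulrA.
    rewrite ler_wpM2l ?sqr_ge0// -[leRHS]mul1r ler_pM ?exprn_ge0 ?invr_ge0//.
      by rewrite exprn_ile1.
    by rewrite lef_pV2 ?posrE ?ltr0n ?fact_gt0// ler_nat leq_fact// leq_addr.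
  rewrite -mulr_sumr ler_wpM2l ?sqr_ge0//.
  apply: (@nondecreasing_cvgn_le _ (series (exp_coeff (1 : R)))).
    by apply: nondecreasing_series => k _ _; exact: exp_coeff_ge0.
  exact: is_cvg_series_exp_coeff.
have lim_u : `|series u N - (ind eta xi + t * L (ind eta) xi)| @[N --> \oo] -->
    `|transition p lambda t xi eta - (ind eta xi + t * L (ind eta) xi)|.
  by apply: cvg_norm; apply: cvgB; [exact: u_cvg|exact: cvg_cst].
rewrite -(cvg_lim _ lim_u)//; apply: limr_le; first exact/cvgP/lim_u.
near=> N; have [M ->] : exists M, N = M.+2.
  by exists N.-2; rewrite -addn2 -subn2 subnK//; near: N; exact: nbhs_infty_ge.
exact: tail.
Unshelve. all: by end_near. Qed.

(** The configurations reachable by at most one move; the first-order expansion charges no other. *)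
Definition targets s xi : seq (config d) :=
  undup (xi :: flatten [seq sleep_at x xi :: [seq jumped lambda xi x (x + e) | e <- D]
    | x <- s & (0 < num_active (xi x))%N]).

Lemma size_targets s xi : supports s xi -> (\sum_(x <- s) particles xi x <= n)%N ->
  (size (targets s xi) <= 1 + n * (1 + size D))%N.
Proof.
move=> [us sE] sn; apply: (leq_trans (size_undup _)); rewrite /= add1n ltnS.
rewrite size_flatten /shape -map_comp sumnE big_map big_filter.
apply: (@leq_trans (\sum_(x <- s) particles xi x * (1 + size D))).
  rewrite big_seq_cond [leqRHS]big_seq big_mkcond [leqRHS]big_mkcond/=.
  apply: leq_sum => x _; case: (boolP (x \in s)) => //= xs; case: ifP => // _.
  have px : (0 < particles xi x)%N by rewrite lt0n -sE.
  by rewrite size_map -add1n leq_pmull.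
by rewrite -big_distrl/= leq_mul2r sn orbT.
Qed.

Lemma at_most_targets s xi eta : at_most n xi -> eta \in targets s xi -> at_most n eta.
Proof.
move=> nxi; rewrite mem_undup inE => /predU1P[->//|/flattenP[_ /mapP[x + ->]]].
rewrite mem_filter => /andP[nx xs]; rewrite inE => /predU1P[->|/mapP[e eD ->]].
  exact: at_most_sleep.
by apply: at_most_jumped => //; exact: e_neq.
Qed.

Lemma eq_drift s f g xi : {in targets s xi, f =1 g} -> drift s f xi = drift s g xi.
Proof.
move=> fg; rewrite /drift big_seq [RHS]big_seq; apply: eq_bigr => x xs.
have fgx : f xi = g xi by apply: fg; rewrite mem_undup inE eqxx.
have [n0|n0] := posnP (num_active (xi x)).
  have -> : sleep_rate lambda xi x = 0.
    by rewrite /sleep_rate; case: lambda => // l; rewrite n0 mulr0.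
  have -> : jump_rate lambda xi x = 0.
    by apply/le_anti; rewrite jump_rate_ge0 andbT leNgt; apply/negP => /jump_rate_gt0; rewrite n0.
  by rewrite !mul0r.
have in_t eta : eta \in sleep_at x xi :: [seq jumped lambda xi x (x + e) | e <- D] ->
    eta \in targets s xi.
  move=> h; rewrite mem_undup inE; apply/orP; right; apply/flattenP.
  by eexists; [apply/mapP; exists x; [rewrite mem_filter n0|reflexivity]|].
rewrite fgx fg; last by apply: in_t; rewrite inE eqxx.
congr (_ + _ * (_ - _)); apply: eq_step => // e eD; apply: fg; apply: in_t.
by rewrite inE; apply/orP; right; apply/mapP; exists e.
Qed.

Lemma drift_sum (I : Type) (t : seq I) (a : I -> R) (f : I -> config d -> R) s xi :
  drift s (fun eta => \sum_(i <- t) a i * f i eta) xi =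
  \sum_(i <- t) a i * drift s (f i) xi.
Proof.
rewrite /drift; under [RHS]eq_bigr do rewrite mulr_sumr.
rewrite [RHS]exchange_big/=; apply: eq_bigr => x _.
have -> : step (fun e => \sum_(i <- t) a i * f i (jumped lambda xi x (x + e))) =
    \sum_(i <- t) a i * step (fun e => f i (jumped lambda xi x (x + e))).
  by rewrite step_sum; apply: eq_bigr => i _; rewrite -stepZ.
by rewrite -!sumrB !mulr_sumr -big_split/=; apply: eq_bigr => i _; ring.
Qed.

Lemma sum_targets s f xi : \sum_(eta <- targets s xi) f eta * (ind eta xi) = f xi.
Proof.
rewrite (bigD1_seq xi)/= ?undup_uniq//; last by rewrite mem_undup inE eqxx.
rewrite indE eqxx mulr1 big1 ?addr0// => eta /negbTE ne.
by rewrite indE eq_sym ne mulr0.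
Qed.

(** The generator at [xi] sees [f] on the targets only, where [f] is a combination of their
    indicators. *)
Lemma sum_targets_generator s f xi : supports s xi ->
  \sum_(eta <- targets s xi) f eta * L (ind eta) xi = L f xi.
Proof.
move=> sxi; under eq_bigr do rewrite (generatorE D_uniq p_supp lambda_gt0 _ sxi).
rewrite -drift_sum (generatorE D_uniq p_supp lambda_gt0 _ sxi).
apply: eq_drift => eta et; rewrite (bigD1_seq eta)/= ?undup_uniq//.
rewrite indE eqxx mulr1 big1 ?addr0// => zeta /negbTE ne.
by rewrite indE eq_sym ne mulr0.
Qed.

End Markov.

(** * Real-valued probabilities *)

Section Prob.
Variables (disp : measure_display) (T : measurableType disp) (R : realType).
Variable P : probability T R.
Implicit Types A B : set T.

Definition prob A : R := fine (P A).

Lemma probE A : measurable A -> P A = (prob A)%:E.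
Proof. by move=> mA; rewrite /prob fineK// fin_num_measure. Qed.

Lemma prob0 : prob set0 = 0.
Proof. by rewrite /prob measure0. Qed.

Lemma probT : prob setT = 1.
Proof. by rewrite /prob probability_setT. Qed.

Lemma prob_ge0 A : 0 <= prob A.
Proof. by rewrite /prob fine_ge0. Qed.

Lemma le_prob A B : measurable A -> measurable B -> A `<=` B -> prob A <= prob B.
Proof.
by move=> mA mB AB; rewrite /prob fine_le ?fin_num_measure// le_measure ?inE.
Qed.

Lemma prob_disjU A B : measurable A -> measurable B -> A `&` B = set0 ->
  prob (A `|` B) = prob A + prob B.
Proof.
by move=> mA mB AB; rewrite /prob measureU// fineD ?fin_num_measure.
Qed.

Lemma prob_sum_le (I : eqType) (s : seq I) (B : I -> set T) A : uniq s ->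
  measurable A -> (forall i, measurable (B i)) ->
  (forall i j, i != j -> B i `&` B j = set0) ->
  \sum_(i <- s) prob (A `&` B i) <= prob A.
Proof.
move=> us mA mB dB; elim: s us A mA => [_ A mA|i s IH /= /andP[iNs us] A mA].
  by rewrite big_nil prob_ge0.
have mAi : measurable (A `\` B i) by exact: measurableD.
have AE : A = (A `&` B i) `|` (A `\` B i).
  by rewrite setDE -setIUr setUCr setIT.
rewrite big_cons [in leRHS]AE prob_disjU//; last 2 first.
- exact: measurableI.
- by rewrite setDE setIACA setICr setI0.
rewrite lerD2l (le_trans _ (IH us _ mAi))// big_seq [leRHS]big_seq.
apply: ler_sum => j js; apply: le_prob; [exact: measurableI..|].
move=> t [At Bjt]; split=> //; split=> // Bit.
have ij : i != j by apply: contra iNs => /eqP ->.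
by have : (B i `&` B j) t by []; rewrite dB.
Qed.

Lemma prob_le_sum (I : eqType) (s : seq I) (B : I -> set T) A :
  measurable A -> (forall i, measurable (B i)) ->
  (forall t, A t -> exists2 i, i \in s & B i t) ->
  prob A <= \sum_(i <- s) prob (A `&` B i).
Proof.
move=> mA mB; elim: s A mA => [A mA AB|i s IH A mA AB].
  rewrite big_nil (_ : A = set0) ?prob0//.
  by apply/seteqP; split=> // t /AB[].
have mAi : measurable (A `\` B i) by exact: measurableD.
have AE : A = (A `&` B i) `|` (A `\` B i).
  by rewrite setDE -setIUr setUCr setIT.
rewrite big_cons [in leLHS]AE prob_disjU//; last 2 first.
- exact: measurableI.
- by rewrite setDE setIACA setICr setI0.
rewrite lerD2l (le_trans (IH _ mAi _))//.
  move=> t [At Bit]; have [j] := AB _ At.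
  by rewrite inE => /predU1P[->//|js] Bj; exists j.
apply: ler_sum => j _; apply: le_prob; [exact: measurableI..|].
by move=> t [[At _] Bjt].
Qed.

End Prob.

(** * Inactivity along a time mesh *)

Section MarkovLaw.
Variables (R : realType) (d : nat).
Variables (D : seq (lattice d)) (p : lattice d -> R).
Hypothesis p_ge0 : forall e, 0 <= p e.
Hypothesis p_sum1 : \sum_(e <- D) p e = 1.
Hypothesis D_uniq : uniq D.
Hypothesis D_neq0 : 0 \notin D.
Hypothesis p_supp : forall z, z \notin D -> p z = 0.
Variable lambda : \bar R.
Hypothesis lambda_gt0 : (0 < lambda)%E.
Variable Q : probability (trajectory R d) R.
Hypothesis Q_markov : forall (s t : R) (F : set (trajectory R d)) (xi xi' : config d),
  0 <= s -> 0 <= t -> event_upto [set: lattice d] s F -> finite_config xi ->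
  Q (F `&` [set w | w s = xi] `&` [set w | w (s + t) = xi']) =
  (Q (F `&` [set w | w s = xi]) * (transition p lambda t xi xi')%:E)%E.
Implicit Types (xi eta : config d) (A E F : set (trajectory R d)).

Local Notation Pr := (prob Q).

Lemma measurable_config_at (s : R) xi : 0 <= s -> measurable (config_at s xi).
Proof.
move=> s0; apply: (@measurable_event_upto _ _ setT s).
by apply: event_upto_config; rewrite s0 lexx.
Qed.

Definition elsewhere (s : R) (T : seq (config d)) : set (trajectory R d) :=
  [set w | (w s : config d) \notin T].

Lemma measurable_elsewhere (s : R) T : 0 <= s -> measurable (elsewhere s T).
Proof.
move=> s0; elim: T => [|a T IH].
  rewrite (_ : elsewhere s [::] = setT); first exact: measurableT.
  by apply/seteqP; split.
rewrite (_ : elsewhere s (a :: T) = ~` config_at s a `&` elsewhere s T).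
  by apply: measurableI => //; apply: measurableC; exact: measurable_config_at.
apply/seteqP; split=> w; rewrite /elsewhere /config_at /= inE negb_or.
  by case/andP => /eqP.
by case=> /eqP -> ->.
Qed.

Lemma Pr_split (s : R) (T : seq (config d)) A : 0 <= s -> uniq T -> measurable A ->
  Pr A = \sum_(eta <- T) Pr (A `&` config_at s eta) + Pr (A `&` elsewhere s T).
Proof.
move=> s0 uT mA; elim: T uT => [_|a T IH /= /andP[aT uT]].
  rewrite big_nil add0r; congr Pr; apply/seteqP; split=> w; last by case.
  by move=> Aw; split.
rewrite (IH uT) big_cons -addrA addrCA; congr (_ + _).
rewrite -prob_disjU; last first.
- apply/seteqP; split=> w //; rewrite /config_at /elsewhere /= => -[[_ wa] [_ wT]].
  by move: wT; rewrite wa inE eqxx.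
- by apply: measurableI => //; exact: measurable_elsewhere.
- by apply: measurableI => //; exact: measurable_config_at.
congr Pr; apply/seteqP; split=> w; rewrite /config_at /elsewhere /=.
  move=> [Aw wT]; have [wa|wa] := eqVneq (w s : config d) a; [left|right] => //.
  by split=> //; rewrite inE negb_or wa.
case=> [[Aw ->]|[Aw]]; first by split.
by rewrite inE negb_or => /andP[_ wT]; split.
Qed.

Variable n : nat.
Local Notation L := (generator p lambda).
Let r := 2 * (rate_bound lambda * n%:R).

Lemma at_most_finite xi : at_most n xi -> finite_config xi.
Proof.
move=> [s [us sE] _]; apply: (@sub_finite_set _ _ [set` s]); last exact: finite_seq.
move=> x /= xi0; rewrite sE; apply: contra xi0.
by rewrite /particles; case: (xi x) => [[|]|].
Qed.

(** The expansion error of one transition probability, times a bound on the number of targets. *)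
Definition mesh_error (delta : R) : R :=
  (1 + n * (1 + size D))%:R * ((delta * r) ^+ 2 * expR 1).

Lemma markov_step (s delta : R) F E xi (g : config d -> R) :
  0 <= s -> 0 <= delta -> delta * r <= 1 -> at_most n xi ->
  event_upto setT s F -> measurable E ->
  (forall eta, at_most n eta -> 0 <= g eta <= 1) ->
  (forall eta, at_most n eta ->
     Pr (F `&` config_at s xi `&` config_at (s + delta) eta `&` E) <=
     Pr (F `&` config_at s xi `&` config_at (s + delta) eta) * g eta) ->
  Pr (F `&` config_at s xi `&` E) <=
  Pr (F `&` config_at s xi) * (g xi + delta * L g xi + mesh_error delta).
Proof.
move=> s0 de0 dr1 nxi evF mE g01 gE.
have [sp sxi sn] := nxi.
pose T := targets D lambda sp xi.
have uT : uniq T by exact: undup_uniq.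
have sd0 : 0 <= s + delta by exact: addr_ge0.
set A := F `&` config_at s xi.
have mA : measurable A.
  apply: measurableI; last exact: measurable_config_at.
  exact: measurable_event_upto evF.
have PrA eta : Pr (A `&` config_at (s + delta) eta) =
    Pr A * transition p lambda delta xi eta.
  by rewrite /prob Q_markov//; [rewrite fineM ?fin_num_measure|exact: at_most_finite].
(* The bound goes through the complement: since [g] is at most 1, configurations outside the targets
   may be dropped, and lower bounds on the transitions suffice. *)
have key : Pr (A `&` E) <= Pr A -
    \sum_(eta <- T) Pr A * transition p lambda delta xi eta * (1 - g eta).
  rewrite [X in _ <= X - _](Pr_split sd0 uT mA) (Pr_split sd0 uT (measurableI _ _ mA mE)).
  rewrite addrAC -sumrB; apply: lerD.
    rewrite big_seq [leRHS]big_seq; apply: ler_sum => eta et.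
    rewrite -PrA [leRHS](_ : _ = Pr (A `&` config_at (s + delta) eta) * g eta); last by ring.
    rewrite -setIA [E `&` _]setIC setIA.
    by apply: gE; apply: at_most_targets et.
  apply: le_prob.
  - by apply: measurableI; [exact: measurableI|exact: measurable_elsewhere].
  - by apply: measurableI => //; exact: measurable_elsewhere.
  - by move=> w [[]].
apply: (le_trans key); under eq_bigr do rewrite -mulrA.
rewrite -mulr_sumr -{1}[Pr A]mulr1 -mulrBr ler_wpM2l ?prob_ge0//.
pose C := (delta * r) ^+ 2 * expR 1.
have C0 : 0 <= C by rewrite mulr_ge0 ?sqr_ge0 ?expR_ge0.
have tr eta : ind R eta xi + delta * L (ind R eta) xi - C <= transition p lambda delta xi eta.
  have := transition_approx p_ge0 p_sum1 D_uniq D_neq0 p_supp lambda_gt0 eta de0 dr1 nxi.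
  by rewrite ler_norml => /andP[+ _]; rewrite -/r -/C; lra.
have low : \sum_(eta <- T) (ind R eta xi + delta * L (ind R eta) xi - C) * (1 - g eta) <=
    \sum_(eta <- T) transition p lambda delta xi eta * (1 - g eta).
  rewrite big_seq [leRHS]big_seq; apply: ler_sum => eta et.
  rewrite ler_wpM2r// subr_ge0.
  by have /andP[] := g01 _ (at_most_targets D_neq0 nxi et).
have sum_eq : \sum_(eta <- T) (ind R eta xi + delta * L (ind R eta) xi - C) * (1 - g eta) =
    (1 - g xi) - delta * L g xi - C * \sum_(eta <- T) (1 - g eta).
  have h1 := sum_targets D lambda sp (fun eta => 1 - g eta) xi.
  have h2 := sum_targets_generator p_ge0 D_uniq p_supp lambda_gt0 (fun eta => 1 - g eta) sxi.
  have h3 : L (fun eta => 1 - g eta) xi = - L g xi.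
    rewrite !(generatorE D_uniq p_supp lambda_gt0 _ sxi) /drift -sumrN.
    apply: eq_bigr => x _.
    rewrite (_ : step D p (fun e => 1 - g (jumped lambda xi x (x + e))) =
      1 - step D p (fun e => g (jumped lambda xi x (x + e)))); first by ring.
    rewrite (eq_step p_ge0 (G := fun e => 1 + -1 * g (jumped lambda xi x (x + e)))).
      by rewrite stepD (step_cst p_sum1) stepZ mulN1r.
    by move=> e _; rewrite mulN1r.
  rewrite -h1 -/T -[- (delta * L g xi)]mulrN -h3 -h2 -/T !mulr_sumr -big_split -sumrB/=.
  by apply: eq_bigr => eta _; ring.
have sT : \sum_(eta <- T) (1 - g eta) <= (1 + n * (1 + size D))%:R.
  apply: (@le_trans _ _ (\sum_(eta <- T) 1)).
    rewrite big_seq [leRHS]big_seq; apply: ler_sum => eta et.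
    by rewrite gerBl; have /andP[] := g01 _ (at_most_targets D_neq0 nxi et).
  rewrite big_const_seq count_predT iter_addr_0 ler_nat.
  exact: size_targets.
have := ler_wpM2l C0 sT; rewrite sum_eq in low; rewrite /mesh_error -/C.
by lra.
Qed.

Variables (o : lattice d) (delta : R) (N : nat).
Hypothesis delta_gt0 : 0 < delta.
Hypothesis delta_small : delta * r <= 1.

(* [o] is inactive at the last N + 1 of the k + 1 times s, s + delta, .. *)
Fixpoint inactive_late (k : nat) (s : R) : set (trajectory R d) :=
  if k is l.+1 then
    (if (l < N)%N then inactive_at o s else setT) `&` inactive_late l (s + delta)
  else inactive_at o s.

Lemma event_upto_inactive_late k (s t : R) : 0 <= s -> s + k%:R * delta <= t ->
  event_upto [set o] t (inactive_late k s).
Proof.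
elim: k s => [|k IH] s s0 st.
  by apply: event_upto_inactive => //; rewrite mul0r addr0 in st; rewrite s0.
have k0 : 0 <= k%:R * delta by rewrite mulr_ge0// ltW.
rewrite -natr1 mulrDl mul1r in st.
have st' : 0 <= s <= t by rewrite s0/=; have := delta_gt0; lra.
apply: event_uptoI.
  by case: ifP => _; [exact: event_upto_inactive|exact: event_uptoT].
by apply: IH; have := delta_gt0; lra.
Qed.

Lemma inactive_late_sub k (s T : R) (w : trajectory R d) :
  (forall t, T <= t -> num_active (w t o) = 0%N) ->
  T + N%:R * delta <= s + k%:R * delta -> inactive_late k s w.
Proof.
move=> wT; elim: k s => [|k IH] s Ts.
  apply: wT; have : 0 <= N%:R * delta by rewrite mulr_ge0// ltW.
  by lra.
have kS : k.+1%:R * delta = k%:R * delta + delta by rewrite -natr1 mulrDl mul1r.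
split; last by apply: IH; lra.
case: ifPn => // kN; apply: wT.
have : k.+1%:R * delta <= N%:R * delta by rewrite ler_pM2r// ler_nat.
by lra.
Qed.

(** Backward recursion along the mesh: activity of [o] at the current time is read off [xi], and
    [markov_step] passes to the next time with the current configuration joined to the past. *)
Lemma inactive_late_le k (s : R) F xi : 0 <= s -> at_most n xi -> event_upto setT s F ->
  Pr (F `&` config_at s xi `&` inactive_late k s) <=
  Pr (F `&` config_at s xi) * inactivity p lambda o delta (mesh_error delta) N k xi.
Proof.
set err := mesh_error delta.
have err0 : 0 <= err by rewrite mulr_ge0// mulr_ge0 ?sqr_ge0 ?expR_ge0.
have mE l t : 0 <= t -> measurable (inactive_late l t).
  by move=> t0; apply: measurable_event_upto (event_upto_inactive_late t0 (lexx _)).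
have small : delta * (rate_bound lambda * n%:R) <= 1.
  apply: le_trans delta_small; rewrite ler_pM2l// /r ler_peMl ?mulr_ge0 ?rate_bound_ge0//.
  by rewrite ler1n.
elim: k s F xi => [|k IH] s F xi s0 nxi evF.
  rewrite [inactivity _ _ _ _ _ _ _ _]/=; have [no|no] := eqVneq (num_active (xi o)) 0%N.
    rewrite mulr1; apply: le_prob.
    - apply: measurableI; last exact: (mE 0%N).
      by apply: measurableI; [exact: measurable_event_upto evF|exact: measurable_config_at].
    - by apply: measurableI; [exact: measurable_event_upto evF|exact: measurable_config_at].
    - by move=> w [].
  rewrite mulr0 (_ : _ `&` _ = set0) ?prob0//.
  apply/seteqP; split=> w // -[[_ wxi] na]; move/eqP: no; apply.
  by move: na; rewrite /= /inactive_at /= (wxi : (w s : config d) = xi).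
have sd : 0 <= s + delta by rewrite addr_ge0// ltW.
have mA : measurable (F `&` config_at s xi).
  by apply: measurableI; [exact: measurable_event_upto evF|exact: measurable_config_at].
rewrite [inactivity _ _ _ _ _ _ _ _]/=.
rewrite /Num.min; case: ifPn => _.
  rewrite mulr1; apply: le_prob; [|exact: mA|by move=> w []].
  by apply: measurableI => //; exact: (mE k.+1).
have [no|no] := boolP ((k < N)%N ==> (num_active (xi o) == 0%N)); last first.
  rewrite mul0r mulr0 (_ : _ `&` _ = set0) ?prob0//.
  move: no; rewrite negb_imply => /andP[kN /eqP no].
  apply/seteqP; split=> w //; rewrite [inactive_late _ _]/= kN.
  move=> [[_ wxi] [na _]]; apply: no => /=.
  by move: na; rewrite /inactive_at /= (wxi : (w s : config d) = xi).
rewrite mul1r; apply: (@le_trans _ _ (Pr (F `&` config_at s xi `&` inactive_late k (s + delta)))).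
  apply: le_prob; first by apply: measurableI => //; exact: (mE k.+1).
    by apply: measurableI => //; exact: mE.
  by move=> w [Aw []].
apply: markov_step => //; [exact: ltW|exact: mE| |].
  move=> eta neta; rewrite inactivity_le1 andbT.
  exact: (inactivity_ge0 p_ge0 p_sum1 D_uniq D_neq0 p_supp lambda_gt0 o delta_gt0 small err0).
move=> eta neta; apply: IH => //; apply: event_uptoI.
  by apply: event_uptoS evF => //; rewrite lerDl ltW.
by apply: event_upto_config; rewrite s0 lerDl ltW.
Qed.

End MarkovLaw.

(** * The initial law *)

Section InitialLaw.
Variables (R : realType) (d : nat).
Variable nu : probability (config d) R.
Hypothesis nu_iid : iid nu.
Implicit Types (xi eta : config d) (x y z : lattice d) (s U V : seq (lattice d)).

Lemma measurable_site x (A : set site_state) : measurable [set eta : config d | A (eta x)].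
Proof.
pose f n := if n is m.+1 then Active m else Sleeping.
have -> : [set eta : config d | A (eta x)] = \bigcup_n
    (if `[< A (f n) >] then [set eta | eta x = f n] else set0).
  apply/seteqP; split=> eta.
    have [n fn] : exists n, eta x = f n.
      by case: (eta x) => [m|]; [exists m.+1|exists 0%N].
    by rewrite /= fn => Af; exists n => //; rewrite asboolT.
  by move=> [n _]; case: ifPn => [/asboolP Aa /= ->|_].
apply: bigcupT_measurable => n; case: ifP => _; last exact: measurable0.
by apply: sub_sigma_algebra; exists x, (f n).
Qed.

Lemma measurable_sitewise (f : lattice d -> site_state -> site_state) xi :
  measurable [set eta : config d | (fun x => f x (eta x)) = xi].
Proof.
have -> : [set eta : config d | (fun x => f x (eta x)) = xi] = \bigcap_n
    (if @choice.unpickle (lattice d) n is Some x then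
       [set eta : config d | f x (eta x) = xi x] else setT).
  apply/seteqP; split=> eta.
    by move=> <- n _; case: (@choice.unpickle (lattice d) n).
  move=> h; apply/funext => x; have := h (choice.pickle x) I.
  by rewrite choice.pickleK.
apply: bigcapT_measurable => n; case: (@choice.unpickle (lattice d) n) => [x|];
  last exact: (@measurableT _ (config d)).
exact: (measurable_site x [set a | f x a = xi x]).
Qed.

(* Discarding the particles of the sites with more than [K] particles makes the
   law of the counts finitely supported, with a mean at most 1. *)
Definition capped (K : nat) (a : site_state) : nat :=
  if (num_particles a <= K)%N then num_particles a else 0%N.

Definition law K (j : nat) : R := prob nu [set eta : config d | capped K (eta 0) = j].

Definition cut_event K (s : seq (lattice d)) (j : lattice d -> nat) : set (config d) :=
  [set eta | {in s, forall x, capped K (eta x) = j x}].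

Lemma measurable_cut_event K s j : measurable (cut_event K s j).
Proof.
elim: s => [|x s IH].
  by rewrite (_ : cut_event _ _ _ = setT)//; apply/seteqP; split.
rewrite (_ : cut_event _ _ _ = [set eta | capped K (eta x) = j x] `&` cut_event K s j).
  by apply: measurableI => //; exact: (measurable_site x [set a | capped K a = j x]).
apply/seteqP; split=> eta.
  move=> h; split=> [|y ys]; first by apply: h; rewrite inE eqxx.
  by apply: h; rewrite inE ys orbT.
by move=> [hx hs] y; rewrite inE => /predU1P[->//|]; exact: hs.
Qed.

Lemma prob_cut_event K s j : uniq s ->
  prob nu (cut_event K s j) = \prod_(x <- s) law K (j x).
Proof.
move=> us; have [hom ind] := nu_iid.
have -> : cut_event K s j = [set eta | forall x, x \in [fset x in s]%fset ->
    [set a | capped K a = j x] (eta x)].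
  by apply/seteqP; split=> eta h x; [rewrite !inE/= => /h|move=> xs; apply: h; rewrite !inE].
rewrite /prob (ind [fset x in s]%fset (fun x => [set a | capped K a = j x])).
rewrite (perm_big s)/=; last first.
  apply: uniq_perm => //; first exact: fset_uniq.
  by move=> x; rewrite !inE.
elim: s {us} => [|x s IH]; first by rewrite !big_nil.
rewrite !big_cons fineM; last 2 first.
- rewrite fin_num_measure//; exact: (measurable_site x [set a | capped K a = j x]).
- elim: s {IH} => [|y s IH]; first by rewrite big_nil.
  rewrite big_cons fin_numM// fin_num_measure//.
  exact: (measurable_site y [set a | capped K a = j y]).
by rewrite IH (hom x [set a | capped K a = j x]).
Qed.

Lemma law_ge0 K j : 0 <= law K j.
Proof. exact: prob_ge0. Qed.

Lemma cut_le K a : (capped K a <= K)%N.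
Proof. by rewrite /capped; case: ifP. Qed.

Lemma measurable_cut K x j : measurable [set eta : config d | capped K (eta x) = j].
Proof. exact: (measurable_site x [set a | capped K a = j]). Qed.

Lemma sum_cut (K : nat) x (A : set (config d)) : measurable A ->
  prob nu A = \sum_(j < K.+1) prob nu (A `&` [set eta | capped K (eta x) = j]).
Proof.
move=> mA; rewrite -(big_mkord xpredT (fun j => prob nu (A `&` [set eta | capped K (eta x) = j]))).
apply/le_anti/andP; split.
  apply: prob_le_sum => // [j|eta Aeta]; first exact: measurable_cut.
  exists (capped K (eta x)) => //; rewrite mem_index_iota leq0n ltnS; exact: cut_le.
apply: prob_sum_le => // [|j|i j ij]; first exact: iota_uniq.
  exact: measurable_cut.
apply/seteqP; split=> // eta [/= h1 h2]; move/eqP: ij; apply.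
by rewrite -h1 -h2.
Qed.

Lemma law_sum1 K : \sum_(j < K.+1) law K j = 1.
Proof.
rewrite -(probT nu) (sum_cut K 0 measurableT); apply: eq_bigr => j _.
by rewrite setTI.
Qed.

Lemma num_particles_sleep_everywhere xi x :
  num_particles (sleep_everywhere xi x) = num_particles (xi x).
Proof. exact: particles_try_sleep. Qed.

Variable lambda : \bar R.
Variable V : {fset lattice d}.
Local Notation init := (initial_config lambda V).

Lemma particles_init eta x :
  particles (init eta) x = if x \in V then num_particles (eta x) else 0%N.
Proof.
rewrite /particles /initial_config.
have rE : num_particles (restrict_config V eta x) =
    if x \in V then num_particles (eta x) else 0%N.
  by rewrite /restrict_config; case: ifP.
by case: ifP => _; rewrite ?num_particles_sleep_everywhere.
Qed.

Lemma cut_init K eta x : x \in V -> capped K (init eta x) = capped K (eta x).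
Proof.
by move=> xV; rewrite /capped; have := particles_init eta x; rewrite /particles xV => ->.
Qed.

Lemma measurable_config_singleton xi : measurable [set eta | init eta = xi].
Proof.
pose f x (a : site_state) := let b := if x \in V then a else Active 0 in
  if lambda == +oo%E then try_sleep b else b.
have <- : [set eta : config d | (fun x => f x (eta x)) = xi] = [set eta | init eta = xi].
  suff fE eta : (fun x => f x (eta x)) = init eta by apply/seteqP; split=> eta /=; rewrite fE.
  apply/funext => x.
  by rewrite /initial_config /f; case: ifP => _; rewrite /sleep_everywhere /restrict_config.
exact: measurable_sitewise.
Qed.

Definition init_weight xi : R := prob nu [set eta | init eta = xi].

Lemma init_weight_ge0 xi : 0 <= init_weight xi.
Proof. exact: prob_ge0. Qed.

Lemma init_disjoint xi xi' : xi != xi' ->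
  [set eta | init eta = xi] `&` [set eta | init eta = xi'] = set0.
Proof.
move=> /eqP ne; apply/seteqP; split=> // eta [/= h1 h2]; apply: ne.
by rewrite -h1 -h2.
Qed.

Lemma sum_init_weight (X : seq (config d)) : uniq X -> \sum_(xi <- X) init_weight xi <= 1.
Proof.
move=> uX; rewrite -(probT nu).
have := prob_sum_le nu uX measurableT measurable_config_singleton init_disjoint.
by under eq_bigr do rewrite setTI.
Qed.

(** The induction moves the sites of [s] one by one to [r], the sites whose capped count is
    prescribed by [j]; [c] accumulates the counts already revealed. Independence enters through
    [prob_cut_event] only. *)
Lemma sum_init_cut K (X : seq (config d)) s r j (F : (lattice d -> nat) -> R) c :
  uniq X -> uniq (s ++ r) -> {subset s <= V} -> (forall c, 0 <= F c) ->
  \sum_(xi <- X) prob nu (cut_event K r j `&` [set eta | init eta = xi]) *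
    F (fun z => c z + (z \in s) * capped K (xi z))%N <=
  (\prod_(x <- r) law K (j x)) * Ex K (law K) s F c.
Proof.
move=> uX; elim: s r j c => [|x s IH] r j c usr sV F0.
  rewrite /= -prob_cut_event//.
  under eq_bigr => xi _.
    rewrite (_ : (fun z => _) = c); first over.
    by apply/funext => z; rewrite mul0n addn0.
  rewrite -mulr_suml ler_wpM2r//; apply: prob_sum_le => //.
  - exact: measurable_cut_event.
  - exact: measurable_config_singleton.
  - exact: init_disjoint.
have xV : x \in V by apply: sV; rewrite inE eqxx.
have sV' : {subset s <= V} by move=> y ys; apply: sV; rewrite inE ys orbT.
move: usr; rewrite cat_cons cons_uniq mem_cat negb_or => /andP[/andP[xs xr] usr].
have usr' : uniq (s ++ x :: r).
  by rewrite uniq_catC cat_cons cons_uniq mem_cat negb_or xr xs/= uniq_catC.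
pose jj (i : nat) z := if z == x then i else j z.
have cutE i : cut_event K (x :: r) (jj i) =
    cut_event K r j `&` [set eta | capped K (eta x) = i].
  apply/seteqP; split=> eta.
    move=> h; split=> [y yr|]; last first.
      by have := h x; rewrite inE eqxx /jj eqxx; exact.
    have := h y; rewrite inE yr orbT /jj; case: eqP => [yx|_ ->//].
    by move: xr; rewrite -yx yr.
  move=> [h hx] y; rewrite inE /jj; case: eqP => [->//|_ /=]; exact: h.
have prodE (i : nat) : \prod_(y <- x :: r) law K (jj i y) =
    law K i * \prod_(y <- r) law K (j y).
  rewrite big_cons /jj eqxx; congr (_ * _); rewrite big_seq [RHS]big_seq.
  by apply: eq_bigr => y yr; case: eqP => // yx; move: xr; rewrite -yx yr.
rewrite [leRHS]/= mulr_sumr.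
apply: (@le_trans _ _ (\sum_(i < K.+1) \sum_(xi <- X)
    prob nu (cut_event K (x :: r) (jj i) `&` [set eta | init eta = xi]) *
    F (fun z => addk x i c z + (z \in s) * capped K (xi z))%N)); last first.
  apply: ler_sum => i _; rewrite mulrA [_ * law K i]mulrC -prodE.
  exact: IH.
rewrite exchange_big/=; apply: ler_sum => xi _.
rewrite (sum_cut K x); last first.
  by apply: measurableI; [exact: measurable_cut_event|exact: measurable_config_singleton].
rewrite mulr_suml; apply: ler_sum => i _; rewrite cutE setIAC.
have [xi_i|xi_i] := eqVneq (capped K (xi x)) i.
  rewrite le_eqVlt; apply/orP; left; apply/eqP; congr (_ * F _).
  apply/funext => z; rewrite inE /addk; case: (eqVneq z x) => [->|_] /=; last first.
    by rewrite mul0n addn0.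
  by rewrite (negbTE xs) mul0n addn0 !mul1n xi_i.
rewrite [X in X * _](_ : _ = 0) ?mul0r ?mulr_ge0 ?prob_ge0//.
rewrite (_ : _ `&` _ = set0) ?prob0//; apply/seteqP; split=> // eta [[_ /= h1] h2].
by move/eqP: xi_i; apply; rewrite -h2 -h1 cut_init.
Qed.

Lemma sum_init_cut0 K (X : seq (config d)) s (F : (lattice d -> nat) -> R) :
  uniq X -> uniq s -> {subset s <= V} -> (forall c, 0 <= F c) ->
  \sum_(xi <- X) init_weight xi * F (fun z => (z \in s) * capped K (xi z))%N <=
  Ex K (law K) s F (fun=> 0%N).
Proof.
move=> uX us sV F0.
have := @sum_init_cut K X s [::] (fun=> 0%N) F (fun=> 0%N) uX _ sV F0.
rewrite cats0 big_nil mul1r => /(_ us); apply: le_trans.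
apply: ler_sum => xi _; rewrite ler_wpM2r// /init_weight.
apply: le_prob; first exact: measurable_config_singleton.
  by apply: measurableI; [exact: measurable_cut_event|exact: measurable_config_singleton].
by move=> eta etaxi; split.
Qed.

Definition count_law (j : nat) : R := prob nu [set eta : config d | num_particles (eta 0) = j].

Hypothesis mean_count : forall k, \sum_(j < k.+1) j%:R * count_law j <= 1.

Lemma sum_init_particles (X : seq (config d)) k x : uniq X -> x \in V ->
  {in X, forall xi, (particles xi x <= k)%N} ->
  \sum_(xi <- X) init_weight xi * (particles xi x)%:R <= 1.
Proof.
move=> uX xV Xk; apply: le_trans (mean_count k).
pose A j := [set eta : config d | num_particles (eta x) = j].
have mA j : measurable (A j) by exact: (measurable_site x [set a | num_particles a = j]).
have hom j : prob nu (A j) = count_law j.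
  by rewrite /prob (nu_iid.1 x [set a | num_particles a = j]).
under [leRHS]eq_bigr do rewrite -hom.
apply: (@le_trans _ _ (\sum_(j < k.+1) j%:R *
    \sum_(xi <- X) prob nu (A j `&` [set eta | init eta = xi]))); last first.
  apply: ler_sum => j _; rewrite ler_wpM2l//; apply: prob_sum_le => //.
    exact: measurable_config_singleton.
  exact: init_disjoint.
under [leRHS]eq_bigr do rewrite mulr_sumr.
rewrite exchange_big/= big_seq [leRHS]big_seq; apply: ler_sum => xi xiX.
rewrite (bigD1 (Ordinal (Xk _ xiX : particles xi x < k.+1)%N))//= mulrC.
rewrite -[leLHS]addr0; apply: lerD; last first.
  by apply: sumr_ge0 => j _; rewrite mulr_ge0// prob_ge0.
rewrite ler_wpM2l//; apply: le_prob; first exact: measurable_config_singleton.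
  by apply: measurableI; [exact: mA|exact: measurable_config_singleton].
move=> eta /= etaxi; split=> //=.
by have := particles_init eta x; rewrite etaxi xV /A /= => ->.
Qed.

End InitialLaw.

(** * Finite volumes *)

Section FiniteVolume.
Variables (R : realType) (d : nat).
Variables (D : seq (lattice d)) (p : lattice d -> R).
Hypothesis p_ge0 : forall e, 0 <= p e.
Hypothesis p_sum1 : \sum_(e <- D) p e = 1.
Hypothesis D_uniq : uniq D.
Hypothesis D_neq0 : 0 \notin D.
Hypothesis p_supp : forall z, z \notin D -> p z = 0.
Variable lambda : \bar R.
Hypothesis lambda_gt0 : (0 < lambda)%E.
Variable nu : probability (config d) R.
Hypothesis nu_iid : iid nu.
Hypothesis mean_count : forall k, \sum_(j < k.+1) j%:R * count_law nu j <= 1.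
Implicit Types (xi eta : config d) (x y z : lattice d).

Fixpoint bounded_configs (k : nat) (s : seq (lattice d)) : seq (config d) :=
  if s is x :: s' then
    [seq (fun z => if z == x then a else xi z : site_state) |
      a <- Sleeping :: [seq Active j | j <- iota 0 k.+1], xi <- bounded_configs k s']
  else [:: (fun=> Active 0) : config d].

Lemma mem_bounded_configs k s xi : (forall x, x \notin s -> particles xi x = 0%N) ->
  (forall x, (particles xi x <= k)%N) -> xi \in bounded_configs k s.
Proof.
elim: s xi => [|x s IH] xi xi0 xik.
  rewrite inE; apply/eqP/funext => x; have := xi0 x isT.
  by rewrite /particles; case: (xi x) => [[|]|].
pose xi' : config d := fun z => if z == x then Active 0 else xi z.
have xi's : xi' \in bounded_configs k s.
  apply: IH => z; rewrite /particles /xi'; case: eqVneq => // zx.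
    by move=> zs; apply: xi0; rewrite inE negb_or zx.
  exact: xik.
apply/allpairsP; exists (xi x, xi'); split; [rewrite [_.1]/=|exact: xi's|].
  have := xik x; rewrite /particles; case: (xi x) => [n nk|_]; last by rewrite inE eqxx.
  by rewrite inE; apply/orP; right; apply/mapP; exists n; rewrite ?mem_iota ?add0n ?ltnS.
by apply/funext => z /=; rewrite /xi'; case: (eqVneq z x) => [->|].
Qed.

Lemma finite_configs k (s : seq (lattice d)) : exists2 X : seq (config d), uniq X &
  forall xi, xi \in X <-> (forall x, x \notin s -> particles xi x = 0%N) /\
    (forall x, (particles xi x <= k)%N).
Proof.
pose good xi := `[< (forall x, x \notin s -> particles xi x = 0%N) /\
    (forall x, (particles xi x <= k)%N) >].
exists (undup [seq xi <- bounded_configs k s | good xi]); first exact: undup_uniq.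
move=> xi; rewrite mem_undup mem_filter; split=> [/andP[/asboolP//]|[xis xik]].
by apply/andP; split; [exact/asboolP|exact: (mem_bounded_configs xis xik)].
Qed.

Variables (V : {fset lattice d}) (Q : probability (trajectory R d) R).
Hypothesis Q_law : finite_arw_law p lambda nu V Q.
Local Notation init := (initial_config lambda V).
Local Notation init_weight := (init_weight nu lambda V).

Lemma measurable_mem (X : seq (config d)) : measurable [set xi : config d | xi \notin X].
Proof.
elim: X => [|a X IH].
  by rewrite (_ : [set _ | _] = setT)//; apply/seteqP; split.
rewrite (_ : [set _ | _] = ~` [set xi | xi = a] `&` [set xi : config d | xi \notin X]).
  by apply: measurableI => //; apply: measurableC; exact: (measurable_sitewise (fun=> id)).
apply/seteqP; split=> xi /=; rewrite inE negb_or; first by case/andP => /eqP.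
by case=> /eqP -> ->.
Qed.

Lemma prob_config_at0 xi : prob Q (config_at 0 xi) = init_weight xi.
Proof.
have [Q0 _] := Q_law; rewrite /prob /init_weight /prob.
by rewrite (Q0 [set eta | eta = xi])//; exact: (measurable_sitewise (fun=> id)).
Qed.

Definition tail_prob k := prob nu [set eta : config d | (k < num_particles (eta 0%R))%N].

Lemma prob_elsewhere k (X : seq (config d)) :
  (forall xi, xi \in X <-> (forall x, x \notin V -> particles xi x = 0%N) /\
    (forall x, (particles xi x <= k)%N)) ->
  prob Q (elsewhere 0 X) <= #|` V|%:R * tail_prob k.
Proof.
move=> XE; have [Q0 _] := Q_law; rewrite /prob (Q0 [set xi | xi \notin X]); last exact: measurable_mem.
set A := [set eta | _]; rewrite -/(prob nu A).
pose B x := [set eta : config d | (k < num_particles (eta x))%N].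
have mB x : measurable (B x) by exact: (measurable_site x [set a | (k < num_particles a)%N]).
have PB x : prob nu (B x) = tail_prob k.
  by rewrite /prob (nu_iid.1 x [set a | (k < num_particles a)%N]).
have AB eta : A eta -> exists2 x, x \in (V : seq (lattice d)) & B x eta.
  move=> Aeta; apply: contrapT => h; move: Aeta; rewrite /A /=; apply/negP; rewrite negbK.
  apply/XE; split=> x; rewrite particles_init; first by move/negbTE ->.
  case: ifPn => // xV; rewrite leqNgt; apply/negP => kx; apply: h.
  by exists x.
have mA : measurable A.
  suff : measurable (~` A) by move/measurableC; rewrite setCK.
  have -> : ~` A = \big[setU/set0]_(xi <- X) [set eta | init eta = xi].
    apply/seteqP; split=> eta; rewrite /A /=.
      move/negP; rewrite negbK => h; rewrite -bigcup_seq; by exists (init eta).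
    rewrite -bigcup_seq => -[xi /= xiX etaxi].
    by apply/negP; rewrite negbK etaxi.
  by apply: bigsetU_measurable => xi _; exact: measurable_config_singleton.
apply: (le_trans (prob_le_sum nu mA mB AB)).
apply: (@le_trans _ _ (\sum_(x <- V) tail_prob k)).
  apply: ler_sum => x _; rewrite -(PB x).
  by apply: le_prob => //; exact: measurableI.
rewrite big_const_seq count_predT iter_addr_0 -(mulr_natl (tail_prob k)); exact: lexx.
Qed.

Variables (o : lattice d) (K : nat) (U : seq (lattice d)) (g : lattice d -> R) (M : R).
Hypotheses (U_uniq : uniq U) (UV : {subset U <= V}).
Hypotheses (g_ge0 : forall x, 0 <= g x) (g_le : forall x, g x <= M).
Hypothesis g_exit : forall x, x \in U ->
  step D p (fun e => if x + e \in U then g (x + e) else 0) <= g x - 1.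
Local Notation w := (stab D p (halving R o) U (fun=> 1)).
Let Wmax := M * (K * size U)%N%:R + 1.

(** Two truncations are at work. Starts with more than [k] particles at a site are put into the last
    term, which leaves at most [n] particles in all; [K] limits only the part of the start that is
    stabilized in [U]. *)
Lemma inactive_late_bound k delta N l m : (0 < m)%N -> 0 < delta ->
  let n := (k * #|` V|)%N in
  delta * (2 * (rate_bound lambda * n%:R)) <= 1 -> 0 <= 1 - delta / Wmax ->
  prob Q (inactive_late o delta N (N + l) 0) <=
    2 ^+ m * Ex K (law nu K) U w (fun=> 0%N) + (1 - delta / Wmax) ^+ N * Wmax +
    m%:R^-1 * ((1 + delta) ^+ l - 1) + (N + l)%:R * mesh_error D lambda n delta +
    #|` V|%:R * tail_prob k.
Proof.
move=> m0 de0 n small rho0; have [_ Q_markov] := Q_law.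
have [X uX XE] := finite_configs k V.
set Z := inactive_late _ _ _ _ _.
have mZ : measurable Z.
  apply: (@measurable_event_upto _ _ [set o] ((N + l)%:R * delta)).
  by apply: event_upto_inactive_late => //; rewrite add0r.
have mE xi : measurable (config_at 0 xi) by exact: measurable_config_at.
have X_at_most xi : xi \in X -> at_most n xi.
  move=> /XE[xiV xik]; apply: (@at_most_sub _ V) => //; first exact: fset_uniq.
    by move=> x; apply: contraNT => /xiV ->.
  apply: (@leq_trans (\sum_(x <- V) k)%N); first exact: leq_sum.
  by rewrite big_const_seq count_predT iter_addn_0.
rewrite (Pr_split _ (lexx 0) uX mZ); apply: lerD; last first.
  apply: le_trans (prob_elsewhere XE); apply: le_prob => //.
  - by apply: measurableI => //; exact: measurable_elsewhere.
  - exact: measurable_elsewhere.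
have small' : delta * (rate_bound lambda * n%:R) <= 1.
  apply: le_trans small; rewrite ler_pM2l// ler_peMl ?mulr_ge0 ?rate_bound_ge0//.
  by rewrite ler1n.
have err0 : 0 <= mesh_error D lambda n delta.
  by rewrite /mesh_error mulr_ge0// mulr_ge0 ?sqr_ge0 ?expR_ge0.
pose zeta xi : lattice d -> nat := fun z => ((z \in U) * capped K (xi z))%N.
set A := (1 - _) ^+ N * Wmax; set E := _ * mesh_error _ _ _ _.
pose ev xi := total_weight V (visit_bound D p o delta l) (particles xi).
have step1 : \sum_(xi <- X) prob Q (Z `&` config_at 0 xi) <=
    \sum_(xi <- X) init_weight xi * (2 ^+ m * w (zeta xi) + m%:R^-1 * ev xi + (A + E)).
  rewrite big_seq [leRHS]big_seq; apply: ler_sum => xi xiX.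
  have nxi := X_at_most _ xiX; have [xiV xik] := (XE xi).1 xiX.
  have := inactive_late_le p_ge0 p_sum1 D_uniq D_neq0 p_supp lambda_gt0 Q_markov o N
    de0 small (N + l) (lexx 0) nxi (@event_uptoT _ _ _ _).
  rewrite setTI prob_config_at0 setIC => /le_trans; apply.
  rewrite ler_wpM2l ?init_weight_ge0//.
  have bz : below U (K * size U) (zeta xi) xi.
    split=> [x xU|].
      rewrite /zeta xU mul1n /capped /particles; by case: ifP.
    apply: (@leq_trans (\sum_(x <- U) K)%N).
      apply: leq_sum => x _; rewrite /zeta; case: (x \in U) => //.
      by rewrite mul1n cut_le.
    by rewrite big_const_seq count_predT iter_addn_0.
  have := inactivity_late_le p_ge0 p_sum1 D_uniq D_neq0 p_supp lambda_gt0 o de0 small'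
    err0 N U_uniq g_ge0 g_le g_exit rho0 m0 l (leqnn m) nxi bz.
  rewrite subnn add0r (expected_visitsE _ _ _ _ _ (fset_uniq V)); last first.
    by move=> x; apply: contraNT => /xiV ->.
  by rewrite -/(ev xi) -/A -/E => /le_trans; apply; lra.
apply: (le_trans step1).
have s1 : \sum_(xi <- X) init_weight xi <= 1 by exact: sum_init_weight.
have s2 : \sum_(xi <- X) init_weight xi * w (zeta xi) <= Ex K (law nu K) U w (fun=> 0%N).
  by apply: sum_init_cut0 => // c; exact: visits_ge0.
(* The mean count is at most 1 at each site, so the total mass of [visit_bound] bounds the expected
   visits, whatever the size of [V]. *)
have s3 : \sum_(xi <- X) init_weight xi * ev xi <= (1 + delta) ^+ l - 1.
  rewrite /ev /total_weight; under eq_bigr do rewrite mulr_sumr.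
  rewrite exchange_big/=.
  apply: le_trans (mass_le_visit_bound p_ge0 p_sum1 o de0 l (fset_uniq V)).
  rewrite big_seq [leRHS]big_seq; apply: ler_sum => x xV.
  under eq_bigr do rewrite mulrA.
  rewrite -mulr_suml ler_piMl//; first by apply: visit_bound_ge0.
  apply: (@sum_init_particles _ _ _ nu_iid _ _ mean_count _ k) => //.
  by move=> xi /XE[_ ->].
have -> : \sum_(xi <- X) init_weight xi * (2 ^+ m * w (zeta xi) + m%:R^-1 * ev xi + (A + E)) =
    2 ^+ m * (\sum_(xi <- X) init_weight xi * w (zeta xi)) +
    m%:R^-1 * (\sum_(xi <- X) init_weight xi * ev xi) + (A + E) * \sum_(xi <- X) init_weight xi.
  by rewrite !mulr_sumr -!big_split/=; apply: eq_bigr => xi _; ring.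
have A0 : 0 <= A.
  apply: mulr_ge0; first exact: exprn_ge0.
  by rewrite /Wmax addr_ge0// mulr_ge0// (le_trans (g_ge0 0) (g_le 0)).
have E0 : 0 <= E by rewrite mulr_ge0.
have := ler_wpM2l (exprn_ge0 m (ler0n R 2)) s2.
have mi0 : 0 <= m%:R^-1 :> R by rewrite invr_ge0.
have := ler_wpM2l mi0 s3.
have := ler_wpM2l A0 s1; have := ler_wpM2l E0 s1.
lra.
Qed.

Lemma Bernoulli_inv (t : R) N : 0 <= t <= 1 -> (1 - t) ^+ N <= (1 + N%:R * t)^-1.
Proof.
move=> /andP[t0 t1]; have pos n : 0 < 1 + n%:R * t by rewrite ltr_pwDl// mulr_ge0.
rewrite -[leRHS]mul1r ler_pdivlMr//.
elim: N => [|N IH]; first by rewrite expr0 mul0r addr0 mulr1.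
apply: le_trans IH; rewrite exprSr -mulrA ler_wpM2l ?exprn_ge0 ?subr_ge0//.
rewrite -natr1; have : 0 <= (N%:R + 1) * t ^+ 2 by rewrite mulr_ge0// sqr_ge0.
lra.
Qed.

Lemma tail_prob_small (e : R) : 0 < e -> exists k, tail_prob k <= e.
Proof.
move=> e0; pose B k := [set eta : config d | (k < num_particles (eta 0%R))%N].
have mB k : measurable (B k) by exact: (measurable_site 0 [set a | (k < num_particles a)%N]).
have cvg0 : nu \o B @ \oo --> nu (\bigcap_k B k).
  apply: nonincreasing_cvg_mu => //.
  - by rewrite (le_lt_trans (probability_le1 _ _))// ltry.
  - exact: bigcapT_measurable.
  - by apply/nonincreasing_seqP => k; apply/subsetPset => eta /=; exact: ltnW.
have B0 : \bigcap_k B k = set0.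
  apply/seteqP; split=> // eta /(_ (num_particles (eta 0)) I).
  by rewrite /B /= ltnn.
move: cvg0; rewrite B0 measure0 => /fine_cvgP[_].
move=> /cvgrPdist_le/(_ _ e0)[k _ /(_ k (leqnn _))] /=.
rewrite sub0r normrN => h; exists k; apply: le_trans h; exact: ler_norm.
Qed.

(* A measurable version of the event that [o] is inactive throughout
   [[T, T + S]]: only the multiples of [1 / h.+1] are tested, for every [h]. *)
Definition grid_inactive (T S : nat) : set (trajectory R d) :=
  \bigcap_h inactive_late o h.+1%:R^-1 (S * h.+1) (S * h.+1 + T * h.+1) 0.

Lemma event_upto_grid_inactive T S :
  event_upto [set o] (S + T)%:R (grid_inactive T S).
Proof.
apply: event_upto_bigcap => h; apply: event_upto_inactive_late => //.
by rewrite add0r -mulnDl natrM mulfK.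
Qed.

(** Neither [V] nor the mesh appears on the right: the mesh is refined for fixed [V], the geometric
    decay of the weight becoming the term in [S] and [(1 + de) ^+ (T * h.+1)] being at most
    [expR T%:R]. *)
Lemma grid_inactive_bound T S m : (0 < m)%N ->
  prob Q (grid_inactive T S) <= 2 ^+ m * Ex K (law nu K) U w (fun=> 0%N) +
    Wmax / (1 + S%:R / Wmax) + expR T%:R / m%:R.
Proof.
move=> m0; apply/ler_addgt0Pr => e e0.
have M0 : 0 <= M by exact: le_trans (g_ge0 0) (g_le 0).
have W1 : 1 <= Wmax by rewrite /Wmax lerDr mulr_ge0.
have W0 : 0 < Wmax by exact: lt_le_trans W1.
pose v : R := #|` V|%:R + 1.
have v0 : 0 < v by rewrite ltr_wpDl.
(* Half of the slack [e] goes to large initial counts, through [k]; the other half goes to the mesh,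
   chosen afterwards because its error grows with [n]. *)
have [k tk] := @tail_prob_small (e / 2 / v) ltac:(by rewrite !divr_gt0).
have tail_le : #|` V|%:R * tail_prob k <= e / 2.
  apply: (@le_trans _ _ (#|` V|%:R * (e / 2 / v))); first exact: ler_wpM2l.
  have vle : #|` V|%:R / v <= 1 by rewrite ler_pdivrMr// mul1r /v lerDl.
  by rewrite mulrCA ler_piMr// divr_ge0// ltW.
pose n := (k * #|` V|)%N; pose r := 2 * (rate_bound lambda * n%:R).
have r0 : 0 <= r by rewrite mulr_ge0// mulr_ge0// rate_bound_ge0.
(* [C * de] is the accumulated error of [(S + T) * h.+1] steps, each of order [de ^+ 2]. *)
pose C : R := (S + T)%:R * ((1 + n * (1 + size D))%:R * (r ^+ 2 * expR 1)).
have C0 : 0 <= C.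
  by apply: mulr_ge0 => //; apply: mulr_ge0 => //; rewrite mulr_ge0 ?sqr_ge0 ?expR_ge0.
have A0 : 0 <= r + C / (e / 2) by rewrite addr_ge0// divr_ge0// divr_ge0// ltW.
have := archi_boundP A0; set h := Num.bound _ => hA.
have hA' : r + C / (e / 2) <= h.+1%:R by rewrite (le_trans (ltW hA))// ler_nat.
pose de : R := h.+1%:R^-1; have de0 : 0 < de by rewrite invr_gt0.
have deh : de * h.+1%:R = 1 by rewrite mulVf.
have rh : r <= h.+1%:R by rewrite (le_trans _ hA')// lerDl divr_ge0// divr_ge0// ltW.
have Ch : C * de <= e / 2.
  rewrite /de ler_pdivrMr// mulrC -ler_pdivrMr ?divr_gt0//.
  by rewrite (le_trans _ hA')// lerDr.
have small : de * r <= 1 by rewrite -deh ler_pM2l.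
have deW : 0 <= de / Wmax <= 1.
  have de1 : de <= 1 by rewrite /de invf_le1// ler1n.
  by rewrite divr_ge0 ?(ltW de0) ?(ltW W0)//= ler_pdivrMr// mul1r (le_trans de1).
have rho0 : 0 <= 1 - de / Wmax by rewrite subr_ge0; case/andP: deW.
have mZ t : measurable (inactive_late o de (S * h.+1) t 0).
  apply: (@measurable_event_upto _ _ [set o] (t%:R * de)).
  by apply: event_upto_inactive_late => //; rewrite add0r.
apply: (@le_trans _ _ (prob Q (inactive_late o de (S * h.+1) (S * h.+1 + T * h.+1) 0))).
  apply: le_prob => //.
    by apply: (@measurable_event_upto _ _ [set o] (S + T)%:R); exact: event_upto_grid_inactive.
  by move=> u /(_ h I).
apply: (le_trans (inactive_late_bound (S * h.+1) (T * h.+1) m0 de0 small rho0)).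
have h1 : (1 - de / Wmax) ^+ (S * h.+1) * Wmax <= Wmax / (1 + S%:R / Wmax).
  rewrite mulrC ler_wpM2l ?(ltW W0)// (le_trans (Bernoulli_inv _ deW))//.
  by rewrite natrM mulrA -[_ * _ * de]mulrA [_ * de]mulrC deh mulr1.
have h2 : m%:R^-1 * ((1 + de) ^+ (T * h.+1) - 1) <= expR T%:R / m%:R.
  rewrite [leRHS]mulrC ler_wpM2l ?invr_ge0//.
  have -> : expR T%:R = expR de ^+ (T * h.+1).
    rewrite -expRM_natl natrM -mulrA [_ * de]mulrC deh mulr1; reflexivity.
  apply: (@le_trans _ _ ((1 + de) ^+ (T * h.+1))); first by rewrite gerBl.
  by rewrite lerXn2r ?nnegrE ?expR_ge0 ?addr_ge0 ?expR_ge1Dx// ltW.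
have h3 : (S * h.+1 + T * h.+1)%:R * mesh_error D lambda n de <= e / 2.
  apply: le_trans Ch; rewrite /mesh_error -/r -mulnDl natrM /C.
  set c := (1 + _)%:R.
  rewrite [leLHS](_ : _ = (S + T)%:R * (c * (r ^+ 2 * expR 1)) * de * (de * h.+1%:R)).
    by rewrite deh mulr1.
  by ring.
lra.
Qed.

End FiniteVolume.

(** * Law of the number of particles at a site *)

Section CountLaw.
Variables (R : realType) (d : nat).
Variable nu : probability (config d) R.
Implicit Types (eta : config d).

Local Notation q := (count_law nu).
Let B j := [set eta : config d | num_particles (eta 0%R) = j].

Let mB j : measurable (B j).
Proof. exact: (measurable_site 0 [set a | num_particles a = j]). Qed.

Lemma count_law_ge0 j : 0 <= q j.
Proof. exact: prob_ge0. Qed.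

Lemma measurable_fun_count (f : nat -> R) :
  measurable_fun setT (fun eta : config d => f (num_particles (eta 0%R))).
Proof.
move=> _ Y mY; rewrite setTI.
exact: (measurable_site 0 [set a | Y (f (num_particles a))]).
Qed.

Lemma integral_count (f : nat -> R) : (forall j, 0 <= f j) ->
  (\int[nu]_(eta in setT) (f (num_particles (eta 0%R)))%:E =
   \sum_(0 <= j <oo) (f j * q j)%:E)%E.
Proof.
move=> f0; have BT : \bigcup_j B j = setT.
  by apply/seteqP; split=> // eta _; exists (num_particles (eta 0%R)).
rewrite -BT ge0_integral_bigcup//.
- apply: eq_eseriesr => j _.
  rewrite (@eq_integral _ _ _ nu (B j) (fun=> (f j)%:E)); last first.
    by move=> eta; rewrite inE => ->.
  by rewrite integral_cst// EFinM; congr (_ * _)%E; exact: (probE nu (mB j)).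
- rewrite BT; apply/measurable_EFinP; exact: measurable_fun_count.
- by move=> eta _; rewrite lee_fin.
- by move=> i j _ _ [eta [/= <- <-]].
Qed.

Lemma sum_count_tail k : \sum_(j < k.+1) q j + tail_prob nu k = 1.
Proof.
rewrite -(probT nu) (_ : setT = [set eta : config d | num_particles (eta 0%R) <= k]%N `|`
    [set eta : config d | (k < num_particles (eta 0%R))%N]); last first.
  by apply/seteqP; split=> // eta _ /=; case: (leqP _ k) => h; [left|right].
rewrite prob_disjU; last 3 first.
- exact: (measurable_site 0 [set a | (num_particles a <= k)%N]).
- exact: (measurable_site 0 [set a | (k < num_particles a)%N]).
- by apply/seteqP; split=> // eta [/=]; lia.
congr (_ + _); rewrite -(big_mkord xpredT); elim: k => [|k IH].
  by rewrite big_nat1 /count_law; congr prob; apply/seteqP; split=> eta /=; lia.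
rewrite big_nat_recr//= IH -prob_disjU.
- by congr prob; apply/seteqP; split=> eta /=; lia.
- exact: (measurable_site 0 [set a | (num_particles a <= k)%N]).
- exact: mB.
- by apply/seteqP; split=> // eta [/=]; lia.
Qed.

Lemma law_count K j : (0 < j <= K)%N -> law nu K j = q j.
Proof.
move=> jK; rewrite /law /count_law; congr prob.
by apply/seteqP; split=> eta /=; rewrite /capped; case: ifP; lia.
Qed.

Lemma law0_ge K : q 0 <= law nu K 0.
Proof.
apply: le_prob; first exact: mB.
  exact: measurable_cut.
by move=> eta /= h; rewrite /capped; case: ifP.
Qed.

(** Bounds from below, uniformly in the cap, the probability of a nonzero count. *)
Lemma law0_le K k : (0 < k <= K)%N -> q k <= 1 - law nu K 0.
Proof.
move=> kK; rewrite -(law_count kK) lerBrDr addrC -(law_sum1 nu K).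
have /andP[k0 kK'] := kK; rewrite big_ord_recl lerD2l.
case: k k0 kK' {kK} => // k _ kK; rewrite (bigD1 (Ordinal kK))//=.
by rewrite lerDl sumr_ge0// => j _; exact: law_ge0.
Qed.

Lemma mean_law K : mean_mu K (law nu K) = \sum_(j < K.+1) j%:R * q j.
Proof.
apply: eq_bigr => -[[|j] jK] _ /=; first by rewrite mulr0 mul0r.
by rewrite mulrC law_count.
Qed.

Hypothesis density : ('E_nu[@particles_at_origin R d] = 1)%E.

Let mean_series : (\sum_(0 <= j <oo) (j%:R * q j)%:E = 1 :> \bar R)%E.
Proof.
rewrite -(integral_count (fun j => ler0n R j)) -density unlock.
by apply: eq_integral.
Qed.

Let term_ge0 j : 0 <= j%:R * q j.
Proof. by rewrite mulr_ge0// count_law_ge0. Qed.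

Lemma mean_count_le1 k : \sum_(j < k.+1) j%:R * q j <= 1.
Proof.
rewrite -lee_fin -mean_series -(big_mkord xpredT (fun j => j%:R * q j)) -sumEFin.
by apply: nneseries_lim_ge => j _ _; rewrite lee_fin.
Qed.

Lemma mean_count_ge e : 0 < e -> exists K0, forall K, (K0 <= K)%N ->
  1 - e <= \sum_(j < K.+1) j%:R * q j.
Proof.
move=> e0.
have := @is_cvg_nneseries R (fun j => (j%:R * q j)%:E) xpredT 0%N
  (fun j _ _ => term_ge0 j).
rewrite mean_series => /fine_cvgP[_ /cvgrPdist_le/(_ _ e0)[K0 _ h]].
exists K0 => K KK0; have /= := h K.+1 (leqW KK0).
rewrite sumEFin/= big_mkord ler_norml => /andP[_]; lra.
Qed.

Lemma count_law_pos : exists2 k, (0 < k)%N & 0 < q k.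
Proof.
apply: contrapT => h; have q0 k : k%:R * q k = 0.
  case: k => [|k]; first by rewrite mul0r.
  have [->|qk] := eqVneq (q k.+1) 0; first by rewrite mulr0.
  by case: h; exists k.+1 => //; rewrite lt_neqAle eq_sym qk count_law_ge0.
have := mean_series; rewrite eseries0; first by move/eqP; rewrite eq_sym onee_eq0.
by move=> j _ _; rewrite q0.
Qed.

Hypothesis variance_pos : (0 < 'V_nu[@particles_at_origin R d])%E.

(** If no site were vacant, mean 1 would exclude counts above 1; the count would be constant, with
    zero variance. *)
Lemma count_law0_pos : 0 < q 0.
Proof.
rewrite lt_neqAle eq_sym count_law_ge0 andbT; apply/eqP => q0.
have qj j : (1 < j)%N -> q j = 0.
  move=> j1; apply/le_anti; rewrite count_law_ge0 andbT.
  apply/ler_addgt0Pr => e e0; rewrite add0r.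
  have [k tk] := tail_prob_small nu e0.
  pose K := maxn j k.
  have tK : tail_prob nu K <= e.
    apply: le_trans tk; apply: le_prob.
    - exact: (measurable_site 0 [set a | (K < num_particles a)%N]).
    - exact: (measurable_site 0 [set a | (k < num_particles a)%N]).
    - by move=> eta /=; rewrite gtn_max => /andP[].
  apply: le_trans tK; have := sum_count_tail K; have := mean_count_le1 K.
  (* Each count from 1 on weighs at least its probability in the mean, and [j] at least twice; this
     excess can only come from the mass beyond [K]. *)
  suff : q j + \sum_(i < K.+1) q i <= \sum_(i < K.+1) i%:R * q i by lra.
  have jK : (j < K.+1)%N by rewrite ltnS leq_maxl.
  rewrite (bigD1 (Ordinal jK))//= [leRHS](bigD1 (Ordinal jK))//= addrA; apply: lerD.
    have := count_law_ge0 j; have : (2 : R) <= j%:R by rewrite ler_nat.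
    by nra.
  apply: ler_sum => -[[|i] iK] _ /=; first by rewrite q0 mulr0.
  by rewrite ler_peMl ?count_law_ge0// ler1n.
move: variance_pos; rewrite /variance unlock density/= unlock.
rewrite (_ : (\int[nu]_w _)%E = 0%E) ?ltxx//.
transitivity (\int[nu]_(eta in setT) (((num_particles (eta 0%R))%:R - 1) ^+ 2)%:E)%E.
  by apply: eq_integral => eta _; rewrite expr2.
rewrite (integral_count (f := fun j => (j%:R - 1) ^+ 2)); last by move=> j; exact: sqr_ge0.
rewrite eseries0// => -[|[|j]] _ _; first by rewrite q0 mulr0.
  by rewrite subrr expr0n/= mul0r.
by rewrite qj// mulr0.
Qed.

End CountLaw.

(** * The infinite system *)

Section StaysActive.
Variables (R : realType) (d : nat).
Implicit Types (x y z o : lattice d).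

Section Finish.
Variables (D : seq (lattice d)) (p : lattice d -> R).
Hypothesis p_ge0 : forall e, 0 <= p e.
Hypothesis p_sum1 : \sum_(e <- D) p e = 1.
Hypothesis D_uniq : uniq D.
Hypothesis D_neq0 : 0 \notin D.
Hypothesis p_supp : forall z, z \notin D -> p z = 0.
Hypothesis D_box : {subset D <= box 0 1}.
Variables (e0 : lattice d).
Hypotheses (e0D : e0 \in D) (pe0 : 0 < p e0).
Variable nu : probability (config d) R.
Hypothesis nu_iid : iid nu.
Hypothesis density : ('E_nu[@particles_at_origin R d] = 1)%E.
Hypothesis variance_pos : (0 < 'V_nu[@particles_at_origin R d])%E.

(** The radius [n] is fixed before the cap [K] and the margin [r]: the constant [C] of the hole term
    depends on [n], while [a] and [b] bound the capped laws uniformly in [K], so the choices are not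
    circular. *)
Lemma visits_small o (e : R) : 0 < e -> exists K r : nat,
  Ex K (law nu K) (box o r) (stab D p (halving R o) (box o r) (fun=> 1)) (fun=> 0%N) <= e.
Proof.
move=> e_gt0; have e0_neq0 : e0 != 0 by apply: contra D_neq0 => /eqP <-.
have [k k0 qk] := count_law_pos density; set a := count_law nu k in qk.
have q0 := count_law0_pos density variance_pos; set b := count_law nu 0 in q0.
(* With this threshold [(1 - mu 0) / 2 * H] is at least [2 / e]. *)
have [n nL] := sum_hit_box p_ge0 p_sum1 D_box o (4 / (e * a)) e0D pe0 e0_neq0.
set H := \sum_(x <- _) _ in nL.
pose C : R := (size (box o n))%:R * b ^- size (box o n) * (size (box o (n + n)))%:R.
have C0 : 0 <= C by rewrite !mulr_ge0// invr_ge0 exprn_ge0// ltW.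
(* One [g] pays for the mean lost by capping and one for the excess in [hole_density]; together they
   cost at most [e / 2] after multiplication by [C]. *)
pose g := Num.min 1 (e / (4 * (C + 1))).
have g0 : 0 < e / (4 * (C + 1)) by rewrite divr_gt0// mulr_gt0// ltr_wpDl.
have g01 : 0 < g <= 1 by rewrite /g lt_min ltr01 g0 ge_min lexx.
have [K0 K0E] := mean_count_ge density g0.
pose K := maxn k K0; pose mu := law nu K.
have mu_ge0 j : 0 <= mu j by exact: law_ge0.
have mu_sum1 : \sum_(j < K.+1) mu j = 1 by exact: law_sum1.
have mean1 : mean_mu K mu <= 1 by rewrite mean_law mean_count_le1.
have bmu : b <= mu 0 by exact: law0_ge.
have mu0_gt0 : 0 < mu 0 by exact: lt_le_trans bmu.
have amu : a <= 1 - mu 0 by apply: law0_le; rewrite k0 leq_maxl.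
have [r rE] := hole_density p_ge0 p_sum1 D_box e0D pe0 e0_neq0 mu_ge0 mu_sum1 mean1 g01.
exists K, (n + n + r)%N.
apply: (le_trans (Ex_visits_box p_ge0 p_sum1 D_box o mu_ge0 mu_sum1 mu0_gt0 n r)).
have eps_le : hole_prob D p K mu r <= e / (2 * (C + 1)).
  have := K0E K (leq_maxr _ _); rewrite -(mean_law nu K) -/mu => Ke.
  have gle : g <= e / (4 * (C + 1)) by rewrite /g ge_min lexx orbT.
  have -> : e / (2 * (C + 1)) = e / (4 * (C + 1)) + e / (4 * (C + 1)).
    by field; rewrite gt_eqF// ltr_wpDl.
  by lra.
rewrite -/H (_ : e = e / 2 + e / 2); last by field.
apply: lerD.
  have He : 2 / e <= (1 - mu 0) / 2 * H.
    apply: (@le_trans _ _ (a / 2 * (4 / (e * a)))).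
      by rewrite le_eqVlt; apply/orP; left; apply/eqP; field; rewrite !gt_eqF.
    apply: ler_pM => //; first by rewrite divr_ge0// ltW.
      by rewrite divr_ge0// mulr_ge0// ltW.
    by rewrite ler_pM2r.
  rewrite -[leRHS]invrK lef_pV2 ?posrE ?invr_gt0 ?divr_gt0//; last first.
    by rewrite ltr_pwDl// (le_trans _ He)// divr_ge0// ltW.
  by rewrite invf_div (le_trans He)// lerDr.
apply: (@le_trans _ _ (C * (e / (2 * (C + 1))))).
  rewrite [leLHS]mulrA /C; apply: ler_pM; last exact: eps_le.
  - by rewrite !mulr_ge0// invr_ge0 exprn_ge0// ltW.
  - exact: hole_prob_ge0.
  - rewrite ler_wpM2r// ler_wpM2l// lef_pV2 ?posrE ?exprn_gt0//.
    by rewrite lerXn2r ?nnegrE// ltW.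
have -> : C * (e / (2 * (C + 1))) = e / 2 * (C / (C + 1)).
  by field; rewrite gt_eqF// ltr_wpDl.
have C1 : C / (C + 1) <= 1 by rewrite ler_pdivrMr ?ltr_wpDl// mul1r lerDl.
by rewrite ler_piMr// divr_ge0// ltW.
Qed.

Variable lambda : \bar R.
Hypothesis lambda_gt0 : (0 < lambda)%E.
Variable P : probability (trajectory R d) R.
Hypothesis P_arw : arw_law p lambda nu P.

Lemma measurable_grid_inactive o T S : measurable (@grid_inactive R d o T S).
Proof. by apply: measurable_event_upto; exact: event_upto_grid_inactive. Qed.

(** The three terms are made small in turn: [m] depends on [T], then [K] and [U] on [m], and [S] on
    all of these. *)
Lemma grid_inactive_small o T (e : R) : 0 < e ->
  exists S, prob P (grid_inactive o T S) <= e.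
Proof.
move=> e_gt0; have e3 : 0 < e / 3 by rewrite divr_gt0.
have eT : 0 <= expR T%:R / (e / 3) :> R by rewrite divr_ge0 ?expR_ge0// ltW.
have := archi_boundP eT; set m := Num.bound _ => mE.
have m0 : (0 < m)%N by rewrite -(ltr_nat R); exact: le_lt_trans mE.
have [K [r Kr]] := @visits_small o (e / 3 / 2 ^+ m) ltac:(by rewrite divr_gt0 ?exprn_gt0).
set U := box o r in Kr.
have [g [M [g_ge0 g_le g_exit]]] := exit_time p_ge0 p_sum1 D_uniq D_neq0 e0D pe0 U.
pose W := M * (K * size U)%N%:R + 1.
have W0 : 0 < W.
  by rewrite /W ltr_wpDl// mulr_ge0// (le_trans (g_ge0 0) (g_le 0)).
have W2 : 0 <= W * W / (e / 3) by rewrite divr_ge0// ?ltW// mulr_gt0.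
have := archi_boundP W2; set S := Num.bound _ => SE.
exists S; have [PV [PV_law PV_cvg]] := P_arw.
rewrite -lee_fin -probE; last exact: measurable_grid_inactive.
have ev : event_upto [set` [fset o]%fset] (S + T)%:R (@grid_inactive R d o T S).
  have oE : [set o] `<=` [set` [fset o]%fset] by move=> z /= ->; rewrite inE.
  exact: (event_uptoS oE (lexx _) (@event_upto_grid_inactive R d o T S)).
have cv := PV_cvg [fset o]%fset (S + T)%:R _ (ler0n _ _) ev.
(* The bound holds for every [V] containing [U], hence also in the limit. *)
apply: (@cvge_to_le _ _ totally_filter _ _ _ _ cv).
exists [fset x in U]%fset => // V /= /fsubsetP UV.
rewrite probE; last exact: measurable_grid_inactive.
rewrite lee_fin.
have UV' : {subset U <= V} by move=> x xU; apply: UV; rewrite inE.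
apply: (le_trans (grid_inactive_bound p_ge0 p_sum1 D_uniq D_neq0 p_supp lambda_gt0 nu_iid
  (mean_count_le1 density) (PV_law V) o K (box_uniq _ _) UV' g_ge0 g_le g_exit T S m0)).
rewrite -/W (_ : e = e / 3 + e / 3 + e / 3); last by field.
apply: lerD; first apply: lerD.
- by move: Kr; rewrite ler_pdivlMr ?exprn_gt0// mulrC.
- rewrite ler_pdivrMr; last by rewrite ltr_pwDl// divr_ge0// ltW.
  apply: (@le_trans _ _ (e / 3 * (S%:R / W))); last by rewrite ler_pM2l// lerDr.
  rewrite mulrA ler_pdivlMr// [_ * S%:R]mulrC -ler_pdivrMr//; exact: ltW.
- by rewrite ler_pdivrMr ?ltr0n// mulrC -ler_pdivrMr// ltW.
Qed.

Lemma probability_forever_inactive o T : P (\bigcap_S grid_inactive o T S) = 0%E.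
Proof.
have mZ := @measurable_grid_inactive o T.
rewrite probE; last exact: bigcapT_measurable.
congr (_%:E); apply/le_anti; rewrite prob_ge0 andbT.
apply/ler_addgt0Pr => e e_gt0; rewrite add0r.
have [S SE] := grid_inactive_small o T e_gt0; apply: le_trans SE.
apply: le_prob => //; first exact: bigcapT_measurable.
by move=> w /(_ S I).
Qed.

End Finish.

Lemma forever_inactive o (T : nat) (w : trajectory R d) :
  (forall t, T%:R <= t -> num_active (w t o) = 0%N) ->
  (\bigcap_S grid_inactive o T S) w.
Proof.
move=> wT S _ h _; apply: (inactive_late_sub _ wT) => //.
by rewrite add0r natrD mulrDl addrC lerD2l natrM mulfK.
Qed.

(** Passes from sums over the lattice to the finite list of possible jumps; one of them has positive
    probability because the total is 1. *)
Lemma jump_support (p : lattice d -> R) : jump_distribution p -> exists D : seq (lattice d),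
  [/\ \sum_(e <- D) p e = 1, uniq D, 0 \notin D, (forall z, z \notin D -> p z = 0) &
      {subset D <= box 0 1} /\ exists2 e, e \in D & 0 < p e].
Proof.
move=> [p_ge0 p_sum p_nn _].
pose N : seq (lattice d) := [seq delta_mx 0 i | i <- enum 'I_d] ++
  [seq - delta_mx 0 i | i <- enum 'I_d].
pose D := undup [seq z <- N | p z != 0].
have DE z : (z \in D) = (p z != 0).
  rewrite mem_undup mem_filter; case: eqVneq => //= pz; rewrite mem_cat.
  have [i [->|->]] := p_nn z pz; first by rewrite map_f ?mem_enum.
  by rewrite (map_f (fun i => - delta_mx 0 i)) ?mem_enum ?orbT.
have Dnn z : z \in D -> exists i, z = delta_mx 0 i \/ z = - delta_mx 0 i.
  by rewrite DE => /p_nn.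
have uD : uniq D by exact: undup_uniq.
have p0 z : z \notin D -> p z = 0 by rewrite DE negbK => /eqP.
have sumD : \sum_(e <- D) p e = 1.
  rewrite -p_sum (@fsbigE _ _ _ _ _ D)//.
    by rewrite [RHS]big_mkcond; apply: eq_bigr => x _; rewrite in_setT.
  by move=> z _; apply: contraNeq => pz; rewrite DE.
exists D; split=> //.
  apply/negP => /Dnn[i []] /rowP/(_ i); rewrite !mxE !eqxx//.
split.
  move=> z /Dnn[i zi]; apply/mem_boxP => j; rewrite mxE subr0.
  by case: zi => ->; rewrite !mxE ?normrN; case: (_ && _).
apply: contrapT => h; have := sumD; rewrite big_seq big1.
  by move/eqP; rewrite eq_sym oner_eq0.
move=> e eD; apply/le_anti; rewrite p_ge0 andbT leNgt; apply/negP => pe.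
by apply: h; exists e.
Qed.

End StaysActive.

Theorem theorem10p4 (R : realType) (d : nat) (d_ge1 : (1 <= d)%N)
    (p : lattice d -> R) (p_jump : jump_distribution p)
    (nu : probability (config d) R) (nu_iid : iid nu)
    (nu_density : ('E_nu[@particles_at_origin R d] = 1)%E)
    (nu_variance : (0 < 'V_nu[@particles_at_origin R d])%E)
    (lambda : \bar R) (lambda_gt0 : (0 < lambda)%E)
    (P : probability (trajectory R d) R) (P_arw : arw_law p lambda nu P) :
  {ae P, forall w, stays_active w}.
Proof.
have [p_ge0 _ _ _] := p_jump.
have [D [p_sum1 D_uniq D_neq0 p_supp [D_box [e e_D pe]]]] := jump_support p_jump.
(* Inactivity after a real time implies inactivity after a later integer time, so countably many
   null events suffice. *)
pose Z (oT : lattice d * nat) := \bigcap_S @grid_inactive R d oT.1 oT.2 S.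
have Z0 oT : P.-negligible (Z oT).
  apply/negligibleP.
    by apply: bigcapT_measurable => S; exact: measurable_grid_inactive.
  exact: (probability_forever_inactive p_ge0 p_sum1 D_uniq D_neq0 p_supp D_box e_D pe
    nu_iid nu_density nu_variance lambda_gt0 P_arw).
apply: (@negligibleS _ _ _ _ (\bigcup_n
    (if @choice.unpickle (lattice d * nat)%type n is Some oT then Z oT else set0))); last first.
  apply: negligible_bigcup => n; case: (@choice.unpickle (lattice d * nat)%type n) => //.
  exact: negligible_set0.
move=> w; rewrite /setC /= => nw.
have [x [T xT]] : exists x T, ~ exists t, [/\ 0 <= t, T <= t & (0 < num_active (w t x))%N].
  by move: nw => /existsNP[x] /existsNP[T] h; exists x, T.
exists (choice.pickle (x, Num.bound `|T|)) => //; rewrite choice.pickleK.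
apply: forever_inactive => t Tt; apply/eqP; rewrite -leqn0 leqNgt; apply/negP => act.
apply: xT; exists t; split=> //; first exact: le_trans (ler0n _ _) Tt.
apply: le_trans Tt; apply: (le_trans (ler_norm T)); apply/ltW.
by apply: archi_boundP.
Qed.
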